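(* Let $F_N(\beta)$ denote the free energy of the Sherrington–Kirkpatrick model with $N$ spins at inverse temperature $\beta>0$, and let $\beta_c=1/\sqrt{2}$. The following statements hold: 1. There exists a constant $C>0$ such that $$\operatorname{Var}\bigl(F_N(\beta_c)\bigr)\leq C\bigl((\log N)^2+1\bigr)\quad\text{for all integers } N\geq 1.$$ 2. For any fixed $\alpha>0$ and $d>0$, there exists a constant $C$ depending only on $\alpha$ and $d$ such that $$\operatorname{Var}\left(F_N\left(\sqrt{\beta_c^2+dN^{-\alpha}}\right)\right)\leq C\bigl((\log N)^2+N^{1-\alpha}\bigr)\quad\text{for all integers } N\geq 1.$$
   Context: For an integer $N\geq 1$, let $\Sigma_N=\{-1,+1\}^N$ and let $(g_{ij})_{1\leq i,j\leq N}$ be independent standard Gaussian random variables (one for each ordered pair $(i,j)$, including $i=j$). The Hamiltonian of the Sherrington–Kirkpatrick model is $$H_N(\sigma)=\frac{1}{\sqrt{N}}\sum_{1\leq i,j\leq N}g_{ij}\sigma_i\sigma_j,\qquad \sigma\in\Sigma_N.$$ The free energy at inverse temperature $\beta>0$ is the random variable (not normalized by $N$) $$F_N(\beta)=\log\sum_{\sigma\in\Sigma_N}\exp\bigl(\beta H_N(\sigma)\bigr).$$ $\operatorname{Var}$ denotes the variance with respect to the randomness of $(g_{ij})$, and $\log$ is the natural logarithm. *)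

(* Defs.v *)
From HB Require Import structures.
From mathcomp Require Import all_boot all_order all_algebra.
From mathcomp Require Import all_classical all_reals all_analysis.

Set Implicit Arguments.
Unset Strict Implicit.
Unset Printing Implicit Defensive.

Import Order.TTheory GRing.Theory Num.Theory.
Import numFieldNormedType.Exports.

Local Open Scope classical_set_scope.
Local Open Scope ring_scope.

(* The law of X is only compared with the Gaussian law on Borel sets: on the
   other sets the values of both set functions are meaningless. *)
Definition standard_gaussian (disp : measure_display)
    (T : measurableType disp) (R : realType) (P : probability T R)
    (X : {RV P >-> R}) : Prop :=
  forall A : set R, measurable A ->
    distribution P X A = normal_prob 0 1 A.

Definition mutually_independent (disp : measure_display)
    (T : measurableType disp) (R : realType) (P : probability T R)
    (I : finType) (X : I -> {RV P >-> R}) : Prop :=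
  forall (J : {set I}) (A : I -> set R),
    (forall i, i \in J -> measurable (A i)) ->
    P (\bigcap_(i in [set` J]) (X i @^-1` A i)) =
    (\prod_(i in J) P (X i @^-1` A i))%E.

(* Independence is over all N ^ 2 ordered pairs, diagonal included; in
   particular g i j and g j i are different variables when i != j. *)
Definition gaussian_disorder (disp : measure_display)
    (T : measurableType disp) (R : realType) (P : probability T R)
    (N : nat) (g : 'I_N -> 'I_N -> {RV P >-> R}) : Prop :=
  (forall i j, standard_gaussian (g i j)) /\
  mutually_independent (fun ij : 'I_N * 'I_N => g ij.1 ij.2).

(* {-1, +1}^N is encoded by {ffun 'I_N -> bool}: false is the spin +1 and
   true is the spin -1. *)
Definition spin (R : realType) (N : nat) (s : {ffun 'I_N -> bool})
    (i : 'I_N) : R := (-1) ^+ s i.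

Definition sk_hamiltonian (R : realType) (N : nat) (g : 'I_N -> 'I_N -> R)
    (s : {ffun 'I_N -> bool}) : R :=
  (Num.sqrt N%:R)^-1 *
  \sum_(i < N) \sum_(j < N) g i j * spin R s i * spin R s j.

Definition sk_free_energy (R : realType) (N : nat) (beta : R)
    (g : 'I_N -> 'I_N -> R) : R :=
  ln (\sum_(s : {ffun 'I_N -> bool}) expR (beta * sk_hamiltonian g s)).

Definition sk_free_energy_rv (disp : measure_display)
    (T : measurableType disp) (R : realType) (P : probability T R)
    (N : nat) (beta : R) (g : 'I_N -> 'I_N -> {RV P >-> R}) : T -> R :=
  fun w => sk_free_energy beta (fun i j => g i j w).

Definition beta_c (R : realType) : R := 1 / Num.sqrt 2.

(* Main.v *)
Require Import Defs.
From HB Require Import structures.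
From mathcomp Require Import all_boot all_order all_algebra.
From mathcomp Require Import all_classical all_reals all_analysis.
From mathcomp Require Import measurable_realfun ring lra.
Set Implicit Arguments.
Unset Strict Implicit.
Unset Printing Implicit Defensive.
Import Order.TTheory GRing.Theory Num.Theory.
Import numFieldNormedType.Exports.
Local Open Scope classical_set_scope.
Local Open Scope ring_scope.

(** * The variance of the Sherrington-Kirkpatrick free energy

    The free energy [F] is a function of the [N ^ 2] independent Gaussian
    variables. Consider two copies of the disorder that share each variable with
    probability [t] and are independent otherwise. The covariance of [F] under
    the two copies, which is [energy] minus the squared mean, is 0 at [t = 0] and the
    variance at [t = 1]. Its derivative in [t] is the mean overlap of two Gibbs
    samples, one for each copy ([energy_free_step]); this mean overlap increases
    with [t] and is at most [beta^2 N].

    For [t] below [tc = beta_c^2 / beta^2] the mean overlap is much smaller. By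
    Jensen's inequality, [(tc - t)] times the overlap is at most the logarithm
    of the annealed partition function of pairs with the interaction of level
    [tc], minus twice the mean of [F] ([replica_annealed]). The interaction of
    level [tc] is the critical one, for which the second moment of the partition
    function is at most [N + 1] times its squared mean ([overlap_second_moment]).
    So the mean overlap is at most [(O (log N) + 2 gap) / (tc - t)], where [gap] is
    the difference between the annealed free energy and the mean of [F].
    Integrating up to distance [1 / N] from [tc] gives another factor [log N], and
    the levels above [tc] contribute [(1 - tc) beta^2 N = (beta^2 - beta_c^2) N],
    which is 0 in the first part and of order [N^(1 - alpha)] in the second
    ([variance_free_le]).

    The gap is bounded by the second moment. At the critical temperature,
    revealing the disorder one variable at a time in a world with a planted
    configuration shows that the mean of [F] is at least its annealed value
    minus the logarithm of the relative second moment, up to an error [O(1)]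
    ([planted_step], [mean_free_ge]); so the gap is [O (log N)]. Above the critical
    temperature, convexity in [beta] gives [gap <= 2 gap_c + N (beta - beta_c)^2]
    ([annealed_gap_midpoint]), and the last term, multiplied by [log N], is still
    of order [N^(1 - alpha)].

    To replace conditional expectations and derivatives by finite sums, the
    Gaussian variables are rounded to a finite set of values. The rounding is odd
    and decreases absolute values, so it keeps the sub-Gaussian bound on which
    the annealed estimates rely ([rounded_mgf]), and for a fine mesh the variance
    of [F] is at most twice that of its rounded version plus [O(1)]
    ([variance_transfer]). The derivative in [t] becomes an
    expansion in each variable, whose errors again sum up to [O(1)], and the
    integral over [t] becomes a sum over dyadic levels. *)

(** * Averages over a finite set *)

Section FiniteAverages.
Context {R : realType} {T : finType}.
Implicit Types (w f g : T -> R).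

Definition weight w := (forall t, 0 <= w t) /\ \sum_t w t = 1.

Definition avg w f := \sum_t w t * f t.

Lemma avg_cst w c : weight w -> avg w (fun=> c) = c.
Proof. by case=> _ w1; rewrite /avg -mulr_suml w1 mul1r. Qed.

Lemma avgD w f g : avg w (fun t => f t + g t) = avg w f + avg w g.
Proof. by rewrite /avg -big_split; apply: eq_bigr => t _; rewrite mulrDr. Qed.

Lemma avgZ w c f : avg w (fun t => c * f t) = c * avg w f.
Proof. by rewrite /avg big_distrr; apply: eq_bigr => t _; rewrite mulrCA. Qed.

Lemma avgB w f g : avg w (fun t => f t - g t) = avg w f - avg w g.
Proof. by rewrite /avg -sumrB; apply: eq_bigr => t _; rewrite mulrBr. Qed.

Lemma eq_avg w f g : f =1 g -> avg w f = avg w g.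
Proof. by move=> fg; apply: eq_bigr => t _; rewrite fg. Qed.

Lemma avg_sum (J : finType) (P : pred J) w (f : J -> T -> R) :
  avg w (fun t => \sum_(j | P j) f j t) = \sum_(j | P j) avg w (f j).
Proof.
by rewrite /avg exchange_big; apply: eq_bigr => t _; rewrite big_distrr.
Qed.

Lemma avg_le w f g : weight w -> (forall t, f t <= g t) -> avg w f <= avg w g.
Proof. by case=> w0 _ fg; apply: ler_sum => t _; apply: ler_wpM2l. Qed.

Lemma avg_ge0 w f : weight w -> (forall t, 0 <= f t) -> 0 <= avg w f.
Proof. by case=> w0 _ f0; apply: sumr_ge0 => t _; apply: mulr_ge0. Qed.

Lemma avg_gt0 w f : weight w -> (forall t, 0 < f t) -> 0 < avg w f.
Proof.
move=> [w0 w1] f0; rewrite lt_def avg_ge0 ?andbT//; last by move=> t; apply: ltW.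
apply/eqP => a0; suff : \sum_t w t = 0 by rewrite w1 => /eqP; rewrite oner_eq0.
apply: big1 => t _; apply/eqP.
have /psumr_eq0P := a0; move=> /(_ _ t isT) H; have := H _.
move=> /(_ (fun t _ => mulr_ge0 (w0 t) (ltW (f0 t)))) /eqP.
by rewrite mulf_eq0 (gt_eqF (f0 t)) orbF.
Qed.

Lemma avg_le_cst w f c : weight w -> (forall t, f t <= c) -> avg w f <= c.
Proof. by move=> hw fc; rewrite -(avg_cst c hw); apply: avg_le. Qed.

Lemma avg_ge_cst w f c : weight w -> (forall t, c <= f t) -> c <= avg w f.
Proof. by move=> hw fc; rewrite -(avg_cst c hw); apply: avg_le. Qed.

Lemma ln_le_tangent (a z : R) : 0 < a -> 0 < z -> ln z <= ln a + z / a - 1.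
Proof.
move=> a0 z0; have -> : ln z = ln a + ln (z / a).
  by rewrite ln_div ?posrE// addrCA subrr addr0.
rewrite -addrA lerD2l; have -> : ln (z / a) = ln (1 + (z / a - 1)).
  by rewrite addrC subrK.
by apply: le_ln1Dx; rewrite ltrBrDl subrr divr_gt0.
Qed.

Lemma avg_ln w f : weight w -> (forall t, 0 < f t) ->
  avg w (fun t => ln (f t)) <= ln (avg w f).
Proof.
move=> hw f0; have A0 := avg_gt0 hw f0.
apply: (@le_trans _ _ (avg w (fun t => (ln (avg w f) - 1) + (avg w f)^-1 * f t))).
  apply: avg_le => // t; have := ln_le_tangent A0 (f0 t).
  by lra.
by rewrite avgD avgZ avg_cst// mulVf ?gt_eqF// subrK.
Qed.

Lemma avg_sqr w f : weight w -> avg w f ^+ 2 <= avg w (fun t => f t ^+ 2).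
Proof.
move=> hw; set m := avg w f.
have : 0 <= avg w (fun t => (f t - m) ^+ 2).
  by apply: avg_ge0 => // t; apply: sqr_ge0.
rewrite (@eq_avg _ _ (fun t => f t ^+ 2 - (2 * m) * f t + m ^+ 2)); last first.
  by move=> t; ring.
by rewrite avgD avgB avgZ avg_cst// -/m; lra.
Qed.

End FiniteAverages.

(** * Product weights *)

Section ProductWeights.
Context {R : realType} {I Y : finType}.
Implicit Types (q : I -> Y -> R) (f : {ffun I -> Y} -> R) (y : {ffun I -> Y}).

Definition prodw q y := \prod_c q c (y c).

Definition upd y c u : {ffun I -> Y} := [ffun c' => if c' == c then u else y c'].

Lemma upd_same y c u : upd y c u c = u.
Proof. by rewrite ffunE eqxx. Qed.

Lemma upd_other y c u c' : c' != c -> upd y c u c' = y c'.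
Proof. by rewrite ffunE => /negbTE->. Qed.

Lemma upd_upd y c u v : upd (upd y c u) c v = upd y c v.
Proof. by apply/ffunP => c'; rewrite !ffunE; case: eqP. Qed.

Lemma upd_id y c : upd y c (y c) = y.
Proof. by apply/ffunP => c'; rewrite !ffunE; case: eqP => // ->. Qed.

Lemma avg_prod q (F : I -> Y -> R) :
  avg (prodw q) (fun y => \prod_c F c (y c)) = \prod_c avg (q c) (F c).
Proof.
rewrite /avg /prodw bigA_distr_bigA; apply: eq_bigr => y _.
by rewrite -big_split.
Qed.

Lemma weight_prodw q : (forall c, weight (q c)) -> weight (prodw q).
Proof.
move=> hq; split; first by move=> y; apply: prodr_ge0 => c _; apply: (hq c).1.
transitivity (avg (prodw q) (fun y => \prod_(c : I) 1)).
  by apply: eq_bigr => y _; rewrite big1_eq mulr1.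
rewrite (avg_prod q (fun _ _ => 1)) big1// => c _.
by rewrite (avg_cst 1 (hq c)).
Qed.

Definition rest q c y := \prod_(c' | c' != c) q c' (y c').

Lemma prodw_rest q c y : prodw q y = q c (y c) * rest q c y.
Proof. by rewrite /prodw (bigD1 c). Qed.

Lemma rest_upd q c y u : rest q c (upd y c u) = rest q c y.
Proof. by apply: eq_bigr => c' cc'; rewrite upd_other. Qed.

(** The configurations with [y c = u0] represent the configurations off [c],
    so this is integration over one coordinate first. *)
Lemma avg_split q c u0 f :
  avg (prodw q) f =
  \sum_(y : {ffun I -> Y} | y c == u0) rest q c y * avg (q c) (fun u => f (upd y c u)).
Proof.
rewrite /avg (partition_big (fun y : {ffun I -> Y} => upd y c u0)
  (fun y : {ffun I -> Y} => y c == u0)) /=;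
  last by move=> y _; rewrite upd_same.
apply: eq_bigr => y /eqP yc.
rewrite (reindex_onto (fun u => upd y c u) (fun y : {ffun I -> Y} => y c)) /=; last first.
  by move=> z /eqP <-; rewrite upd_upd upd_id.
rewrite big_distrr; apply: eq_big => [u|u _].
  by rewrite upd_same upd_upd eqxx andbT -yc upd_id eqxx.
by rewrite (prodw_rest q c) rest_upd upd_same mulrAC mulrC.
Qed.

Lemma sum_rest q c u0 : (forall c, weight (q c)) ->
  \sum_(y : {ffun I -> Y} | y c == u0) rest q c y = 1.
Proof.
move=> hq; rewrite -[RHS](avg_cst 1 (weight_prodw hq)) (avg_split _ c u0).
by apply: eq_bigr => y _; rewrite (avg_cst 1 (hq c)) mulr1.
Qed.

Lemma avg_resample q c f : weight (q c) ->
  avg (prodw q) (fun y => avg (q c) (fun u => f (upd y c u))) = avg (prodw q) f.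
Proof.
move=> hq.
have [u0 _|Y0] := pickP (mem Y); last first.
  have [_] := hq; rewrite big_pred0 => [/esym/eqP|u]; last by have := Y0 u.
  by rewrite oner_eq0.
rewrite (avg_split _ c u0) [RHS](avg_split _ c u0); apply: eq_bigr => y _.
congr (_ * _); rewrite -[RHS](avg_cst _ hq); apply: eq_avg => u.
by apply: eq_avg => v; rewrite upd_upd.
Qed.

Lemma avg_coord q c (h : Y -> R) : (forall c, weight (q c)) ->
  avg (prodw q) (fun y => h (y c)) = avg (q c) h.
Proof.
move=> hq; rewrite -(avg_resample (c := c))// -[RHS](avg_cst _ (weight_prodw hq)).
by apply: eq_avg => y; apply: eq_avg => u; rewrite upd_same.
Qed.

(** The weights of the coordinate [c] sum to 1 in both averages, and the weights
    of the other coordinates agree. *)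
Lemma avg_indep q q' c f :
  weight (q c) -> weight (q' c) -> (forall c', c' != c -> q c' =1 q' c') ->
  (forall y u, f (upd y c u) = f y) -> avg (prodw q) f = avg (prodw q') f.
Proof.
move=> hq hq' qq' fc.
have [u0 _|Y0] := pickP (mem Y); last first.
  by rewrite /avg !big_pred0// => y; have := Y0 (y c).
rewrite !(avg_split _ c u0); apply: eq_bigr => y _.
rewrite (@eq_avg _ _ _ _ (fun=> f y)) ?avg_cst//.
rewrite (@eq_avg _ _ _ (fun u => f (upd y c u)) (fun=> f y)) ?avg_cst//.
by congr (_ * _); apply: eq_bigr => c' cc'; rewrite qq'.
Qed.

End ProductWeights.

(** * Partial information about independent coordinates *)

Section Erasure.
Context {R : realType} {I X : finType} {p : X -> R}.
Hypothesis hp : weight p.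
Implicit Types (t : I -> R) (f h l m : {ffun I -> X} -> R)
  (x : {ffun I -> X}) (w : {ffun I -> option X}).

Lemma sum_option (F : option X -> R) :
  \sum_o F o = F None + \sum_u F (Some u).
Proof.
rewrite (bigD1 None)//=; congr (_ + _).
rewrite (reindex_omap Some id) => [|[]//].
by apply: eq_bigl => u /=; rewrite eqxx.
Qed.

(** Each coordinate [c] is revealed with probability [t c]; [None] stands for
    an erased coordinate. *)
Definition erasure t (c : I) (o : option X) : R :=
  if o is Some u then t c * p u else 1 - t c.

Definition posterior (o : option X) (u : X) : R :=
  if o is Some v then (u == v)%:R else p u.

Definition cmean f w := avg (prodw (fun c => posterior (w c))) f.

(** For [t] constant, this is the covariance of [f] under two copies of the
    coordinates that share each coordinate with probability [t], independently
    of the other coordinates. *)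
Definition energy t f := avg (prodw (erasure t)) (fun w => cmean f w ^+ 2).

Definition levels t := forall c, 0 <= t c <= 1.

Lemma avg_erasure t c (F : option X -> R) :
  avg (erasure t c) F = t c * avg p (fun u => F (Some u)) + (1 - t c) * F None.
Proof.
rewrite /avg sum_option addrC /=; congr (_ + _).
by rewrite big_distrr; apply: eq_bigr => u _; rewrite /= mulrA.
Qed.

Lemma weight_erasure t c : levels t -> weight (erasure t c).
Proof.
move=> /(_ c)/andP[t0 t1]; split.
  by case=> [u|] /=; rewrite ?subr_ge0// mulr_ge0// hp.1.
have := avg_erasure t c (fun=> 1); rewrite avg_cst// !mulr1 addrC subrK /avg.
by under eq_bigr do rewrite mulr1.
Qed.

Lemma weight_posterior o : weight (posterior o).
Proof.
case: o => [v|] //=; split; first by move=> u; rewrite /posterior ler0n.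
by rewrite (bigD1 v)//= eqxx big1 ?addr0// => u /negbTE ->.
Qed.

Lemma avg_posterior_Some v (F : X -> R) : avg (posterior (Some v)) F = F v.
Proof.
rewrite /avg (bigD1 v)//= eqxx mul1r big1 ?addr0// => u /negbTE ->.
by rewrite mul0r.
Qed.

Lemma weight_posteriors w : weight (prodw (fun c => posterior (w c))).
Proof. by apply: weight_prodw => c; apply: weight_posterior. Qed.

Lemma weight_erasures t : levels t -> weight (prodw (erasure t)).
Proof. by move=> ht; apply: weight_prodw => c; apply: weight_erasure. Qed.

Lemma cmeanD f h w : cmean (fun x => f x + h x) w = cmean f w + cmean h w.
Proof. exact: avgD. Qed.

(** The tower property. *)
Lemma avg_cmean t f : levels t ->
  avg (prodw (erasure t)) (cmean f) = avg (prodw (fun=> p)) f.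
Proof.
move=> ht; rewrite /cmean /avg.
under eq_bigr do rewrite big_distrr /=.
rewrite exchange_big /=; apply: eq_bigr => x _.
under eq_bigr do rewrite mulrA.
rewrite -big_distrl /=; congr (_ * _).
under eq_bigr do rewrite -big_split /=.
rewrite -(bigA_distr_bigA (fun c o => erasure t c o * posterior o (x c))).
apply: eq_bigr => c _; have := avg_erasure t c (posterior^~ (x c)).
rewrite /avg => ->; rewrite [\sum_u _](_ : _ = p (x c)) /=.
  by rewrite -mulrDl subrKC mul1r.
rewrite (bigD1 (x c))//= eqxx mulr1 big1 ?addr0// => u.
by rewrite eq_sym => /negbTE ->; rewrite mulr0.
Qed.

Lemma cmean_indep f c w o o' : (forall x u, f (upd x c u) = f x) ->
  cmean f (upd w c o) = cmean f (upd w c o').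
Proof.
move=> fc; apply: (@avg_indep _ _ _ _ _ c) => //; try exact: weight_posterior.
by move=> c' cc' u; rewrite !upd_other.
Qed.

Lemma cmean_None f c w :
  cmean f (upd w c None) = avg p (fun u => cmean f (upd w c (Some u))).
Proof.
have [u0 _|X0] := pickP (mem X); last first.
  by have := hp.2; rewrite big_pred0// => /esym/eqP; rewrite oner_eq0.
rewrite /cmean (avg_split _ c u0) upd_same.
under [RHS]eq_avg => u.
  rewrite (avg_split _ c u0) upd_same.
  under eq_bigr do rewrite avg_posterior_Some; over.
rewrite avg_sum /=; apply: eq_bigr => x _; rewrite -avgZ.
apply: eq_avg => u; congr (_ * _); apply: eq_bigr => c' cc'.
by rewrite !upd_other.
Qed.

(** [revealed] and [hidden] are the energy conditioned on the fate of the
    coordinate [c]; the sum over [w c == None] enumerates the other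
    coordinates. *)
Definition revealed t c f := \sum_(w : {ffun I -> option X} | w c == None)
  rest (erasure t) c w * avg p (fun u => cmean f (upd w c (Some u)) ^+ 2).

Definition hidden t c f := \sum_(w : {ffun I -> option X} | w c == None)
  rest (erasure t) c w * cmean f (upd w c None) ^+ 2.

Lemma energy_split t c f :
  energy t f = t c * revealed t c f + (1 - t c) * hidden t c f.
Proof.
rewrite /energy (avg_split _ c None) /revealed /hidden !big_distrr -big_split /=.
by apply: eq_bigr => w _; rewrite avg_erasure; ring.
Qed.

Lemma rest_erasure_ge0 t c w : levels t -> 0 <= rest (erasure t) c w.
Proof.
by move=> ht; apply: prodr_ge0 => c' _; apply: (weight_erasure _ ht).1.
Qed.

Lemma hidden_le_revealed t c f : levels t -> hidden t c f <= revealed t c f.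
Proof.
move=> ht; apply: ler_sum => w _; apply: ler_wpM2l; first exact: rest_erasure_ge0.
by rewrite cmean_None; exact: avg_sqr.
Qed.

Lemma hidden_le_energy t c f : levels t -> hidden t c f <= energy t f.
Proof.
move=> ht; have /andP[t0 t1] := ht c; have := hidden_le_revealed c f ht.
rewrite -subr_ge0 => hr; rewrite (energy_split t c).
by have := mulr_ge0 t0 hr; move: (hidden _ _ _) (revealed _ _ _) => h r; lra.
Qed.

Lemma energy_le_avg t f : levels t ->
  energy t f <= avg (prodw (fun=> p)) (fun x => f x ^+ 2).
Proof.
move=> ht; rewrite -(avg_cmean _ ht); apply: avg_le; first exact: weight_erasures.
by move=> w; apply: avg_sqr; exact: weight_posteriors.
Qed.

Lemma energyD t f h : levels t ->
  energy t (fun x => f x + h x) <= 2 * energy t f + 2 * energy t h.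
Proof.
move=> ht; rewrite /energy -!avgZ -avgD; apply: avg_le; first exact: weight_erasures.
move=> w; rewrite cmeanD; have := sqr_ge0 (cmean f w - cmean h w); nra.
Qed.

Definition set_level t c a : I -> R := fun c' => if c' == c then a else t c'.

Lemma energy_set_level t c a f :
  energy (set_level t c a) f = a * revealed t c f + (1 - a) * hidden t c f.
Proof.
have E w : rest (erasure (set_level t c a)) c w = rest (erasure t) c w.
  by apply: eq_bigr => c' cc'; rewrite /erasure /set_level (negbTE cc').
rewrite (energy_split _ c) /set_level eqxx.
by congr (_ * _ + _ * _); apply: eq_bigr => w _; rewrite E.
Qed.

Lemma energy_set_level_mono t c a b f : levels t -> a <= b ->
  energy (set_level t c a) f <= energy (set_level t c b) f.
Proof.
move=> ht ab; rewrite !energy_set_level; have := hidden_le_revealed c f ht.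
rewrite -subr_ge0 => hr; rewrite -subr_ge0 in ab; have := mulr_ge0 ab hr.
by move: (hidden _ _ _) (revealed _ _ _) => h r; lra.
Qed.

(** Only the part of [f] that depends on the coordinate [c] feels whether this
    coordinate is revealed. *)
Lemma revealed_sub_hidden t c f f0 l : levels t ->
  (forall x, f x = f0 x + l x) -> (forall x u, f0 (upd x c u) = f0 x) ->
  revealed t c f - hidden t c f <= revealed t c l.
Proof.
move=> ht fE f0c; rewrite /revealed /hidden -sumrB; apply: ler_sum => w _.
rewrite -mulrBr; apply: ler_wpM2l; first exact: rest_erasure_ge0.
rewrite cmean_None; set a := cmean f0 (upd w c None).
have cE u : cmean f (upd w c (Some u)) = a + cmean l (upd w c (Some u)).
  rewrite /a (cmean_indep _ _ (Some u) f0c) -cmeanD.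
  by apply: eq_avg => x; rewrite fE.
rewrite (@eq_avg _ _ _ (fun u => cmean f _) _ cE) avgD avg_cst//.
rewrite (@eq_avg _ _ _ (fun u => cmean f _ ^+ 2) (fun u => a ^+ 2 +
  (2 * a) * cmean l (upd w c (Some u)) + cmean l (upd w c (Some u)) ^+ 2));
  last by move=> u; rewrite cE; ring.
rewrite !avgD avgZ avg_cst//; set m := avg p (fun u => cmean l _).
by have := sqr_ge0 m; nra.
Qed.

(** Since [m0] does not depend on the coordinate [c], the main part of [l] is
    a product of independent factors, of which only [m0] feels the erasure of
    the other coordinates. *)
Lemma revealed_le t c l z m0 r s2 r2 : levels t ->
  (forall x, `|l x - z (x c) * m0 x| <= r (x c)) ->
  (forall x u, m0 (upd x c u) = m0 x) ->
  avg p (fun u => z u ^+ 2) <= s2 -> avg p (fun u => r u ^+ 2) <= r2 ->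
  revealed t c l <= 2 * s2 * hidden t c m0 + 2 * r2.
Proof.
move=> ht hl m0c hz hr.
have -> : 2 * r2 = \sum_(w : {ffun I -> option X} | w c == None)
    rest (erasure t) c w * (2 * r2).
  by rewrite -big_distrl /= sum_rest ?mul1r// => c'; exact: weight_erasure.
rewrite /revealed /hidden big_distrr /= -big_split /=; apply: ler_sum => w _.
rewrite mulrCA -mulrDr; apply: ler_wpM2l; first exact: rest_erasure_ge0.
set a := cmean m0 (upd w c None).
apply: (@le_trans _ _ (avg p (fun u => (2 * a ^+ 2) * z u ^+ 2 + 2 * r u ^+ 2))).
  apply: avg_le => // u; set b := cmean l _.
  have : `|b - z u * a| <= r u.
    rewrite /b /a (cmean_indep _ _ (Some u) m0c) -avgZ -avgB.
    have [u0 _|X0] := pickP (mem X); last by have := X0 u.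
    rewrite (avg_split _ c u0) upd_same.
    under eq_bigr do rewrite avg_posterior_Some.
    rewrite (le_trans (ler_norm_sum _ _ _))//.
    rewrite -[leRHS]mul1r -(sum_rest (q := fun c' => posterior (upd w c (Some u) c')) c u0);
      last by move=> c'; exact: weight_posterior.
    rewrite big_distrl; apply: ler_sum => x _; rewrite normrM ger0_norm.
      apply: ler_wpM2l; last by have := hl (upd x c u); rewrite upd_same.
      by apply: prodr_ge0 => c' _; apply: (weight_posterior _).1.
    by apply: prodr_ge0 => c' _; apply: (weight_posterior _).1.
  rewrite ler_norml => /andP[h1 h2].
  have h3 : (b - z u * a) ^+ 2 <= r u ^+ 2 by nra.
  have h4 := sqr_ge0 (b - z u * a - z u * a); nra.
rewrite avgD !avgZ; have := sqr_ge0 a; nra.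
Qed.

(** The levels are raised from [a] to [b] one coordinate at a time; the energy
    is affine in each of them, with slope [revealed - hidden]. *)
Lemma energy_increment a b f (B : I -> R) : 0 <= a -> a <= b -> b <= 1 ->
  (forall t c, levels t -> (forall c, t c <= b) ->
    revealed t c f - hidden t c f <= B c) ->
  energy (fun=> b) f - energy (fun=> a) f <= (b - a) * \sum_c B c.
Proof.
move=> a0 ab b1 hB.
pose lev (s : seq I) c := if c \in s then b else a.
have levP s : levels (lev s).
  by move=> c; rewrite /lev; case: ifP => _; lra.
have levb s c : lev s c <= b by rewrite /lev; case: ifP => _; lra.
suff H s : uniq s -> energy (lev s) f - energy (fun=> a) f <=
    (b - a) * \sum_(c <- s) B c.
  have := H (enum I) (enum_uniq I); rewrite big_enum /=.
  suff -> : lev (enum I) = fun=> b by [].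
  by apply/funext => c; rewrite /lev mem_enum.
elim: s => [_|c s IH /= /andP[cs us]]; first by rewrite big_nil mulr0 subrr.
rewrite big_cons mulrDr.
have E1 : lev (c :: s) = set_level (lev s) c b.
  by apply/funext => c'; rewrite /lev /set_level inE; case: eqP.
have E2 : lev s = set_level (lev s) c a.
  apply/funext => c'; rewrite /lev /set_level; case: eqP => // ->.
  by rewrite (negbTE cs).
have -> : energy (lev (c :: s)) f - energy (fun=> a) f =
    (energy (lev (c :: s)) f - energy (lev s) f) +
    (energy (lev s) f - energy (fun=> a) f) by ring.
apply: lerD; last exact: IH.
rewrite E1 {2}E2 !energy_set_level.
have := hB (lev s) c (levP s) (levb s); rewrite -[_ <= B c]subr_ge0 => hr.
rewrite -subr_ge0 in ab; have := mulr_ge0 ab hr.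
by move: (hidden _ _ _) (revealed _ _ _) => h r; lra.
Qed.

(** Each level can be raised to [b] on its own, and more information can only
    increase the energy. *)
Lemma energy_mono t b f : levels t -> (forall c, t c <= b) -> b <= 1 ->
  energy t f <= energy (fun=> b) f.
Proof.
move=> ht tb b1.
pose lev (s : seq I) c := if c \in s then b else t c.
have levP s : levels (lev s).
  by move=> c; have /andP[? ?] := ht c; rewrite /lev; case: ifP => _; have := tb c; lra.
suff H s : energy t f <= energy (lev s) f.
  have := H (enum I).
  suff -> : lev (enum I) = fun=> b by [].
  by apply/funext => c; rewrite /lev mem_enum.
elim: s => [|c s]; first by [].
move=> /le_trans; apply.
have E1 : lev (c :: s) = set_level (lev s) c b.
  by apply/funext => c'; rewrite /lev /set_level inE; case: eqP.
have E2 : lev s = set_level (lev s) c (lev s c).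
  by apply/funext => c'; rewrite /set_level; case: eqP => // ->.
rewrite E1 {1}E2; apply: energy_set_level_mono => //.
by rewrite /lev; case: ifP.
Qed.

(** No coordinate is erased, so the conditional mean is [f] itself. *)
Lemma energy1 f : energy (fun=> 1) f = avg (prodw (fun=> p)) (fun x => f x ^+ 2).
Proof.
rewrite /energy /avg.
have E (w : {ffun I -> option X}) : prodw (erasure (fun=> 1)) w =
   \sum_(x : {ffun I -> X} | w == [ffun c => Some (x c)]) prodw (fun=> p) x.
  case: (boolP [exists x : {ffun I -> X}, w == [ffun c => Some (x c)]]).
    move=> /existsP[x /eqP ->]; rewrite (bigD1 x)//= big1 ?addr0.
      by apply: eq_bigr => c _; rewrite ffunE /erasure mul1r.
    move=> x' /andP[/eqP/ffunP xx' /eqP]; case; apply/ffunP => c.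
    by have := xx' c; rewrite !ffunE => -[].
  rewrite negb_exists => /forallP H; rewrite big_pred0; last first.
    by move=> x; apply/negbTE/H.
  have [c wc|Hw] := pickP (fun c => w c == None).
    by rewrite /prodw (bigD1 c)//= (eqP wc) /= subrr mul0r.
  have [u0 _|X0] := pickP (mem X); last first.
    by have := hp.2; rewrite big_pred0// => /esym/eqP; rewrite oner_eq0.
  have := H [ffun c => odflt u0 (w c)]; case/eqP; apply/ffunP => c.
  by rewrite !ffunE; have := Hw c; case: (w c).
under eq_bigr do rewrite E big_distrl /=.
rewrite (exchange_big_dep predT)//=; apply: eq_bigr => x _.
rewrite (big_pred1 [ffun c => Some (x c)])//=; congr (_ * _ ^+ 2).
rewrite /cmean /avg (bigD1 x)//= [X in _ + X]big1 ?addr0.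
  by rewrite /prodw big1 ?mul1r// => c _; rewrite ffunE /= eqxx.
move=> x' /eqP xx'; rewrite /prodw.
have [c xc|Hx] := pickP (fun c => x' c != x c).
  by rewrite (bigD1 c)//= ffunE /= (negbTE xc) !mul0r.
by case: xx'; apply/ffunP => c; have := Hx c => /negbFE/eqP.
Qed.

Lemma energy0 f : energy (fun=> 0) f = avg (prodw (fun=> p)) f ^+ 2.
Proof.
have lev0 : levels (fun=> 0) by move=> c; rewrite lexx ler01.
have E w : cmean f w ^+ 2 * prodw (erasure (fun=> 0)) w =
    avg (prodw (fun=> p)) f ^+ 2 * prodw (erasure (fun=> 0)) w.
  have [c wc|Hw] := pickP (fun c => w c != None).
    rewrite /prodw (bigD1 c)//=; case: (w c) wc => //= u _.
    by rewrite !mul0r !mulr0.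
  congr (avg _ _ ^+ 2 * _); apply/funext => x; apply: eq_bigr => c _.
  by have := Hw c => /negbFE/eqP ->.
rewrite /energy -[RHS](avg_cst _ (weight_erasures lev0)) /avg.
by apply: eq_bigr => w _; rewrite mulrC E mulrC.
Qed.

End Erasure.

(** * Gibbs measures with signs as features *)

Section RealInequalities.
Context {R : realType}.
Implicit Types (a b m x z : R).

Lemma expR_sub1_le z : expR z - 1 <= z * expR z.
Proof.
have := expR_ge1Dx (- z); have := expRxMexpNx_1 z; have := expR_gt0 z.
move: (expR z) (expR (- z)) => u v; nra.
Qed.

Lemma expR_quadratic z : expR z <= 1 + z + expR `|z| * z ^+ 2.
Proof.
have h1 := expR_sub1_le z; have h2 := expR_ge1Dx z; have h3 := expR_gt0 z.
have [z0|z0] := leP 0 z; first by rewrite ger0_norm//; nra.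
rewrite ltr0_norm//; have h4 : 1 <= expR (- z).
  by rewrite -expR0 ler_expR oppr_ge0 ltW.
nra.
Qed.

(** The quotient is the mean of a sign of mean [m] after its law is tilted by
    [z]; its derivative in [z] is a variance, hence bounded. *)
Lemma tilted_sign_lipschitz m z : -1 <= m <= 1 ->
  `|((1 + m) / 2 * expR z - (1 - m) / 2 * expR (- z)) /
    ((1 + m) / 2 * expR z + (1 - m) / 2 * expR (- z)) - m| <= 4 * `|z|.
Proof.
move=> /andP[m1 m2]; have u0 := expR_gt0 z; have v0 := expR_gt0 (- z).
have uv := expRxMexpNx_1 z.
have h1 := expR_ge1Dx (2 * z); have h2 := expR_ge1Dx (- (2 * z)).
have e1 : expR (2 * z) = expR z * expR z by rewrite -expRD; congr expR; lra.
have e2 : expR (- (2 * z)) = expR (- z) * expR (- z).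
  by rewrite -expRD; congr expR; lra.
have h1' : expR (- z) * (1 + 2 * z) <= expR z.
  have := ler_wpM2l (ltW v0) h1; rewrite e1.
  suff -> : expR (- z) * (expR z * expR z) = expR z by [].
  by rewrite mulrC -mulrA uv mulr1.
have h2' : expR z * (1 + - (2 * z)) <= expR (- z).
  have := ler_wpM2l (ltW u0) h2; rewrite e2.
  suff -> : expR z * (expR (- z) * expR (- z)) = expR (- z) by [].
  by rewrite mulrA uv mul1r.
have : expR (- z) <= expR z \/ z < 0.
  by have [z0|] := leP 0 z; [left; rewrite ler_expR; lra|right].
have : expR z <= expR (- z) \/ 0 <= z.
  by have [z0|z0] := leP 0 z; [right|left; rewrite ler_expR; lra].
move: h1' h2' uv u0 v0 {h1 h2 e1 e2}.
move: (expR z) (expR (- z)) => u v h1 h2 uv u0 v0 mon1 mon2.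
suff H A B : 0 <= A -> 0 <= B -> A + B = 1 ->
    `|(A * u - B * v) / (A * u + B * v) - (A - B)| <= 4 * `|z|.
  have := H ((1 + m) / 2) ((1 - m) / 2).
  by rewrite (_ : (1 + m) / 2 - (1 - m) / 2 = m); [apply; lra|lra].
move=> A0 B0 AB.
have Au0 : 0 <= A * u by rewrite mulr_ge0// ltW.
have Bv0 : 0 <= B * v by rewrite mulr_ge0// ltW.
have D0 : 0 < A * u + B * v.
  have [Ap|An] := ltP 0 A; first by have := mulr_gt0 Ap u0; lra.
  by have Bp : 0 < B; [lra|have := mulr_gt0 Bp v0; lra].
have -> : (A * u - B * v) / (A * u + B * v) - (A - B) =
    2 * (A * B) * (u - v) / (A * u + B * v).
  have B1 : B = 1 - A by lra.
  by move: D0; rewrite B1 => D0; field; rewrite gt_eqF.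
rewrite normrM normfV (gtr0_norm D0) ler_pdivrMr// !normrM.
rewrite (ger0_norm A0) (ger0_norm B0) (ger0_norm (_ : 0 <= 2))//.
have A1 : A <= 1 by lra.
have B1 : B <= 1 by lra.
have [z0|z0] := leP 0 z.
  have vu : v <= u by case: mon2 => //; lra.
  rewrite (ger0_norm z0) ger0_norm; last by lra.
  have k1 : 2 * (A * B) * (u - v) <= 2 * (A * B) * (2 * z * u).
    by apply: ler_wpM2l; [rewrite !mulr_ge0//; lra|lra].
  have k2 : B * (z * (A * u)) <= 1 * (z * (A * u)).
    by apply: ler_wpM2r => //; rewrite mulr_ge0.
  have k3 : 0 <= z * (B * v) by rewrite mulr_ge0.
  by rewrite (le_trans k1)//; nra.
have uv' : u <= v by case: mon1 => //; lra.
rewrite (ltr0_norm z0) ler0_norm; last by lra.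
have k1 : 2 * (A * B) * (- (u - v)) <= 2 * (A * B) * (2 * (- z) * v).
  by apply: ler_wpM2l; [rewrite !mulr_ge0//; lra|lra].
have nz0 : 0 <= - z by lra.
have k2 : A * (- z * (B * v)) <= 1 * (- z * (B * v)).
  by apply: ler_wpM2r => //; rewrite mulr_ge0.
have k3 : 0 <= - z * (A * u) by rewrite mulr_ge0.
by rewrite (le_trans k1)//; nra.
Qed.

End RealInequalities.

Section Gibbs.
Context {R : realType} {I S : finType} (s0 : S) (chi : S -> I -> R).
Hypothesis chiP : forall s c, chi s c = 1 \/ chi s c = -1.
Implicit Types (e : R) (x y b : I -> R) (s : S) (c : I).

(** [chi s c = s i * s j] for [c = (i, j)] and [e = beta / sqrt N] give [beta]
    times the Sherrington-Kirkpatrick Hamiltonian. *)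
Definition field e y s := \sum_c e * chi s c * y c.

Definition logZ e y := ln (\sum_s expR (field e y s)).

Definition gibbs e y s := expR (field e y s) / \sum_s expR (field e y s).

Definition magnet e y c := avg (gibbs e y) (chi^~ c).

Definition overlap e s s' := \sum_c e ^+ 2 * (chi s c * chi s' c).

Definition fset y c a : I -> R := fun c' => if c' == c then a else y c'.

Lemma partition_gt0 (g : S -> R) : 0 < \sum_s expR (g s).
Proof.
rewrite (bigD1 s0)//= ltr_pwDl ?expR_gt0//.
by apply: sumr_ge0 => s _; apply: expR_ge0.
Qed.

Lemma weight_gibbs e y : weight (gibbs e y).
Proof.
split; first by move=> s; rewrite divr_ge0 ?expR_ge0// ltW// partition_gt0.
by rewrite -big_distrl /= divff// gt_eqF// partition_gt0.
Qed.

Lemma chi_sqr s c : chi s c ^+ 2 = 1.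
Proof. by case: (chiP s c) => ->; rewrite ?sqrrN expr1n. Qed.

Lemma chi_le1 s c : -1 <= chi s c <= 1.
Proof. by case: (chiP s c) => ->; lra. Qed.

Lemma magnet_le1 e y c : -1 <= magnet e y c <= 1.
Proof.
rewrite avg_le_cst ?avg_ge_cst//; try exact: weight_gibbs;
by move=> s; have /andP[] := chi_le1 s c.
Qed.

Lemma expR_logZ e y : expR (logZ e y) = \sum_s expR (field e y s).
Proof. by rewrite lnK// posrE partition_gt0. Qed.

Lemma avg_gibbs_tilt e y (g : S -> R) :
  avg (gibbs e y) (fun s => expR (g s)) =
  (\sum_s expR (field e y s + g s)) / \sum_s expR (field e y s).
Proof.
rewrite /avg /gibbs [RHS]big_distrl /=; apply: eq_bigr => s _.
by rewrite expRD mulrAC.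
Qed.

Lemma logZ_tilt e y b : logZ e b =
  logZ e y + ln (avg (gibbs e y) (fun s => expR (field e b s - field e y s))).
Proof.
rewrite avg_gibbs_tilt ln_div ?posrE ?partition_gt0//.
rewrite /logZ addrC subrK; congr ln; apply: eq_bigr => s _.
by rewrite addrC subrK.
Qed.

(** The free energy is convex in the disorder [y], with gradient [e] times the
    magnetizations. *)
Lemma logZ_tangent e y b :
  logZ e y + \sum_c e * magnet e y c * (b c - y c) <= logZ e b.
Proof.
rewrite (logZ_tilt e y b) lerD2l.
have hw := weight_gibbs e y.
apply: le_trans (avg_ln hw (fun s => expR_gt0 _)).
rewrite (@eq_avg _ _ _ _ (fun s => \sum_c (e * (b c - y c)) * chi s c)); last first.
  move=> s; rewrite expRK /field -sumrB; apply: eq_bigr => c _; ring.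
by rewrite avg_sum le_eqVlt; apply/orP; left; apply/eqP; apply: eq_bigr => c _;
  rewrite avgZ mulrAC.
Qed.

Lemma fset_field e y c a s :
  field e (fset y c a) s - field e y s = e * chi s c * (a - y c).
Proof.
rewrite /field -sumrB (bigD1 c)//= /fset eqxx big1 ?addr0; first by ring.
by move=> c' /negbTE ->; rewrite subrr.
Qed.

Lemma expR_sign s c z : expR (chi s c * z) =
  (1 + chi s c) / 2 * expR z + (1 - chi s c) / 2 * expR (- z).
Proof. by case: (chiP s c) => ->; rewrite ?mul1r ?mulN1r; lra. Qed.

Lemma avg_expR_sign e y c z : avg (gibbs e y) (fun s => expR (chi s c * z)) =
  (1 + magnet e y c) / 2 * expR z + (1 - magnet e y c) / 2 * expR (- z).
Proof.
have hw := weight_gibbs e y.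
rewrite (@eq_avg _ _ _ _ (fun s => (expR z + expR (- z)) / 2 +
   (expR z - expR (- z)) / 2 * chi s c)); last by move=> s; rewrite expR_sign; lra.
by rewrite avgD avg_cst// avgZ /magnet; lra.
Qed.

Lemma avg_gibbs_fset e y c a f : avg (gibbs e (fset y c a)) f =
  avg (gibbs e y) (fun s => f s * expR (chi s c * (e * (a - y c)))) /
  avg (gibbs e y) (fun s => expR (chi s c * (e * (a - y c)))).
Proof.
have E s : expR (field e (fset y c a) s) =
    expR (field e y s) * expR (chi s c * (e * (a - y c))).
  rewrite -expRD; congr expR.
  by rewrite -[LHS](subrK (field e y s)) fset_field addrC; congr (_ + _); ring.
have Z0 := partition_gt0 (field e y); have Z1 := partition_gt0 (field e (fset y c a)).
have H g : avg (gibbs e y) (fun s => g s * expR (chi s c * (e * (a - y c)))) =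
    (\sum_s g s * expR (field e (fset y c a) s)) / \sum_s expR (field e y s).
  rewrite /avg /gibbs big_distrl; apply: eq_bigr => s _ /=.
  by rewrite E; ring.
have H1 := H (fun=> 1); rewrite (eq_bigr _ (fun s _ => mul1r _)) in H1.
rewrite H.
have -> : avg (gibbs e y) (fun s => expR (chi s c * (e * (a - y c)))) =
    (\sum_s expR (field e (fset y c a) s)) / \sum_s expR (field e y s).
  by rewrite -H1; apply: eq_avg => s; rewrite mul1r.
rewrite invf_div.
rewrite mulrA mulfVK ?gt_eqF// /avg /gibbs big_distrl; apply: eq_bigr => s _ /=.
by rewrite mulrC mulrA.
Qed.

Lemma magnet_fset e y c a : magnet e (fset y c a) c =
  let z := e * (a - y c) in let m := magnet e y c in
  ((1 + m) / 2 * expR z - (1 - m) / 2 * expR (- z)) /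
  ((1 + m) / 2 * expR z + (1 - m) / 2 * expR (- z)).
Proof.
rewrite /magnet avg_gibbs_fset avg_expR_sign -/(magnet e y c) /=.
congr (_ / _); have hw := weight_gibbs e y; set z := e * _.
rewrite (@eq_avg _ _ _ _ (fun s => (expR z - expR (- z)) / 2 +
   (expR z + expR (- z)) / 2 * chi s c)).
  by rewrite avgD avg_cst// avgZ /magnet; lra.
by move=> s; rewrite expR_sign; case: (chiP s c) => ->; lra.
Qed.

Lemma magnet_lipschitz e y c a :
  `|magnet e (fset y c a) c - magnet e y c| <= 4 * `|e * (a - y c)|.
Proof. by rewrite magnet_fset; apply: tilted_sign_lipschitz; exact: magnet_le1. Qed.

Lemma logZ_fset_ge e y c a :
  logZ e y + e * magnet e y c * (a - y c) <= logZ e (fset y c a).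
Proof.
apply: le_trans (logZ_tangent e y (fset y c a)).
rewrite lerD2l (bigD1 c)//= /fset eqxx big1 ?addr0// => c' /negbTE ->.
by rewrite subrr mulr0.
Qed.

Lemma fset_fset y c a a' : fset (fset y c a) c a' = fset y c a'.
Proof. by apply/funext => c'; rewrite /fset; case: eqP. Qed.

Lemma fset_id y c : fset y c (y c) = y.
Proof. by apply/funext => c'; rewrite /fset; case: eqP => // ->. Qed.

(** By convexity the increment lies between its two tangents. *)
Lemma logZ_fset_expansion e y c :
  `|logZ e y - logZ e (fset y c 0) - e * y c * magnet e (fset y c 0) c| <=
  4 * (e * y c) ^+ 2.
Proof.
set y0 := fset y c 0; set m0 := magnet e y0 c.
have h1 := logZ_fset_ge e y0 c (y c).
rewrite /y0 fset_fset fset_id -/y0 -/m0 {2}/y0 /fset eqxx subr0 in h1.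
have h2 := logZ_fset_ge e y c 0; rewrite -/y0 in h2.
have h3 := magnet_lipschitz e y c 0; rewrite -/y0 -/m0 in h3.
have h4 : `|e * y c * (magnet e y c - m0)| <= 4 * (e * y c) ^+ 2.
  rewrite normrM -[_ ^+ 2]real_normK ?num_real// expr2 mulrCA.
  apply: ler_wpM2l => //; rewrite distrC (le_trans h3)//.
  by rewrite sub0r mulrN normrN.
rewrite ger0_norm; last by lra.
by rewrite (le_trans _ h4)// (le_trans _ (ler_norm _))//; lra.
Qed.

(** The Cauchy-Schwarz inequality for the partition functions at two
    inverse temperatures and at their midpoint. *)
Lemma logZ_midpoint e1 e2 y :
  2 * logZ ((e1 + e2) / 2) y <= logZ e1 y + logZ e2 y.
Proof.
set e := (e1 + e2) / 2.
have Ze := expR_logZ e y; have := expR_logZ e1 y; have := expR_logZ e2 y.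
move: (logZ e1 y) (logZ e2 y) => l1 l2 Z2 Z1.
suff : expR (logZ e y) <= expR ((l1 + l2) / 2) by rewrite ler_expR; lra.
rewrite Ze -[leRHS]mul1r -ler_pdivrMr ?expR_gt0// big_distrl /=.
apply: (@le_trans _ _ (\sum_s (expR (field e1 y s) / expR l1 +
    expR (field e2 y s) / expR l2) / 2)).
  apply: ler_sum => s _; rewrite -!expRB.
  have -> : field e y s = (field e1 y s + field e2 y s) / 2.
    rewrite /field -big_split big_distrl; apply: eq_bigr => c _ /=.
    by rewrite /e; field.
  move: (field e1 y s) (field e2 y s) => f1 f2.
  have -> : (f1 + f2) / 2 - (l1 + l2) / 2 = (f1 - l1) / 2 + (f2 - l2) / 2 by lra.
  have H (f : R) : expR f = expR (f / 2) ^+ 2 by rewrite expr2 -expRD; congr expR; lra.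
  rewrite (H (f1 - l1)) (H (f2 - l2)) expRD.
  have := sqr_ge0 (expR ((f1 - l1) / 2) - expR ((f2 - l2) / 2)).
  by move: (expR _) (expR _) => u v; nra.
rewrite -big_distrl /= big_split /= -!big_distrl /= -Z1 -Z2.
by rewrite !divff ?gt_eqF ?expR_gt0//; lra.
Qed.

Lemma logZ0 e : logZ e (fun=> 0) = ln #|S|%:R.
Proof.
rewrite /logZ (eq_bigr (fun=> 1)) ?sumr_const// => s _.
by rewrite /field big1 ?expR0// => c _; rewrite mulr0.
Qed.

End Gibbs.

(** * The variance of the free energy of a discretized disorder *)

Section SubGaussianMoments.
Context {R : realType}.

Lemma exprn_le_expR (x : R) n :
  `|x| ^+ n.+1 <= n.+1`!%:R * (expR x + expR (- x)).
Proof.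
have h := expR_ge1Dxn n (normr_ge0 x).
have n0 : 0 < n.+1`!%:R :> R by rewrite ltr0n fact_gt0.
have h1 : `|x| ^+ n.+1 / n.+1`!%:R <= expR `|x|.
  by apply: le_trans h; rewrite lerDr.
rewrite mulrC -ler_pdivrMr//; apply: (le_trans h1).
have [x0|x0] := leP 0 x; first by rewrite ger0_norm// lerDl expR_ge0.
by rewrite ltr0_norm// lerDr expR_ge0.
Qed.

Lemma expR_half_le2 : expR (2^-1) <= 2 :> R.
Proof.
have := expR_ge1Dx (- 2^-1 : R); have := expRxMexpNx_1 (2^-1 : R).
have := expR_gt0 (2^-1 : R); move: (expR _) (expR _) => u v; nra.
Qed.

End SubGaussianMoments.

Section DiscreteVariance.
Context {R : realType} {I S X : finType} (s0 : S) {chi : S -> I -> R}.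
Hypothesis chiP : forall s c, chi s c = 1 \/ chi s c = -1.
Context {p : X -> R} {val : X -> R}.
Hypothesis hp : weight p.
Hypothesis mgf : forall a, avg p (fun u => expR (a * val u)) <= expR (a ^+ 2 / 2).
Variable e : R.

Lemma moment2 : avg p (fun u => val u ^+ 2) <= 8.
Proof.
have m1 := mgf 1; have m2 := mgf (-1); have h := @expR_half_le2 R.
apply: (@le_trans _ _ (avg p (fun u => 2 * (expR (1 * val u) + expR (-1 * val u))))).
  apply: avg_le => // u; rewrite mul1r mulN1r -[_ ^+ 2]real_normK ?num_real//.
  exact: (exprn_le_expR (val u) 1).
rewrite avgZ avgD; rewrite sqrrN expr1n !mul1r in m1 m2; lra.
Qed.

Lemma moment4 : avg p (fun u => val u ^+ 4) <= 96.
Proof.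
have m1 := mgf 1; have m2 := mgf (-1); have h := @expR_half_le2 R.
apply: (@le_trans _ _ (avg p (fun u => 24 * (expR (1 * val u) + expR (-1 * val u))))).
  apply: avg_le => // u; rewrite mul1r mulN1r.
  rewrite (_ : val u ^+ 4 = (val u ^+ 2) ^+ 2); last by ring.
  rewrite -[val u ^+ 2]real_normK ?num_real// -exprM.
  exact: (exprn_le_expR (val u) 3).
rewrite avgZ avgD; rewrite sqrrN expr1n !mul1r in m1 m2; lra.
Qed.

Let vec (x : {ffun I -> X}) (c : I) := val (x c).

Definition free_energy (x : {ffun I -> X}) := logZ chi e (vec x).

Definition fmag c (x : {ffun I -> X}) := magnet chi e (vec x) c.

Definition Emean (f : {ffun I -> X} -> R) := avg (prodw (fun=> p)) f.

(** The mean of [overlap] for two Gibbs samples whose disorders share each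
    coordinate with probability [t] and are otherwise independent. *)
Definition replica t := e ^+ 2 * \sum_c energy (p := p) (fun=> t) (fmag c).

Let hpI : weight (prodw (fun=> p : X -> R) : {ffun I -> X} -> R).
Proof. by apply: weight_prodw. Qed.

Lemma vec_upd x c u : vec (upd x c u) = fset (vec x) c (val u).
Proof. by apply/funext => c'; rewrite /vec /fset ffunE; case: eqP. Qed.

(** The energy of the free energy grows with the level at a rate given by
    [replica], since the gradient of [logZ] is [e] times the magnetizations.
    For Gaussian disorder this is integration by parts; for other laws a second
    order expansion in each coordinate costs [O(e^4)], and a worse constant. *)
Lemma energy_free_step a b : 0 <= a -> a <= b -> b <= 1 ->
  energy (p := p) (fun=> b) free_energy - energy (p := p) (fun=> a) free_energy <=
  (b - a) * (32 * replica b + 7168 * (e ^+ 4 *+ #|I|)).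
Proof.
move=> a0 ab b1.
have levb : levels (fun _ : I => b) by move=> c; lra.
have -> : 32 * replica b + 7168 * (e ^+ 4 *+ #|I|) = \sum_c
    (32 * (e ^+ 2 * energy (p := p) (fun=> b) (fmag c)) + 7168 * e ^+ 4).
  by rewrite big_split /= sumr_const [7168 * _]mulrnAr /replica !big_distrr.
apply: energy_increment => // t c levt tb.
set m0 := fun x => magnet chi e (fset (vec x) c 0) c.
have m0c x u : m0 (upd x c u) = m0 x by rewrite /m0 vec_upd fset_fset.
pose f0 x := logZ chi e (fset (vec x) c 0).
apply: (@le_trans _ _ (revealed (p := p) t c (fun x => free_energy x - f0 x))).
  apply: (revealed_sub_hidden hp (f0 := f0)) => //; first by move=> x; rewrite addrC subrK.
  by move=> x u; rewrite /f0 vec_upd fset_fset.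
have h2 : avg p (fun u => (e * val u) ^+ 2) <= 8 * e ^+ 2.
  rewrite (@eq_avg _ _ _ _ (fun u => e ^+ 2 * val u ^+ 2)); last by move=> u; ring.
  rewrite avgZ mulrC; apply: ler_wpM2r; [exact: sqr_ge0|exact: moment2].
have h4 : avg p (fun u => (4 * (e * val u) ^+ 2) ^+ 2) <= 1536 * e ^+ 4.
  rewrite (@eq_avg _ _ _ _ (fun u => (16 * e ^+ 4) * val u ^+ 4)); last by move=> u; ring.
  rewrite avgZ; have := moment4; have : 0 <= e ^+ 4 by rewrite exprn_even_ge0.
  by move: (avg _ _) => M ? ?; nra.
have hexp (x : {ffun I -> X}) : `|free_energy x - f0 x - e * val (x c) * m0 x| <=
    4 * (e * val (x c)) ^+ 2 by exact: (logZ_fset_expansion s0 chiP e (vec x) c).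
apply: (le_trans (revealed_le (z := fun u => e * val u)
  (r := fun u => 4 * (e * val u) ^+ 2) hp levt hexp m0c h2 h4)).
have k1 := hidden_le_energy hp c m0 levt.
have k2 : energy (p := p) t m0 <= 2 * energy (p := p) t (fmag c) +
    2 * energy (p := p) t (fun x => m0 x - fmag c x).
  apply: le_trans (energyD hp _ _ levt); rewrite le_eqVlt; apply/orP; left.
  by apply/eqP; congr energy; apply/funext => x; rewrite addrC subrK.
have k3 : energy (p := p) t (fun x => m0 x - fmag c x) <= 128 * e ^+ 2.
  apply: (le_trans (energy_le_avg hp _ levt)).
  apply: (@le_trans _ _ (avg (prodw (fun=> p))
      (fun x : {ffun I -> X} => 16 * (e * val (x c)) ^+ 2))).
    apply: avg_le => // x; have := magnet_lipschitz s0 chiP e (vec x) c 0.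
    rewrite -/(fmag c x) -/(m0 x) sub0r mulrN normrN => h.
    rewrite -[leLHS]real_normK ?num_real// (_ : 16 * _ = (4 * `|e * val (x c)|) ^+ 2).
      by apply: lerXn2r; rewrite ?nnegrE// mulr_ge0.
    by rewrite [RHS]exprMn real_normK ?num_real//; ring.
  rewrite (avg_coord (q := fun=> p) c (fun u => 16 * (e * val u) ^+ 2))//.
  by rewrite avgZ; lra.
have k4 := energy_mono hp (fmag c) levt tb b1.
have e2 : 0 <= e ^+ 2 by exact: sqr_ge0.
have k5 : hidden (p := p) t c m0 <=
  2 * energy (p := p) (fun=> b) (fmag c) + 256 * e ^+ 2 by lra.
have := ler_wpM2l e2 k5; rewrite mulrDr.
have -> : e ^+ 2 * (256 * e ^+ 2) = 256 * e ^+ 4 by ring.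
lra.
Qed.

Lemma replica_le t : 0 <= t <= 1 -> replica t <= e ^+ 2 *+ #|I|.
Proof.
move=> ht; rewrite /replica -mulr_natr; apply: ler_wpM2l; first exact: sqr_ge0.
rewrite -sum1_card natr_sum; apply: ler_sum => c _.
apply: le_trans (energy_le_avg hp _ (fun _ => ht)) _; apply: avg_le_cst => // x.
have /andP[h1 h2] := magnet_le1 s0 chiP e (vec x) c.
by rewrite /fmag; nra.
Qed.

(** Jensen's inequality under the product of the two Gibbs measures: the mean
    overlap is bounded by a partition function of pairs in which the overlap
    is an additional interaction. *)
Lemma overlap_jensen lam y y' :
  lam * (e ^+ 2 * \sum_c magnet chi e y c * magnet chi e y' c) <=
  ln (\sum_s \sum_s' expR (field chi e y s + field chi e y' s' +
    lam * overlap chi e s s')) - logZ chi e y - logZ chi e y'.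
Proof.
have hy := weight_gibbs s0 chi e y; have hy' := weight_gibbs s0 chi e y'.
have E0 s s' := expR_gt0 (lam * overlap chi e s s').
apply: (@le_trans _ _ (ln (avg (gibbs chi e y) (fun s => avg (gibbs chi e y')
    (fun s' => expR (lam * overlap chi e s s')))))); last first.
  rewrite le_eqVlt; apply/orP; left; apply/eqP.
  have Z0 := partition_gt0 s0 (field chi e y); have Z1 := partition_gt0 s0 (field chi e y').
  have -> : avg (gibbs chi e y) (fun s => avg (gibbs chi e y')
      (fun s' => expR (lam * overlap chi e s s'))) =
      (\sum_s \sum_s' expR (field chi e y s + field chi e y' s' +
        lam * overlap chi e s s')) / (\sum_s expR (field chi e y s)) /
      (\sum_s expR (field chi e y' s)).
    rewrite /avg /gibbs !big_distrl; apply: eq_bigr => s _ /=.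
    rewrite big_distrr !big_distrl; apply: eq_bigr => s' _ /=.
    by rewrite !expRD; ring.
  have Z2 : 0 < \sum_s \sum_s' expR (field chi e y s + field chi e y' s' +
        lam * overlap chi e s s').
    rewrite (bigD1 s0)//= ltr_pwDl ?(partition_gt0 s0 (fun s' => _))//.
    by apply: sumr_ge0 => s _; apply: sumr_ge0 => s' _; apply: expR_ge0.
  by rewrite !ln_div ?posrE ?divr_gt0.
apply: le_trans (avg_ln hy _); last by move=> s; exact: avg_gt0.
apply: (@le_trans _ _ (avg (gibbs chi e y) (fun s => avg (gibbs chi e y')
    (fun s' => lam * overlap chi e s s')))); last first.
  apply: avg_le => // s; apply: le_trans (avg_ln hy' (E0 s)).
  by apply: avg_le => // s'; rewrite expRK.
rewrite le_eqVlt; apply/orP; left; apply/eqP.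
under [RHS]eq_avg => s do rewrite avgZ avg_sum.
rewrite avgZ avg_sum; congr (_ * _); rewrite big_distrr; apply: eq_bigr => c _ /=.
under [RHS]eq_avg => s do rewrite avgZ avgZ -/(magnet chi e y' c) mulrA mulrAC.
rewrite avgZ -/(magnet chi e y c); ring.
Qed.

Let theta s c (o : option X) :=
  avg (posterior (p := p) o) (fun u => expR (e * chi s c * val u)).

Lemma cmean_weight s w :
  cmean (p := p) (fun x => expR (field chi e (vec x) s)) w = \prod_c theta s c (w c).
Proof.
rewrite /cmean -(avg_prod (fun c => posterior (p := p) (w c))
  (fun c u => expR (e * chi s c * val u))).
by apply: eq_avg => x; rewrite /field expR_sum.
Qed.

(** The weights of [s] and [s'] at a shared coordinate average to at most
    [exp (e^2 + z)], at independent ones to [exp (e^2)], where [z] is the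
    overlap at this coordinate. The term in [e^4] pays for writing their mixture
    as one exponential of [t * z]. *)
Lemma avg_theta_le t s s' c : 0 <= t <= 1 ->
  avg (erasure (p := p) (fun _ : I => t) c) (fun o => theta s c o * theta s' c o) <=
  expR (e ^+ 2 + expR (e ^+ 2) * e ^+ 4 + t * (e ^+ 2 * (chi s c * chi s' c))).
Proof.
move=> /andP[t0 t1]; rewrite avg_erasure.
set z := e ^+ 2 * (chi s c * chi s' c).
have H1 : avg p (fun u => theta s c (Some u) * theta s' c (Some u)) <=
    expR (e ^+ 2 + z).
  rewrite (@eq_avg _ _ _ _ (fun u => expR ((e * (chi s c + chi s' c)) * val u))).
    apply: le_trans (mgf _) _; rewrite ler_expR /z.
    by case: (chiP s c) => ->; case: (chiP s' c) => ->; lra.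
  by move=> u; rewrite /theta !avg_posterior_Some// -expRD; congr expR; ring.
have H2 r : theta r c None <= expR (e ^+ 2 / 2).
  apply: le_trans (mgf _) _; rewrite ler_expR exprMn.
  by rewrite (chi_sqr chiP) mulr1.
have H3 r : 0 <= theta r c None by apply: avg_ge0 => // u; exact: expR_ge0.
have H4 : theta s c None * theta s' c None <= expR (e ^+ 2).
  by rewrite [e ^+ 2](splitr) expRD; apply: ler_pM.
have H5 := expR_quadratic z.
have z2 : z ^+ 2 = e ^+ 4.
  by rewrite /z exprMn [X in _ * X]exprMn !(chi_sqr chiP) !mulr1 -exprM.
have nz : `|z| = e ^+ 2.
  rewrite /z normrM ger0_norm ?sqr_ge0// normrM.
  by case: (chiP s c) => ->; case: (chiP s' c) => ->; rewrite ?normrN normr1 !mulr1.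
rewrite z2 nz in H5.
have H6 : t * expR z + (1 - t) <= expR (expR (e ^+ 2) * e ^+ 4 + t * z).
  apply: le_trans (expR_ge1Dx _).
  have k : 0 <= expR (e ^+ 2) * e ^+ 4.
    by rewrite mulr_ge0 ?expR_ge0 ?exprn_even_ge0.
  move: H5 k; move: (expR (e ^+ 2) * e ^+ 4) (expR z) => K E; nra.
apply: (@le_trans _ _ (expR (e ^+ 2) * (t * expR z + (1 - t)))).
  have -> : expR (e ^+ 2) * (t * expR z + (1 - t)) =
    t * expR (e ^+ 2 + z) + (1 - t) * expR (e ^+ 2) by rewrite expRD; ring.
  by apply: lerD; apply: ler_wpM2l => //; lra.
by rewrite -addrA expRD; apply: ler_wpM2l => //; exact: expR_ge0.
Qed.

(** The annealed bound for a pair of replicas. The interaction [(tc - t) *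
    overlap] comes from [overlap_jensen]; averaging over the shared disorder
    contributes another [t * overlap], so that the total interaction is that of
    level [tc], where the second moment is under control. *)
Lemma replica_annealed t tc : 0 <= t <= 1 ->
  (tc - t) * replica t <=
  (e ^+ 2 + expR (e ^+ 2) * e ^+ 4) *+ #|I| +
  ln (\sum_s \sum_s' expR (tc * overlap chi e s s')) - 2 * Emean free_energy.
Proof.
move=> ht; set lam := tc - t; have lev : levels (fun _ : I => t) by [].
have hE := weight_erasures hp lev.
pose W s s' := fun x x' : {ffun I -> X} => expR (field chi e (vec x) s +
   field chi e (vec x') s' + lam * overlap chi e s s').
pose G x x' := \sum_s \sum_s' W s s' x x'.
have G0 x x' : 0 < G x x'.
  rewrite /G (bigD1 s0)//= ltr_pwDl ?(partition_gt0 s0 (fun s' => _))//.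
  by apply: sumr_ge0 => s _; apply: sumr_ge0 => s' _; apply: expR_ge0.
pose J (w : {ffun I -> option X}) := avg (prodw (fun c => posterior (p := p) (w c))).
have hJ (w : {ffun I -> option X}) : weight (prodw (fun c => posterior (p := p) (w c)) : {ffun I -> X} -> R).
  exact: (weight_posteriors hp).
have lhsE : lam * replica t = avg (prodw (erasure (p := p) (fun=> t)))
   (fun w => J w (fun x => J w (fun x' =>
     lam * (e ^+ 2 * \sum_c fmag c x * fmag c x')))).
  rewrite /replica /energy -avg_sum -avgZ -avgZ; apply: eq_avg => w.
  rewrite /J; under [RHS]eq_avg => x do rewrite avgZ avgZ avg_sum.
  rewrite !avgZ avg_sum; do 2 congr (_ * _); apply: eq_bigr => c _.
  under [RHS]eq_avg => x do rewrite avgZ mulrC.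
  by rewrite avgZ expr2.
rewrite lhsE; apply: (@le_trans _ _ (avg (prodw (erasure (p := p) (fun=> t)))
  (fun w => ln (J w (fun x => J w (G x))) - 2 * cmean (p := p) free_energy w))).
  apply: avg_le => // w.
  apply: (@le_trans _ _ (J w (fun x => J w (fun x' =>
      ln (G x x') - free_energy x - free_energy x')))).
    by apply: avg_le => // x; apply: avg_le => // x'; exact: overlap_jensen.
  rewrite /J; under eq_avg => x do rewrite avgB avgB avg_cst//.
  rewrite avgB avgB avg_cst// -/(cmean (p := p) free_energy w).
  have := avg_ln (hJ w) (fun x => avg_gt0 (hJ w) (G0 x)).
  have : avg (prodw (fun c => posterior (p := p) (w c)))
      (fun x => avg (prodw (fun c => posterior (p := p) (w c))) (fun x' => ln (G x x')))
      <= avg (prodw (fun c => posterior (p := p) (w c)))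
      (fun x => ln (avg (prodw (fun c => posterior (p := p) (w c))) (G x))).
    by apply: avg_le => // x; exact: avg_ln.
  lra.
rewrite avgB avgZ (avg_cmean (p := p) free_energy lev) lerD2r.
have JG0 w : 0 < J w (fun x => J w (G x)).
  by apply: avg_gt0 => // x; exact: avg_gt0.
apply: le_trans (avg_ln hE JG0) _.
set A := (e ^+ 2 + _) *+ #|I|; set L := \sum_s \sum_s' _.
have L0 : 0 < L.
  rewrite /L (bigD1 s0)//= ltr_pwDl ?(partition_gt0 s0 (fun s' => _))//.
  by apply: sumr_ge0 => s _; apply: sumr_ge0 => s' _; apply: expR_ge0.
rewrite -[A]expRK -lnM ?posrE ?expR_gt0// ler_ln ?posrE ?mulr_gt0 ?expR_gt0//;
  last exact: avg_gt0.
have JE w : J w (fun x => J w (G x)) = \sum_s \sum_s'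
    expR (lam * overlap chi e s s') * \prod_c (theta s c (w c) * theta s' c (w c)).
  rewrite /J /G; under eq_avg => x do rewrite avg_sum.
  rewrite avg_sum; apply: eq_bigr => s _.
  under eq_avg => x do rewrite avg_sum.
  rewrite avg_sum; apply: eq_bigr => s' _.
  rewrite big_split /= -!cmean_weight.
  set E := expR (lam * _).
  pose phi r x := expR (field chi e (vec x) r).
  transitivity (avg (prodw (fun c => posterior (p := p) (w c)))
      (fun x => (E * cmean (p := p) (phi s') w) * phi s x)).
    apply: eq_avg => x; rewrite mulrAC -avgZ; apply: eq_avg => x'.
    by rewrite /W !expRD /E /phi; ring.
  by rewrite avgZ -/(cmean (p := p) (phi s) w); ring.
under eq_avg => w do rewrite JE.
rewrite avg_sum /L big_distrr /=; apply: ler_sum => s _.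
rewrite avg_sum big_distrr /=; apply: ler_sum => s' _.
rewrite avgZ (avg_prod (erasure (p := p) (fun=> t)) (fun c o => theta s c o * theta s' c o)).
apply: (@le_trans _ _ (expR (lam * overlap chi e s s') * \prod_c
  expR (e ^+ 2 + expR (e ^+ 2) * e ^+ 4 + t * (e ^+ 2 * (chi s c * chi s' c))))).
  apply: ler_wpM2l; first exact: expR_ge0.
  apply: ler_prod => c _; rewrite avg_theta_le// andbT.
  apply: avg_ge0 => [|o]; first exact: weight_erasure.
  have ho := weight_posterior hp o.
  by rewrite mulr_ge0//; apply: avg_ge0 => // u; exact: expR_ge0.
rewrite -expR_sum -!expRD ler_expR big_split /= sumr_const -big_distrr /=.
by rewrite -/(overlap chi e s s') -/A /lam; lra.
Qed.

Let sub_chain (x y z u v w : R) :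
  x - y <= u -> y - z <= v -> u + v <= w -> x - z <= w.
Proof. by move=> h1 h2 h3; rewrite -(subrKA y) (le_trans (lerD h1 h2)). Qed.

(** Halving the distance to [tc] at each step, the levels [tc (1 - 2^-k)]
    contribute equally. *)
Lemma energy_free_dyadic tc B K : 0 < tc <= 1 -> 0 <= B ->
  (forall t, 0 <= t < tc -> (tc - t) * replica t <= B) ->
  energy (p := p) (fun=> tc * (1 - 2^-1 ^+ K)) free_energy - energy (p := p) (fun=> 0) free_energy <=
  32 * B *+ K + tc * (1 - 2^-1 ^+ K) * (7168 * (e ^+ 4 *+ #|I|)).
Proof.
move=> /andP[tc0 tc1] B0 hB; elim: K => [|K IH].
  by rewrite expr0 subrr mulr0 mulr0n mul0r addr0 subrr.
have h0 : 0 < 2^-1 ^+ K :> R by rewrite exprn_gt0.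
have h1 : 2^-1 ^+ K <= 1 :> R by rewrite exprn_ile1// invf_le1// ler1n.
rewrite exprS; move: IH; move: (2^-1 ^+ K : R) h0 h1 => h h0 h1 IH.
set a := tc * (1 - h) in IH *; set b := tc * (1 - 2^-1 * h).
have ba : b - a = tc * h / 2 by rewrite /a /b; field.
have tb : tc - b = tc * h / 2 by rewrite /b; field.
have th : 0 < tc * h / 2 by rewrite !mulr_gt0.
have a0 : 0 <= a by rewrite mulr_ge0 ?subr_ge0// ltW.
have ab : a <= b by rewrite -subr_ge0 ba ltW.
have bt : b < tc by rewrite -subr_gt0 tb.
have := energy_free_step a0 ab (ltW (lt_le_trans bt tc1)).
have := hB b; rewrite (le_trans a0 ab) bt => /(_ isT).
move=> k1 k2; apply: (sub_chain k2 IH); rewrite [_ *+ K.+1]mulrS {k2 IH}.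
move: ba tb k1; move: (replica _) (7168 * _) (32 * B *+ K) => r q bk ba tb.
rewrite tb -ba {ba tb ab bt a0}; clearbody a b => k1.
have -> : (b - a) * (32 * r + q) = 32 * ((b - a) * r) + (b - a) * q by ring.
by lra.
Qed.

(** The variance is the increment of the energy from level 0 to level 1. Below
    [tc (1 - 2^-K)] each of the [K] dyadic steps costs [O(B)]; the remaining
    levels, of total length at most [1 - tc + 2^-K], are left to the trivial
    bound [replica_le]. *)
Theorem variance_free_le tc B K : 0 < tc <= 1 -> 0 <= B ->
  (forall t, 0 <= t < tc -> (tc - t) * replica t <= B) ->
  Emean (fun x => (free_energy x - Emean free_energy) ^+ 2) <=
  32 * B *+ K + 32 * (1 - tc + 2^-1 ^+ K) * (e ^+ 2 *+ #|I|) +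
  7168 * (e ^+ 4 *+ #|I|).
Proof.
move=> /andP[tc0 tc1] B0 hB.
have -> : Emean (fun x => (free_energy x - Emean free_energy) ^+ 2) =
    energy (p := p) (fun=> 1) free_energy - energy (p := p) (fun=> 0) free_energy.
  rewrite energy1// energy0// -/(Emean free_energy) /Emean.
  set m := avg _ free_energy.
  rewrite (@eq_avg _ _ _ _ (fun x => free_energy x ^+ 2 - (2 * m) * free_energy x + m ^+ 2)).
    by rewrite avgD avg_cst// avgB avgZ -/m; ring.
  by move=> x; ring.
have h1 := @energy_free_dyadic tc B K _ B0 hB; rewrite tc0 tc1 in h1.
have h0 : 0 < 2^-1 ^+ K :> R by rewrite exprn_gt0.
have h01 : 2^-1 ^+ K <= 1 :> R by rewrite exprn_ile1// invf_le1// ler1n.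
move: h1 => /(_ isT); move: (2^-1 ^+ K : R) h0 h01 => h h0 h01.
have : 0 <= tc * (1 - h) by rewrite mulr_ge0 ?subr_ge0// ltW.
have : tc * (1 - h) <= 1 by rewrite mulr_ile1 ?subr_ge0 ?gerBl// ltW.
have : 1 - tc * (1 - h) <= 1 - tc + h by have k : tc * h <= h; [rewrite ler_piMl// ltW|lra].
move: (tc * (1 - h)) => a aa a1 a0 h1.
have h2 := energy_free_step a0 a1 (lexx 1).
have h3 := replica_le (t := 1); rewrite ler01 lexx in h3; have {}h3 := h3 isT.
have n2 : 0 <= e ^+ 2 *+ #|I| by rewrite mulrn_wge0// sqr_ge0.
apply: (sub_chain h2 h1); move: h3 n2.
move: (replica _) (7168 * _) (32 * B *+ K) (_ *+ #|I|) => r q bk n h3 n0.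
have h4 : (1 - a) * r <= (1 - tc + h) * n.
  apply: (@le_trans _ _ ((1 - a) * n)); first by apply: ler_wpM2l; rewrite ?subr_ge0.
  exact: ler_wpM2r.
by lra.
Qed.

End DiscreteVariance.

(** * Integration against the standard Gaussian measure *)

Section Gauss.
Context {R : realType}.
Local Notation mu := (@lebesgue_measure R).
Local Notation gauss := (@normal_prob R 0 1).
Local Notation pdf := (@normal_pdf R 0 1).
Implicit Types (f g : R -> R) (a c C K : R).

Lemma ge0_integral_gauss (f : R -> \bar R) :
  measurable_fun setT f -> (forall x, (0 <= f x)%E) ->
  (\int[gauss]_x f x = \int[mu]_x (f x * (pdf x)%:E))%E.
Proof.
move=> mf f0; have dom := @normal_prob_dominates R 0 1.
rewrite -(Radon_Nikodym_SigmaFinite.change_of_variables dom)//.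
have mpdf : measurable_fun setT (fun x => (pdf x)%:E).
  by apply/measurable_EFinP; exact: measurable_normal_pdf.
have iRN := Radon_Nikodym_SigmaFinite.f_integrable dom.
have mRN := measurable_int _ iRN.
apply: ae_eq_integral => //; [exact: emeasurable_funM|exact: emeasurable_funM|].
apply: ae_eqe_mul2l; apply: integral_ae_eq => // A _ mA.
by rewrite -Radon_Nikodym_SigmaFinite.f_integral.
Qed.

Lemma lebesgue_measure_shift (a : R) (A : set R) : measurable A ->
  pushforward mu ((fun x => x + a) : _ -> measurableTypeR R) A = mu A.
Proof.
move=> mA; apply/esym/lebesgue_measure_unique => //=.
  by apply: measurable_funD.
move=> _ _ [[b c]] _ <-.
rewrite /pushforward.
have -> : (fun x => x + a) @^-1` `]b, c] = `]b - a, c - a]%classic.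
  apply/seteqP; split=> x /=; rewrite !in_itv /= => /andP[h1 h2];
    by apply/andP; split; lra.
rewrite !lebesgue_measure_itv /= !lte_fin ltrD2r.
by case: ifP => // _; rewrite -!EFinB; congr EFin; ring.
Qed.

Lemma normal_pdf_shift (a x : R) :
  pdf (x - a) = expR (a * x - a ^+ 2 / 2) * pdf x.
Proof.
rewrite !normal_pdfE ?oner_neq0// mulrCA; congr (_ * _).
rewrite /normal_fun -expRD; congr expR; rewrite !expr1n !subr0.
by rewrite -mulr_natr mul1r; field.
Qed.

(** The Cameron-Martin formula. *)
Lemma ge0_integral_gauss_shift (a : R) (f : R -> \bar R) :
  measurable_fun setT f -> (forall x, (0 <= f x)%E) ->
  (\int[gauss]_x f (x + a)%R =
   \int[gauss]_x (f x * (expR (a * x - a ^+ 2 / 2))%R%:E))%E.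
Proof.
move=> mf f0.
have mexp : measurable_fun setT (fun x => (expR (a * x - a ^+ 2 / 2))%:E).
  apply/measurable_EFinP; apply: measurableT_comp => //.
  by apply: measurable_funB => //; exact: measurable_funM.
have mpdf (b : R) : measurable_fun setT (fun x : R => (pdf (x + b))%:E).
  apply/measurable_EFinP; apply: measurableT_comp.
    exact: measurable_normal_pdf.
  exact: measurable_funD.
have mpdf0 : measurable_fun setT (fun x => (pdf x)%:E).
  by apply/measurable_EFinP; exact: measurable_normal_pdf.
have msh : measurable_fun setT (fun x : R => x + a) by exact: measurable_funD.
rewrite ge0_integral_gauss//; last exact: measurableT_comp.
rewrite ge0_integral_gauss//; last 2 first.
- exact: emeasurable_funM.
- by move=> x; rewrite mule_ge0// lee_fin expR_ge0.
transitivity (\int[mu]_x ((fun y => f y * (pdf (y - a))%:E) \o (fun x => x + a)%R) x)%E.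
  by apply: eq_integral => x _ /=; rewrite addrK.
pose G (y : measurableTypeR R) := (f y * (pdf (y - a))%:E)%E.
have mG : measurable_fun [set: measurableTypeR R] G.
  by apply: emeasurable_funM => //; exact: (mpdf (- a)).
have G0 : {in [set: measurableTypeR R], forall y, (0 <= G y)%E}.
  by move=> x _; rewrite mule_ge0// lee_fin normal_pdf_ge0.
have msh' : measurable_fun [set: measurableTypeR R]
  ((fun x => x + a) : measurableTypeR R -> measurableTypeR R) by [].
have := ge0_integral_pushforward msh' mu measurableT mG G0.
rewrite preimage_setT => <-.
rewrite (eq_measure_integral mu)/=; last by move=> A mA _; exact: lebesgue_measure_shift.
by apply: eq_integral => x _; rewrite /G normal_pdf_shift EFinM muleA.
Qed.

(** A class of functions with finite Gaussian mean, stable under the operations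
    needed below and under the shifts of [gmean_shift]. *)
Definition expgrowth (f : R -> R) := measurable_fun setT f /\
  exists C K, forall x, `|f x| <= C * (expR (K * x) + expR (- K * x)).

Definition gmean (f : R -> R) : R := fine (\int[gauss]_x (f x)%:E)%E.

Lemma measurable_expRl (a : R) : measurable_fun setT (fun x => expR (a * x)).
Proof. by apply: measurableT_comp => //; exact: measurable_funM. Qed.

Lemma integral_gauss_expR (a : R) :
  (\int[gauss]_x (expR (a * x)%R)%:E = (expR (a ^+ 2 / 2))%:E)%E.
Proof.
have := @ge0_integral_gauss_shift a (cst 1%E) (measurable_cst _) (fun=> lee01).
rewrite integral_cst//= mul1e probability_setT => H.
transitivity ((expR (a ^+ 2 / 2))%:E *
   \int[gauss]_x (1 * (expR (a * x - a ^+ 2 / 2))%R%:E))%E; last by rewrite -H mule1.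
rewrite -ge0_integralZl//.
- apply: eq_integral => x _; rewrite mul1e -EFinM -expRD; congr (expR _)%:E.
  by rewrite addrC subrK.
- apply: emeasurable_funM => //; apply/measurable_EFinP; apply: measurableT_comp => //.
  by apply: measurable_funB => //; exact: measurable_funM.
Qed.

Lemma expgrowth_integrable f : expgrowth f ->
  gauss.-integrable setT (fun x => (f x)%:E).
Proof.
move=> [mf [C [K hf]]].
have iexp a : gauss.-integrable setT (fun x => (expR (a * x))%:E).
  apply/integrableP; split; first by apply/measurable_EFinP; exact: measurable_expRl.
  under eq_integral => x _ do rewrite gee0_abs ?lee_fin ?expR_ge0//.
  by rewrite integral_gauss_expR ltry.
have idom : gauss.-integrable setT
    (fun x => C%:E * ((expR (K * x))%:E + (expR (- K * x))%:E))%E.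
  by apply: integrableZl => //; apply: integrableD.
apply: le_integrable idom => //; first exact/measurable_EFinP.
move=> x _; rewrite -EFinD -EFinM /= lee_fin (le_trans (hf x))//.
exact: ler_norm.
Qed.

Lemma gmeanD f g : expgrowth f -> expgrowth g ->
  gmean (fun x => f x + g x) = gmean f + gmean g.
Proof.
move=> /expgrowth_integrable hf /expgrowth_integrable hg; rewrite /gmean.
under eq_integral do rewrite EFinD.
by rewrite integralD// fineD//; exact: integrable_fin_num.
Qed.

Lemma gmeanZ c f : expgrowth f -> gmean (fun x => c * f x) = c * gmean f.
Proof.
move=> /expgrowth_integrable hf; rewrite /gmean.
under eq_integral do rewrite EFinM.
by rewrite integralZl// fineM//; exact: integrable_fin_num.
Qed.

Lemma gmean_le f g : expgrowth f -> expgrowth g -> (forall x, f x <= g x) ->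
  gmean f <= gmean g.
Proof.
move=> /expgrowth_integrable hf /expgrowth_integrable hg fg; rewrite /gmean.
apply: fine_le; [exact: integrable_fin_num|exact: integrable_fin_num|].
by apply: le_integral => // x _; rewrite lee_fin.
Qed.

Lemma gmean_cst c : gmean (fun=> c) = c.
Proof. by rewrite /gmean integral_cst//= probability_setT mule1. Qed.

Lemma gmean_expR a : gmean (fun x => expR (a * x)) = expR (a ^+ 2 / 2).
Proof. by rewrite /gmean integral_gauss_expR. Qed.

Lemma expgrowthP f C K : measurable_fun setT f ->
  (forall x, `|f x| <= C * expR (K * `|x|)) -> expgrowth f.
Proof.
move=> mf hf; split => //; exists `|C|, K => x.
apply: (le_trans (hf x)); apply: (@le_trans _ _ (`|C| * expR (K * `|x|))).
  by apply: ler_wpM2r; [exact: expR_ge0|exact: ler_norm].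
apply: ler_wpM2l => //; have [x0|x0] := leP 0 x.
  by rewrite ger0_norm// lerDl expR_ge0.
by rewrite ltr0_norm// mulrN mulNr lerDr expR_ge0.
Qed.

Lemma expgrowth_bounded f C : measurable_fun setT f -> (forall x, `|f x| <= C) ->
  expgrowth f.
Proof.
by move=> mf fC; apply: (@expgrowthP f C 0) => // x; rewrite mul0r expR0 mulr1.
Qed.

Lemma expgrowth_cst c : expgrowth (fun=> c).
Proof. exact: (@expgrowth_bounded _ `|c|). Qed.

Lemma expgrowthD f g : expgrowth f -> expgrowth g -> expgrowth (fun x => f x + g x).
Proof.
move=> [mf [C [K hf]]] [mg [D [L hg]]].
apply: (@expgrowthP _ (2 * `|C| + 2 * `|D|) (`|K| + `|L|)).
  exact: measurable_funD.
have H (A B : R) x : A * (expR (B * x) + expR (- B * x)) <=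
    2 * `|A| * expR (`|B| * `|x|).
  apply: (@le_trans _ _ (`|A| * (expR (B * x) + expR (- B * x)))).
    by apply: ler_wpM2r; [rewrite addr_ge0 ?expR_ge0|exact: ler_norm].
  rewrite (_ : 2 * `|A| * _ = `|A| * (expR (`|B| * `|x|) + expR (`|B| * `|x|)));
    last by ring.
  apply: ler_wpM2l => //; apply: lerD; rewrite ler_expR -normrM ?ler_norm//.
  by rewrite mulNr -normrN ler_norm.
move=> x; apply: le_trans (ler_normD _ _) _; rewrite mulrDl; apply: lerD.
  apply: (le_trans (hf x)); apply: (le_trans (H C K x)).
  apply: ler_wpM2l; first by rewrite mulr_ge0.
  by rewrite ler_expR mulrDl lerDl mulr_ge0.
apply: (le_trans (hg x)); apply: (le_trans (H D L x)).
apply: ler_wpM2l; first by rewrite mulr_ge0.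
by rewrite ler_expR mulrDl lerDr mulr_ge0.
Qed.

Lemma expgrowthZ c f : expgrowth f -> expgrowth (fun x => c * f x).
Proof.
move=> [mf [C [K hf]]]; split; first exact: measurable_funM.
by exists (`|c| * C), K => x; rewrite normrM -mulrA ler_wpM2l.
Qed.

Lemma expgrowth_expR a : expgrowth (fun x => expR (a * x)).
Proof.
apply: (@expgrowthP _ 1 `|a|); first exact: measurable_expRl.
by move=> x; rewrite mul1r ger0_norm ?expR_ge0// ler_expR -normrM ler_norm.
Qed.

Lemma expgrowth_id : expgrowth id.
Proof.
apply: (@expgrowthP _ 1 1) => // x; rewrite !mul1r.
by apply: le_trans (expR_ge1Dx _); rewrite lerDr.
Qed.

(** The mean vanishes since [h x <= exp (h x) - 1] for all small [h] of either
    sign, while the right hand side has mean [O(h^2)]. *)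
Lemma gmean_id : gmean id = 0.
Proof.
set m := gmean id.
have H h : h * m <= expR (h ^+ 2 / 2) - 1.
  rewrite -gmeanZ; last exact: expgrowth_id.
  have -> : expR (h ^+ 2 / 2) - 1 = gmean (fun x => expR (h * x) + (-1)).
    by rewrite gmeanD ?gmean_expR ?gmean_cst//; [exact: expgrowth_expR|exact: expgrowth_cst].
  apply: gmean_le => [||x]; first exact/expgrowthZ/expgrowth_id.
    by apply: expgrowthD; [exact: expgrowth_expR|exact: expgrowth_cst].
  by rewrite lerBrDl expR_ge1Dx.
have K h : `|h| <= 1 -> h * m <= h ^+ 2.
  move=> h1; apply: (le_trans (H h)).
  have h2 : h ^+ 2 <= 1 by rewrite -real_normK ?num_real// exprn_ile1.
  have h0 := sqr_ge0 h.
  have := expR_ge1Dx (- (h ^+ 2 / 2)); have := expRxMexpNx_1 (h ^+ 2 / 2).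
  have := expR_gt0 (h ^+ 2 / 2); move: (expR _) (expR _) => u v; nra.
apply/eqP; apply: contraT => m0.
pose h := m / (2 * (1 + `|m|)).
have d0 : 0 < 2 * (1 + `|m|) by rewrite mulr_gt0// ltr_pwDl.
have h1 : `|h| <= 1.
  rewrite normrM normfV (gtr0_norm d0) ler_pdivrMr// mul1r.
  by have := normr_ge0 m; lra.
have m2 : 0 < m ^+ 2 by rewrite exprn_even_gt0.
have i2 : (2 * (1 + `|m|))^-1 <= 2^-1.
  by rewrite lef_pV2 ?posrE//; have := normr_ge0 m; lra.
have i0 : 0 < (2 * (1 + `|m|))^-1 by rewrite invr_gt0.
have := K h h1; rewrite /h; move: i2 i0; move: (2 * (1 + `|m|))^-1 => i i2 i0 k.
have k1 : 0 < m ^+ 2 * i by rewrite mulr_gt0.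
have k2 : 0 <= m ^+ 2 * i * (2^-1 - i) by rewrite mulr_ge0 ?subr_ge0// ltW.
have : m ^+ 2 * i <= 0 by nra.
by rewrite leNgt k1.
Qed.

Lemma gmean_shift (a : R) f : expgrowth f -> (forall x, 0 <= f x) ->
  gmean (fun x => f (x + a)) = gmean (fun x => f x * expR (a * x - a ^+ 2 / 2)).
Proof.
move=> [mf _] f0; rewrite /gmean; congr fine.
have := @ge0_integral_gauss_shift a (fun x => (f x)%:E).
by move=> -> //; exact/measurable_EFinP.
Qed.

End Gauss.

(** * Revealing one Gaussian coordinate of a planted signal *)

Section PlantedStep.
Context {R : realType}.
Variables (e A B : R).
Hypotheses (A0 : 0 <= A) (B0 : 0 <= B) (AB : A + B = 1).

Implicit Types (a b c u x : R).

(** If a sign of law [(A, B)] is planted in a Gaussian variable as a shift by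
    plus or minus [e], this is the likelihood ratio of the value [u], up to the
    factor [exp (- e^2/2)]. *)
Definition Dsgn (u : R) := A * expR (e * u) + B * expR (- (e * u)).

(** The quotient of [expR (a * u)] by [Dsgn u], written so that positivity and
    measurability are immediate. *)
Definition ratio (a u : R) := expR (a * u - ln (Dsgn u)).

Lemma Dsgn_gt0 u : 0 < Dsgn u.
Proof.
have h1 := expR_gt0 (e * u); have h2 := expR_gt0 (- (e * u)).
have h3 := mulr_ge0 A0 (ltW h1); have h4 := mulr_ge0 B0 (ltW h2).
have [Ap|An] := ltP 0 A; first by have := mulr_gt0 Ap h1; rewrite /Dsgn; lra.
by have Bp : 0 < B; [move: AB; lra|have := mulr_gt0 Bp h2; rewrite /Dsgn; lra].
Qed.

Lemma ratioE a u : ratio a u = expR (a * u) / Dsgn u.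
Proof. by rewrite /ratio expRB lnK// posrE Dsgn_gt0. Qed.

Lemma measurable_ratio a b : measurable_fun setT (fun x => ratio a (x + b)).
Proof.
have mb : measurable_fun [set: R] (fun x => x + b) by exact: measurable_funD.
have ml c : measurable_fun [set: R] (fun x => c * (x + b)) by exact: measurable_funM.
have mD : measurable_fun [set: R] (fun x => Dsgn (x + b)).
  apply: measurable_funD; apply: measurable_funM => //.
    exact: (measurableT_comp (@measurable_expR R) (ml e)).
  have := measurableT_comp (@measurable_expR R) (ml (- e)).
  by apply: eq_measurable_fun => x _ /=; rewrite mulNr.
have := measurableT_comp (@measurable_expR R)
  (measurable_funB (ml a) (measurableT_comp (@measurable_ln R) mD)).
exact.
Qed.

Lemma Dsgn_ge u : expR (- `|e * u|) <= Dsgn u.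
Proof.
rewrite -[leLHS]mul1r -AB mulrDl; apply: lerD; apply: ler_wpM2l => //;
  rewrite ler_expR lerNl.
  by rewrite -normrN ler_norm.
by rewrite opprK ler_norm.
Qed.

Lemma ratio_le a u : ratio a u <= expR ((`|a| + `|e|) * `|u|).
Proof.
rewrite ratioE ler_pdivrMr ?Dsgn_gt0//.
apply: (@le_trans _ _ (expR ((`|a| + `|e|) * `|u|) * expR (- `|e * u|))).
  rewrite -expRD ler_expR mulrDl normrM addrK.
  by rewrite -normrM ler_norm.
by apply: ler_wpM2l; [exact: expR_ge0|exact: Dsgn_ge].
Qed.

Lemma expgrowth_ratio a b : expgrowth (fun x => ratio a (x + b)).
Proof.
apply: (@expgrowthP _ _ (expR ((`|a| + `|e|) * `|b|)) (`|a| + `|e|)).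
  exact: measurable_ratio.
move=> x; rewrite ger0_norm ?expR_ge0//; apply: (le_trans (ratio_le _ _)).
rewrite -expRD ler_expR -mulrDr; apply: ler_wpM2l; first by rewrite addr_ge0.
by rewrite addrC; exact: ler_normD.
Qed.

(** Averaging over a planted sign turns the Gaussian measure into the measure
    of density [exp (- e^2/2) Dsgn]. *)
Lemma planted_ratio a :
  A * gmean (fun x => ratio a (x + e)) + B * gmean (fun x => ratio a (x - e)) =
  expR (- (e ^+ 2 / 2)) * expR (a ^+ 2 / 2).
Proof.
have eg b : expgrowth (fun x => ratio a (x + b)) by exact: expgrowth_ratio.
have eg0 : expgrowth (ratio a).
  by have := eg 0; under eq_fun do rewrite addr0.
have r0 x : 0 <= ratio a x by exact: expR_ge0.
have egr b c : expgrowth (fun x => ratio a x * expR (b * x - c)).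
  apply: (@expgrowthP _ _ (expR (- c)) (`|a| + `|e| + `|b|)).
    apply: measurable_funM; first by case: eg0.
    by apply: measurableT_comp => //; apply: measurable_funB => //; exact: measurable_funM.
  move=> x; rewrite normrM (ger0_norm (r0 x)) (ger0_norm (expR_ge0 _)).
  apply: (@le_trans _ _ (expR ((`|a| + `|e|) * `|x|) * expR (b * x - c))).
    by apply: ler_wpM2r; [exact: expR_ge0|exact: ratio_le].
  rewrite -!expRD ler_expR [(_ + `|b|) * _]mulrDl -[`|b| * _]normrM.
  by have := ler_norm (b * x); lra.
have h1 := gmean_shift e eg0 r0; have h2 := gmean_shift (- e) eg0 r0.
transitivity (A * gmean (fun x => ratio a x * expR (e * x - e ^+ 2 / 2)) +
    B * gmean (fun x => ratio a x * expR (- e * x - (- e) ^+ 2 / 2))).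
  by congr (A * _ + B * _); [exact: h1|exact: h2].
transitivity (gmean (fun x => A * (ratio a x * expR (e * x - e ^+ 2 / 2))) +
    gmean (fun x => B * (ratio a x * expR (- e * x - (- e) ^+ 2 / 2)))).
  by congr (_ + _); apply/esym/gmeanZ/egr.
rewrite -gmeanD; try exact: expgrowthZ.
rewrite -gmean_expR -gmeanZ; last exact: expgrowth_expR.
congr gmean; apply/funext => x; rewrite ratioE !expRB mulNr sqrrN -!expRN.
by have := Dsgn_gt0 x; rewrite /Dsgn => /lt0r_neq0 d0; field.
Qed.

(** The inverse of [Dsgn] is at least [2 - Dsgn]. *)
Lemma gmean_ratio0_ge : 2 - expR (e ^+ 2 / 2) <= gmean (fun x => ratio 0 x).
Proof.
have egD c : expgrowth (fun x => expR (c * x)) by exact: expgrowth_expR.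
have egr : expgrowth (ratio 0).
  by have := expgrowth_ratio 0 0; under eq_fun do rewrite addr0.
have -> : 2 - expR (e ^+ 2 / 2) =
    gmean (fun x => 2 + ((- A) * expR (e * x) + (- B) * expR ((- e) * x))).
  rewrite gmeanD ?gmean_cst; [|exact: expgrowth_cst|]; last first.
    by apply: expgrowthD; exact: expgrowthZ.
  rewrite gmeanD; try exact: expgrowthZ.
  rewrite !gmeanZ// !gmean_expR sqrrN; congr (_ + _).
  by rewrite -mulrDl -opprD AB mulN1r.
apply: gmean_le => //.
  by apply: expgrowthD; [exact: expgrowth_cst|apply: expgrowthD; exact: expgrowthZ].
move=> x; rewrite ratioE mul0r expR0 mul1r.
have d0 := Dsgn_gt0 x; rewrite -(ler_pM2r d0) mulVf ?gt_eqF// [- e * x]mulNr.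
have -> : - A * expR (e * x) + - B * expR (- (e * x)) = - Dsgn x.
  by rewrite /Dsgn; ring.
by have := sqr_ge0 (Dsgn x - 1); move: (Dsgn x) => D; nra.
Qed.

Lemma gmean_cross : gmean (fun x => ratio (- e) (x + e)) +
  gmean (fun x => ratio e (x - e)) = 2 * expR (- (e ^+ 2 / 2)) * gmean (ratio 0).
Proof.
have eg a : expgrowth (ratio a).
  by have := expgrowth_ratio a 0; under eq_fun do rewrite addr0.
have r0 a x : 0 <= ratio a x by exact: expR_ge0.
have h1 := gmean_shift e (eg (- e)) (r0 (- e)).
have h2 := gmean_shift (- e) (eg e) (r0 e).
have E (b : R) : b ^+ 2 = e ^+ 2 -> (fun x => ratio (- b) x * expR (b * x - b ^+ 2 / 2)) =
    (fun x => expR (- (e ^+ 2 / 2)) * ratio 0 x).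
  move=> be; apply/funext => x; rewrite /ratio -!expRD be; congr expR; ring.
have E2 := E (- e) (sqrrN e); rewrite opprK in E2.
have E3 := gmeanZ (expR (- (e ^+ 2 / 2))) (eg 0).
rewrite -mulrA mulr2n mulrDl !mul1r -E3; congr (_ + _).
  by apply: (etrans h1); congr gmean; exact: E.
by apply: (etrans h2); congr gmean; exact: E2.
Qed.

(** Two tangents of the logarithm: [ln (N / Dsgn u)] at [expR (e^2/2) * J], and
    [2 * ln (Dsgn u)], which will turn into a relative entropy, at the
    likelihood ratio of a Gaussian variable of mean [e (A - B)]. *)
Lemma log_tangents u N J : 0 < N -> 0 < J ->
  3 + e ^+ 2 / 2 - ln J - e ^+ 2 * (A - B) ^+ 2 + 2 * e * (A - B) * u
  - 2 * expR (e ^+ 2 / 2) * expR (- (e ^+ 2 * (A - B) ^+ 2 / 2)) * ratio (e * (A - B)) u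
  - N / (expR (e ^+ 2 / 2) * J) / Dsgn u <= 3 * ln (Dsgn u) - ln N.
Proof.
move=> N0 J0; have d0 := Dsgn_gt0 u; set m := A - B; set k := expR (e ^+ 2 / 2).
have k0 : 0 < k by exact: expR_gt0.
have h1 := @ln_le_tangent R (Dsgn u) (expR (e * m * u - e ^+ 2 * m ^+ 2 / 2) * k) d0.
rewrite mulr_gt0 ?expR_gt0// in h1; have {h1} := h1 isT.
rewrite lnM ?posrE ?expR_gt0// !expRK expRD => h1.
have h2 := @ln_le_tangent R (k * J * Dsgn u) N.
rewrite !mulr_gt0// in h2; have {h2} := h2 isT N0.
rewrite !lnM ?posrE ?mulr_gt0// expRK => h2.
rewrite ratioE.
have E1 : 2 * k * expR (- (e ^+ 2 * m ^+ 2 / 2)) * (expR (e * m * u) / Dsgn u) =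
   2 * (expR (e * m * u) * expR (- (e ^+ 2 * m ^+ 2 / 2)) * k / Dsgn u) by ring.
have E2 : N / (k * J) / Dsgn u = N / (k * J * Dsgn u) by rewrite [in RHS]invfM mulrA.
rewrite E1 E2; move: h1 h2; set X1 := _ / Dsgn u; set X2 := N / _.
move: X1 X2 (ln (Dsgn u)) (ln N) (ln J) => X1 X2 l1 l2 l3; lra.
Qed.

Lemma gmean_lin (s : seq (R * (R -> R))) :
  (forall i, (i < size s)%N -> expgrowth (nth (0, id) s i).2) ->
  expgrowth (fun x => \sum_(l <- s) l.1 * l.2 x) /\
  gmean (fun x => \sum_(l <- s) l.1 * l.2 x) = \sum_(l <- s) l.1 * gmean l.2.
Proof.
elim: s => [_|[c f] s IH h].
  under eq_fun do rewrite big_nil; rewrite big_nil gmean_cst.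
  by split => //; exact: expgrowth_cst.
have {IH} [|eg E] := IH; first by move=> i; exact: (h i.+1).
under eq_fun do rewrite big_cons; rewrite big_cons /=.
have ef : expgrowth f := h 0%N isT.
split; first by apply: expgrowthD => //; exact: expgrowthZ.
by rewrite gmeanD ?gmeanZ ?E//; exact: expgrowthZ.
Qed.

Lemma two_replica_gt0 (qpp qpm qmm a b u v : R) :
  0 <= qpp -> 0 <= qpm -> 0 <= qmm -> 0 < u -> 0 < v ->
  0 < a * (qpp + qmm) + 2 * b * qpm -> 0 < qpp * u + 2 * qpm + qmm * v.
Proof.
move=> h1 h2 h3 u0 v0 hJ.
have k1 := mulr_ge0 h1 (ltW u0); have k2 := mulr_ge0 h3 (ltW v0).
rewrite lt_neqAle; apply/andP; split; last lra.
rewrite eq_sym; apply: contraTneq hJ => E.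
have q2 : qpm = 0 by lra.
have q1 : qpp * u = 0 by lra.
have q3 : qmm * v = 0 by lra.
have {}q1 : qpp = 0 by apply/eqP; move/eqP: q1; rewrite mulf_eq0 (gt_eqF u0) orbF.
have {}q3 : qmm = 0 by apply/eqP; move/eqP: q3; rewrite mulf_eq0 (gt_eqF v0) orbF.
by rewrite q1 q2 q3 addr0 !mulr0 addr0 ltxx.
Qed.

(** [qpp], [qpm], [qmm] are the parts of a second moment in which the two
    replicas have the given signs, [J] is this moment before the coordinate is
    revealed. The relative entropy of the planted coordinate, at least
    [e^2 (A - B)^2 / 2], enters twice and pays for the transport cost
    [e^2 (A - B)^2] up to fourth order. *)
Lemma planted_step (c0 wp wm qpp qpm qmm J : R) (H del : R -> R) :
  0 <= qpp -> 0 <= qpm -> 0 <= qmm -> 0 < J ->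
  J = expR (e ^+ 2) * (qpp + qmm) + 2 * expR (- e ^+ 2) * qpm ->
  expgrowth H -> expgrowth del ->
  let N u := qpp * expR (2 * e * u) + 2 * qpm + qmm * expR (- (2 * e * u)) in
  let W u := wp * expR (e * u) + wm * expR (- (e * u)) in
  let mu u := (A * expR (e * u) - B * expR (- (e * u))) / Dsgn u in
  (forall x, c0 + (3 * ln (Dsgn (x + e)) - ln (N (x + e))) - W (x + e) / Dsgn (x + e)
     - e ^+ 2 * mu (x + e) - `|e| * del x <= H x) ->
  (forall x, c0 + (3 * ln (Dsgn (x - e)) - ln (N (x - e))) - W (x - e) / Dsgn (x - e)
     + e ^+ 2 * mu (x - e) - `|e| * del x <= H x) ->
  c0 + e ^+ 2 / 2 - ln J - (wp + wm) - e ^+ 4 - `|e| * gmean del <= gmean H.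
Proof.
move=> qpp0 qpm0 qmm0 J0 JE egH egdel N W mu Hp Hm.
have N0 u : 0 < N u.
  have J0' := J0; rewrite JE in J0'.
  exact: (two_replica_gt0 qpp0 qpm0 qmm0 (expR_gt0 _) (expR_gt0 _) J0').
set k := expR (e ^+ 2 / 2); set m := A - B.
set w0 := expR (- (e ^+ 2 * m ^+ 2 / 2)).
pose pl a x := A * ratio a (x + e) + B * ratio a (x - e).
pose cross x := ratio (- e) (x + e) + ratio e (x - e).
pose iJ := (k * J)^-1.
pose cst0 := c0 + 3 + e ^+ 2 / 2 - ln J - e ^+ 2 * m ^+ 2 - e ^+ 2 + 2 * e ^+ 2 * m ^+ 2.
pose L : seq (R * (R -> R)) :=
  [:: (cst0, fun=> 1);
   (2 * e * m, id); (- (2 * k * w0), pl (e * m)); (- (iJ * qpp), pl (2 * e));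
   (- (iJ * (2 * qpm)), pl 0); (- (iJ * qmm), pl (- (2 * e))); (- wp, pl e);
   (- wm, pl (- e)); (2 * e ^+ 2 * (A * B), cross); (- `|e|, del)].
have egr a b : expgrowth (fun x => ratio a (x + b)) by exact: expgrowth_ratio.
have egpl a : expgrowth (pl a) by apply: expgrowthD; apply: expgrowthZ; exact: egr.
have gpl a : gmean (pl a) = expR (- (e ^+ 2 / 2)) * expR (a ^+ 2 / 2).
  rewrite -planted_ratio.
  apply: etrans (gmeanD (expgrowthZ A (egr a e)) (expgrowthZ B (egr a (- e)))) _.
  by congr (_ + _); apply: gmeanZ; exact: egr.
have egc : expgrowth cross by apply: expgrowthD; exact: egr.
have egL i : (i < size L)%N -> expgrowth (nth (0, id) L i).2.
  case: i => [_|[_|[_|[_|[_|[_|[_|[_|[_|[_|//]]]]]]]]]] //=.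
    exact: expgrowth_cst.
  exact: expgrowth_id.
have [egS gS] := gmean_lin egL.
have HL x : \sum_(l <- L) l.1 * l.2 x <= H x.
  have NE u : N u / (k * J) / Dsgn u = iJ * qpp * ratio (2 * e) u +
      iJ * (2 * qpm) * ratio 0 u + iJ * qmm * ratio (- (2 * e)) u.
    by rewrite !ratioE /N -/iJ mul0r expR0 mulNr; ring.
  have WE u : W u / Dsgn u = wp * ratio e u + wm * ratio (- e) u.
    by rewrite !ratioE /W mulNr; ring.
  have mup u : mu u = 1 - 2 * B * ratio (- e) u.
    rewrite ratioE mulNr /mu; have := lt0r_neq0 (Dsgn_gt0 u).
    by rewrite /Dsgn => d0; field.
  have mum u : mu u = 2 * A * ratio e u - 1.
    rewrite ratioE /mu; have := lt0r_neq0 (Dsgn_gt0 u).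
    by rewrite /Dsgn => d0; field.
  pose low u (v : R) := c0 + (3 + e ^+ 2 / 2 - ln J - e ^+ 2 * m ^+ 2 + 2 * e * m * u
    - 2 * k * w0 * ratio (e * m) u - (iJ * qpp * ratio (2 * e) u +
      iJ * (2 * qpm) * ratio 0 u + iJ * qmm * ratio (- (2 * e)) u)) -
    (wp * ratio e u + wm * ratio (- e) u) + v - `|e| * del x.
  have lowp : low (x + e) (- (e ^+ 2 * (1 - 2 * B * ratio (- e) (x + e)))) <= H x.
    apply: le_trans (Hp x); rewrite WE mup /low -NE lerD2r lerD2r lerD2r lerD2l.
    exact: (log_tangents (x + e) (N0 _) J0).
  have lowm : low (x - e) (e ^+ 2 * (2 * A * ratio e (x - e) - 1)) <= H x.
    apply: le_trans (Hm x); rewrite WE mum /low -NE lerD2r lerD2r lerD2r lerD2l.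
    exact: (log_tangents (x - e) (N0 _) J0).
  apply: (@le_trans _ _ (A * low (x + e) (- (e ^+ 2 * (1 - 2 * B * ratio (- e) (x + e))))
     + B * low (x - e) (e ^+ 2 * (2 * A * ratio e (x - e) - 1)))); last first.
    have -> : H x = A * H x + B * H x by rewrite -mulrDl AB mul1r.
    by apply: lerD; exact: ler_wpM2l.
  rewrite le_eqVlt; apply/orP; left; apply/eqP.
  rewrite /L !big_cons big_nil /= addr0 /cst0 /pl /cross /low /m.
  have B1 : B = 1 - A by rewrite -AB [A + B]addrC addrK.
  move: (ratio _ _) (ratio _ _) (ratio _ _) (ratio _ _) (ratio _ _) (ratio _ _).
  move: (ratio _ _) (ratio _ _) (ratio _ _) (ratio _ _) (ratio _ _) (ratio _ _) => *.
  rewrite B1; ring.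
have eh : 2 - k <= gmean (ratio 0) by exact: gmean_ratio0_ge.
apply: le_trans (gmean_le egS egH HL).
rewrite gS /L !big_cons big_nil /= addr0 gmean_cst gmean_id !gpl.
have -> : gmean cross = 2 * expR (- (e ^+ 2 / 2)) * gmean (ratio 0).
  by rewrite -gmean_cross; apply: gmeanD; exact: egr.
have k1 : expR (- (e ^+ 2 / 2)) = k^-1 by rewrite expRN.
have E1 : expR ((e * m) ^+ 2 / 2) = w0^-1.
  by rewrite /w0 -expRN opprK exprMn.
have E2 : expR ((2 * e) ^+ 2 / 2) = k ^+ 4.
  by rewrite /k -expRM_natl; congr expR; field.
have E3 : expR (0 ^+ 2 / 2) = 1 :> R by rewrite expr0n mul0r expR0.
have JE' : J = k ^+ 2 * (qpp + qmm) + 2 * k ^- 2 * qpm.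
  by rewrite JE /k -!expRM_natl -expRN; congr (expR _ * _ + _ * expR _ * _); field.
rewrite !sqrrN k1 E1 E2 E3.
have k0 : 0 < k by exact: expR_gt0.
have w00 : 0 < w0 by exact: expR_gt0.
have k11 : 1 <= k by rewrite -expR0 ler_expR; have := sqr_ge0 e; lra.
have kk : 1 - e ^+ 2 / 2 <= k^-1 by rewrite -k1; exact: expR_ge1Dx.
have mAB : 4 * (A * B) = 1 - m ^+ 2.
  by rewrite /m; have -> : B = 1 - A; [rewrite -AB [A + B]addrC addrK|ring].
have sum1 : iJ * qpp * (k^-1 * k ^+ 4) + iJ * (2 * qpm) * k^-1 +
    iJ * qmm * (k^-1 * k ^+ 4) = 1.
  have kn := lt0r_neq0 k0.
  have kJ : qpp * (k^-1 * k ^+ 4) + 2 * qpm * k^-1 + qmm * (k^-1 * k ^+ 4) = k * J.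
    by rewrite JE'; field.
  transitivity (iJ * (k * J)); first by rewrite -kJ; ring.
  by rewrite /iJ mulVf// mulf_neq0// lt0r_neq0.
have cross_ge : e ^+ 2 * (1 - m ^+ 2) * (1 - e ^+ 2) <=
    2 * e ^+ 2 * (A * B) * (2 * k^-1 * gmean (ratio 0)).
  have -> : 2 * e ^+ 2 * (A * B) * (2 * k^-1 * gmean (ratio 0)) =
    e ^+ 2 * (4 * (A * B)) * (k^-1 * gmean (ratio 0)) by ring.
  rewrite mAB; apply: ler_wpM2l.
    by rewrite mulr_ge0 ?sqr_ge0// -mAB !mulr_ge0.
  apply: (@le_trans _ _ (k^-1 * (2 - k))).
    by rewrite mulrBr mulVf ?gt_eqF//; lra.
  by apply: ler_wpM2l => //; rewrite invr_ge0 ltW.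
have e4 : e ^+ 4 = e ^+ 2 * e ^+ 2 by ring.
have m2 : 0 <= m ^+ 2 * e ^+ 4 by rewrite mulr_ge0 ?sqr_ge0// exprn_even_ge0.
have kk1 : k^-1 * k = 1 by rewrite mulVf ?gt_eqF.
have ww1 : w0 * w0^-1 = 1 by rewrite mulfV ?gt_eqF.
have T1 : - (2 * k * w0) * (k^-1 * w0^-1) = -2.
  by have -> : - (2 * k * w0) * (k^-1 * w0^-1) = - 2 * (k^-1 * k) * (w0 * w0^-1);
    [ring|rewrite kk1 ww1 !mulr1].
rewrite T1 -/k !kk1 !mulr1 mulr0 [- (iJ * qpp) * _]mulNr
  [- (iJ * (2 * qpm)) * _]mulNr [- (iJ * qmm) * _]mulNr.
move: cross_ge sum1; rewrite e4 in m2 *; rewrite /cst0.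
set X := 2 * e ^+ 2 * (A * B) * _; move: X (iJ * qpp * _) (iJ * (2 * qpm) * _) (iJ * qmm * _).
move: (gmean del) (ln J) (e ^+ 2) (m ^+ 2) m2 => gd lJ e2 mm m2 X Y1 Y2 Y3 h1 h2.
rewrite !mulNr; lra.
Qed.

End PlantedStep.

(** * A lower bound for the mean free energy *)

Section Cells.
Context {R : realType} {X : finType} {cell : R -> X}.
Hypothesis mcell : forall j, measurable (cell @^-1` [set j]).
Local Notation gauss := (@normal_prob R 0 1).

Definition cellw (j : X) : R := fine (gauss (cell @^-1` [set j])).

Lemma cell_sum (h : X -> R) :
  (fun x => h (cell x)) = (fun x => \sum_j h j * \1_(cell @^-1` [set j]) x).
Proof.
apply/funext => x; rewrite (bigD1 (cell x))//= indicE mem_set// mulr1.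
rewrite big1 ?addr0// => j jx; rewrite indicE memNset ?mulr0//=.
by move=> H; rewrite H eqxx in jx.
Qed.

Lemma measurable_cell (h : X -> R) : measurable_fun setT (fun x => h (cell x)).
Proof.
rewrite cell_sum; apply: measurable_sum => j; apply: measurable_funM => //.
Qed.

Lemma expgrowth_cell (h : X -> R) : expgrowth (fun x => h (cell x)).
Proof.
apply: (@expgrowth_bounded _ _ (\sum_j `|h j|)); first exact: measurable_cell.
by move=> x; rewrite (bigD1 (cell x))//= lerDl sumr_ge0.
Qed.

Lemma gmean_cell (h : X -> R) : gmean (fun x => h (cell x)) = avg cellw h.
Proof.
have eg1 j : expgrowth (\1_(cell @^-1` [set j]) : R -> R).
  apply: (@expgrowth_bounded _ _ 1) => [|x]; first exact: measurable_indic.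
  by rewrite indicE; case: (_ \in _); rewrite ?normr1 ?normr0.
rewrite cell_sum /avg.
suff H (r : seq X) : expgrowth (fun x => \sum_(j <- r) h j * \1_(cell @^-1` [set j]) x) /\
    gmean (fun x => \sum_(j <- r) h j * \1_(cell @^-1` [set j]) x) =
    \sum_(j <- r) cellw j * h j by exact: (H (index_enum X)).2.
elim: r => [|j r [eg E]].
  under eq_fun do rewrite big_nil; rewrite big_nil gmean_cst; split => //.
  exact: expgrowth_cst.
under eq_fun do rewrite big_cons; rewrite big_cons; split.
  by apply: expgrowthD => //; exact: expgrowthZ.
rewrite gmeanD ?gmeanZ ?E//; last exact: expgrowthZ.
rewrite mulrC; congr (_ * _ + _); rewrite /gmean /cellw; congr fine.
rewrite integral_indic; [|exact: measurableT|exact: mcell].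
congr (gauss _); exact: setIT.
Qed.

Lemma weight_cellw : weight cellw.
Proof.
split; first by move=> j; apply: fine_ge0; exact: measure_ge0.
have := gmean_cell (fun=> 1); rewrite gmean_cst /avg => ->.
by apply: eq_bigr => j _; rewrite mulr1.
Qed.

End Cells.

Section LowerBound.
Context {R : realType} {I S X : finType} (s0 : S) {chi : S -> I -> R}.
Hypothesis chiP : forall s c, chi s c = 1 \/ chi s c = -1.
Context {cell : R -> X} {val : X -> R}.
Hypothesis mcell : forall j, measurable (cell @^-1` [set j]).
Variable e : R.
Implicit Types (b y : I -> R) (r : seq I).

Local Notation p := (cellw (R := R) (cell := cell)).
Local Notation qerr := (fun x : R => `|x - val (cell x)|).

Definition mix r b (x : {ffun I -> X}) : I -> R :=
  fun c => if c \in r then val (x c) else b c.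

Definition partial_mean r b := avg (prodw (fun=> p)) (fun x => logZ chi e (mix r b x)).

(** The second moment of the partition function relative to its squared mean,
    given the coordinates outside [r]. *)
Definition second_moment r y := avg (gibbs chi e y) (fun s =>
  avg (gibbs chi e y) (fun s' => expR (\sum_(c <- r) e ^+ 2 * (chi s c * chi s' c)))).

Definition shift_cost r y b := \sum_(c | c \notin r) e * magnet chi e y c * (y c - b c).

Let hp : weight p. Proof. exact: weight_cellw. Qed.

Lemma partial_mean_cons c r b : c \notin r ->
  partial_mean (c :: r) b = gmean (fun x => partial_mean r (fset b c (val (cell x)))).
Proof.
move=> cr; rewrite (gmean_cell mcell (fun u => partial_mean r (fset b c (val u)))).
rewrite /partial_mean -(avg_resample (c := c))//.
rewrite /avg; under eq_bigr do rewrite big_distrr /=.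
rewrite exchange_big; apply: eq_bigr => u _ /=; rewrite big_distrr.
apply: eq_bigr => x _ /=; rewrite mulrCA; do 2 congr (_ * _); congr logZ.
apply/funext => c'; rewrite /mix /fset inE.
case: eqP => [->|/eqP cc]; first by rewrite upd_same (negbTE cr).
by rewrite upd_other.
Qed.

Lemma expgrowth_qerr : expgrowth qerr.
Proof.
have [mv [C [K hv]]] := expgrowth_cell mcell val.
have [_ [D [L hD]]] := expgrowthD (expgrowth_id (R := R))
  (expgrowthZ (-1) (expgrowth_cell mcell val)).
split; first by apply: measurableT_comp => //; exact: measurable_funB.
by exists D, L => x; rewrite normr_id; have := hD x; rewrite mulN1r.
Qed.

(** The coefficients are the indicators of the events that both signs are [1],
    that they differ, and that both are [-1]. *)
Lemma sign_pair_tilt s s' c z : expR (chi s c * z) * expR (chi s' c * z) =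
  (1 + chi s c) * (1 + chi s' c) / 4 * expR (2 * z) +
  2 * ((1 - chi s c * chi s' c) / 4) +
  (1 - chi s c) * (1 - chi s' c) / 4 * expR (- (2 * z)).
Proof.
rewrite -expRD; case: (chiP s c) => ->; case: (chiP s' c) => ->.
- by rewrite (_ : 1 * z + 1 * z = 2 * z); [lra|ring].
- by rewrite (_ : 1 * z + -1 * z = 0); [rewrite expR0; lra|ring].
- by rewrite (_ : -1 * z + 1 * z = 0); [rewrite expR0; lra|ring].
- by rewrite (_ : -1 * z + -1 * z = - (2 * z)); [lra|ring].
Qed.

Lemma avg_magnet_sum e' y (P : pred I) (z : I -> R) :
  avg (gibbs chi e' y) (fun s => \sum_(c | P c) e' * chi s c * z c) =
  \sum_(c | P c) e' * magnet chi e' y c * z c.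
Proof.
rewrite avg_sum; apply: eq_bigr => c _.
rewrite (@eq_avg _ _ _ _ (fun s => (e' * z c) * chi s c)); last by move=> s; ring.
by rewrite avgZ /magnet mulrAC.
Qed.

(** The disorder [b] is compared with the disorder [y] of a world in which a
    configuration is planted; [shift_cost] is the first order price of passing
    from one to the other. Convexity gives the case [r = [::]]; [planted_step]
    reveals one more coordinate, by the value [x] in the first world and by [x]
    shifted by the planted sign in the second. *)
Lemma partial_mean_ge r b y : uniq r -> (forall c, c \in r -> y c = 0) ->
  logZ chi e y + (e ^+ 2 / 2 - e ^+ 4 - `|e| * gmean qerr) *+ size r
  - ln (second_moment r y) - shift_cost r y b <= partial_mean r b.
Proof.
elim: r b y => [|c r IH] b y /=.
  move=> _ _; have -> : second_moment [::] y = 1.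
    rewrite /second_moment; under eq_avg => s do under eq_avg => s' do
      rewrite big_nil expR0.
    by under eq_avg => s do rewrite (avg_cst _ (weight_gibbs s0 chi e y));
      exact: avg_cst (weight_gibbs s0 chi e y).
  have -> : partial_mean [::] b = logZ chi e b.
    by rewrite /partial_mean /mix /=; exact: avg_cst (weight_prodw _).
  rewrite mulr0n addr0 ln1 subr0.
  have := logZ_tangent s0 chi e y b; rewrite /shift_cost /= -sumrN.
  congr (_ + _ <= _); apply: eq_bigr => c _; ring.
move=> /andP[cr ur] y0; have yc : y c = 0 by apply: y0; rewrite mem_head.
have y0' c' : c' \in r -> y c' = 0 by move=> h; apply: y0; rewrite inE h orbT.
set k0 := e ^+ 2 / 2 - _ - _.
have hw := weight_gibbs s0 chi e y.
set m := magnet chi e y c.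
have /andP[m1 m2] : -1 <= m <= 1 by exact: magnet_le1.
pose A := (1 + m) / 2; pose B := (1 - m) / 2.
have A0 : 0 <= A by rewrite /A; lra.
have B0 : 0 <= B by rewrite /B; lra.
have AB : A + B = 1 by rewrite /A /B; lra.
pose E s s' := expR (\sum_(c' <- r) e ^+ 2 * (chi s c' * chi s' c')).
pose avg2 f := avg (gibbs chi e y) (fun s => avg (gibbs chi e y) (fun s' => f s s' * E s s')).
pose qpp := avg2 (fun s s' => (1 + chi s c) * (1 + chi s' c) / 4).
pose qpm := avg2 (fun s s' => (1 - chi s c * chi s' c) / 4).
pose qmm := avg2 (fun s s' => (1 - chi s c) * (1 - chi s' c) / 4).
pose ell s := \sum_(c' | c' \notin c :: r) e * chi s c' * (y c' - b c').
pose wp := avg (gibbs chi e y) (fun s => (1 + chi s c) / 2 * ell s).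
pose wm := avg (gibbs chi e y) (fun s => (1 - chi s c) / 2 * ell s).
have avg2D f g : avg2 (fun s s' => f s s' + g s s') = avg2 f + avg2 g.
  by rewrite /avg2 -avgD; apply: eq_avg => s; rewrite -avgD; apply: eq_avg => s';
    rewrite mulrDl.
have avg2Z a f : avg2 (fun s s' => a * f s s') = a * avg2 f.
  by rewrite /avg2 -avgZ; apply: eq_avg => s; rewrite -avgZ; apply: eq_avg => s';
    rewrite mulrA.
have avg2_ge0 f : (forall s s', 0 <= f s s') -> 0 <= avg2 f.
  move=> f0; apply: avg_ge0 => // s; apply: avg_ge0 => // s'.
  by rewrite mulr_ge0 ?expR_ge0.
have eq_avg2 f g : (forall s s', f s s' = g s s') -> avg2 f = avg2 g.
  by move=> fg; apply: eq_avg => s; apply: eq_avg => s'; rewrite fg.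
have chi1 s : 0 <= 1 + chi s c by have /andP[] := chi_le1 chiP s c; lra.
have chi2 s : 0 <= 1 - chi s c by have /andP[] := chi_le1 chiP s c; lra.
have qpp0 : 0 <= qpp by apply: avg2_ge0 => s s'; rewrite !mulr_ge0.
have qmm0 : 0 <= qmm by apply: avg2_ge0 => s s'; rewrite !mulr_ge0.
have qpm0 : 0 <= qpm.
  apply: avg2_ge0 => s s'.
  by case: (chiP s c) => ->; case: (chiP s' c) => ->; lra.
have JE : second_moment (c :: r) y =
    expR (e ^+ 2) * (qpp + qmm) + 2 * expR (- e ^+ 2) * qpm.
  transitivity (avg2 (fun s s' =>
      expR (e ^+ 2) * ((1 + chi s c) * (1 + chi s' c) / 4 + (1 - chi s c) * (1 - chi s' c) / 4)
      + 2 * expR (- e ^+ 2) * ((1 - chi s c * chi s' c) / 4))).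
    apply: eq_avg => s; apply: eq_avg => s'.
    rewrite big_cons expRD -/(E s s'); congr (_ * _).
    case: (chiP s c) => ->; case: (chiP s' c) => ->;
      rewrite !(mulr1, mulrN1, opprK); lra.
  by rewrite avg2D !avg2Z avg2D.
have J0 : 0 < second_moment (c :: r) y.
  by apply: avg_gt0 => // s; apply: avg_gt0 => // s'; exact: expR_gt0.
rewrite partial_mean_cons//.
have egH : expgrowth (fun x => partial_mean r (fset b c (val (cell x)))).
  exact: (expgrowth_cell mcell (fun u => partial_mean r (fset b c (val u)))).
(* The value [u] of the new coordinate reweights the Gibbs measure by
   [exp (chi s c * (e * u))], of mean [Dsgn u]. *)
have DE u : avg (gibbs chi e y) (fun s => expR (chi s c * (e * u))) = Dsgn e A B u.
  by rewrite (avg_expR_sign s0 chiP).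
have gibbsE u f : avg (gibbs chi e (fset y c u)) f =
    avg (gibbs chi e y) (fun s => f s * expR (chi s c * (e * u))) / Dsgn e A B u.
  by rewrite (avg_gibbs_fset s0) yc subr0 DE.
have logZE u : logZ chi e (fset y c u) = logZ chi e y + ln (Dsgn e A B u).
  rewrite (logZ_tilt s0 chi e y) -DE; congr (_ + ln _); apply: eq_avg => s.
  by rewrite fset_field yc subr0; congr expR; ring.
have NE u : second_moment r (fset y c u) =
   (qpp * expR (2 * e * u) + 2 * qpm + qmm * expR (- (2 * e * u))) / Dsgn e A B u ^+ 2.
  rewrite /second_moment gibbsE.
  under eq_avg => s do rewrite gibbsE.
  rewrite expr2 invfM mulrA; congr (_ / _); set D := Dsgn e A B u.
  pose t s := expR (chi s c * (e * u)).
  transitivity (avg2 (fun s s' => t s * t s') / D).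
    rewrite [RHS]mulrC /avg2 -avgZ; apply: eq_avg => s; rewrite -/(t s).
    have -> : avg (gibbs chi e y) (fun s' => t s * t s' * E s s') =
        t s * avg (gibbs chi e y) (fun s' => E s s' * t s').
      by rewrite -avgZ; apply: eq_avg => s'; ring.
    by rewrite -/t; ring.
  congr (_ / _); transitivity (avg2 (fun s s' =>
      expR (2 * e * u) * ((1 + chi s c) * (1 + chi s' c) / 4) +
      (2 * ((1 - chi s c * chi s' c) / 4) +
       expR (- (2 * e * u)) * ((1 - chi s c) * (1 - chi s' c) / 4)))).
    by apply: eq_avg2 => s s'; rewrite /t sign_pair_tilt !mulrA; ring.
  rewrite avg2D avg2Z (avg2D (fun s s' => 2 * ((1 - chi s c * chi s' c) / 4))).
  by rewrite avg2Z avg2Z -/qpp -/qpm -/qmm; ring.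
have magE u : magnet chi e (fset y c u) c =
    (A * expR (e * u) - B * expR (- (e * u))) / Dsgn e A B u.
  by rewrite (magnet_fset s0 chiP) yc subr0.
have costE u v : shift_cost r (fset y c u) (fset b c v) =
    (wp * expR (e * u) + wm * expR (- (e * u))) / Dsgn e A B u +
    e * ((A * expR (e * u) - B * expR (- (e * u))) / Dsgn e A B u) * (u - v).
  rewrite /shift_cost (bigD1 c)//= -magE /fset eqxx addrC; congr (_ + _).
  transitivity (avg (gibbs chi e (fset y c u)) ell).
    rewrite avg_magnet_sum; apply: eq_big => [c'|c' /andP[_ /negbTE ->]//].
    by rewrite inE negb_or andbC.
  rewrite gibbsE; congr (_ / _).
  rewrite [wp * _]mulrC [wm * _]mulrC /wp /wm -!avgZ -avgD.
  apply: eq_avg => s; rewrite (expR_sign chiP); ring.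
have costE0 : wp + wm = shift_cost (c :: r) y b.
  rewrite /shift_cost -avg_magnet_sum /wp /wm -avgD; apply: eq_avg => s.
  by rewrite -/(ell s); lra.
have low u x : let mu := (A * expR (e * u) - B * expR (- (e * u))) / Dsgn e A B u in
    logZ chi e y + k0 *+ size r + (3 * ln (Dsgn e A B u) -
      ln (qpp * expR (2 * e * u) + 2 * qpm + qmm * expR (- (2 * e * u)))) -
    (wp * expR (e * u) + wm * expR (- (e * u))) / Dsgn e A B u -
    e * mu * (u - val (cell x)) <= partial_mean r (fset b c (val (cell x))).
  have h0 c' : c' \in r -> fset y c u c' = 0.
    move=> c'r; rewrite /fset; case: eqP => [E1|_]; last exact: y0'.
    by rewrite -E1 c'r in cr.
  apply: le_trans (IH (fset b c (val (cell x))) (fset y c u) ur h0).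
  rewrite logZE NE costE.
  rewrite ln_div ?posrE; last 2 first.
  - have J0' := J0; rewrite JE in J0'.
    exact: (two_replica_gt0 qpp0 qpm0 qmm0 (expR_gt0 _) (expR_gt0 _) J0').
  - by rewrite exprn_gt0// Dsgn_gt0.
  rewrite lnXn ?Dsgn_gt0// -/k0.
  move: (ln _) (ln _) (_ / _) (_ / _) => l1 l2 r1 r2 /=.
  by move: (k0 *+ _) (logZ _ _ _) (_ * (u - _)) => kk l3 r3; lra.
have mu1 u : `|(A * expR (e * u) - B * expR (- (e * u))) / Dsgn e A B u| <= 1.
  rewrite -magE; have /andP[h1 h2] := magnet_le1 s0 chiP e (fset y c u) c.
  by rewrite ler_norml h1 h2.
have low_err u x a : u - x = a ->
    e * ((A * expR (e * u) - B * expR (- (e * u))) / Dsgn e A B u) * (u - val (cell x)) <=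
    a * e * ((A * expR (e * u) - B * expR (- (e * u))) / Dsgn e A B u) + `|e| * qerr x.
  move=> ua; have := mu1 u; move: (_ / _) => mu h1.
  have -> : u - val (cell x) = a + (x - val (cell x)) by rewrite -ua; ring.
  rewrite mulrDr; apply: lerD; first by rewrite mulrC mulrA.
  rewrite -mulrA (le_trans (ler_norm _))// !normrM; apply: ler_wpM2l => //.
  by rewrite ler_piMl.
apply: (@le_trans _ _ (logZ chi e y + k0 *+ size r + e ^+ 2 / 2
    - ln (second_moment (c :: r) y) - (wp + wm) - e ^+ 4 - `|e| * gmean qerr)).
  by rewrite costE0 mulrS /k0; lra.
apply: (planted_step A0 B0 AB qpp0 qpm0 qmm0 J0 JE egH expgrowth_qerr) => x.
- apply: le_trans (low (x + e) x).
  have := low_err (x + e) x e; rewrite addrAC subrr add0r => /(_ erefl).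
  by rewrite expr2; lra.
- apply: le_trans (low (x - e) x).
  have := low_err (x - e) x (- e); rewrite addrAC subrr add0r => /(_ erefl).
  by rewrite expr2; lra.
Qed.

(** Hence the mean free energy is close to its annealed value as long as the
    second moment of the partition function is not too large. One of the three
    terms [ln #|S|%:R] is the annealed free energy without disorder, the other two
    normalize the second moment. *)
Theorem mean_free_ge :
  ln #|S|%:R *+ 3 + (e ^+ 2 / 2 - e ^+ 4 - `|e| * gmean qerr) *+ #|I|
  - ln (\sum_s \sum_s' expR (overlap chi e s s'))
  <= Emean (p := p) (free_energy (chi := chi) (val := val) e).
Proof.
have y0 c : c \in enum I -> (fun=> 0 : R) c = 0 by [].
have := @partial_mean_ge (enum I) (fun=> 0) (fun=> 0) (enum_uniq I) y0.
have -> : partial_mean (enum I) (fun=> 0) = Emean (p := p) (free_energy (chi := chi) (val := val) e).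
  apply: eq_avg => x; congr logZ; apply/funext => c.
  by rewrite /mix mem_enum.
have -> : shift_cost (enum I) (fun=> 0) (fun=> 0) = 0.
  by rewrite /shift_cost big1// => c _; rewrite subrr mulr0.
rewrite subr0 logZ0 -cardT; apply: le_trans.
have n0 : 0 < #|S|%:R :> R by rewrite ltr0n; apply/card_gt0P; exists s0.
have L0 : 0 < \sum_s \sum_s' expR (overlap chi e s s').
  rewrite (bigD1 s0)//= ltr_pwDl ?(partition_gt0 s0 (fun s' => _))//.
  by apply: sumr_ge0 => s _; apply: sumr_ge0 => s' _; apply: expR_ge0.
have -> : second_moment (enum I) (fun=> 0) =
    (\sum_s \sum_s' expR (overlap chi e s s')) / #|S|%:R / #|S|%:R.
  have g s : gibbs chi e (fun=> 0) s = #|S|%:R^-1.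
    rewrite /gibbs (eq_bigr (fun=> 1)) => [|s' _].
      by rewrite sumr_const /field big1 ?expR0 ?mul1r// => c _; rewrite mulr0.
    by rewrite /field big1 ?expR0// => c _; rewrite mulr0.
  rewrite /second_moment /avg !big_distrl; apply: eq_bigr => s _ /=.
  rewrite g mulrC; congr (_ / _); rewrite big_distrl; apply: eq_bigr => s' _ /=.
  rewrite g mulrC /overlap; congr (expR _ / _); rewrite -[RHS]big_enum /=.
  by rewrite big_enum.
rewrite !ln_div ?posrE ?divr_gt0//.
move: (ln _) (ln _) (_ *+ #|I|) => l1 l2 k; rewrite !mulrS mulr0n; lra.
Qed.

End LowerBound.

(** * Rounding the Gaussian variables *)

Section Rounding.
Context {R : realType}.
Local Notation mu := (@lebesgue_measure R).
Local Notation gauss := (@normal_prob R 0 1).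
Local Notation pdf := (@normal_pdf R 0 1).
Implicit Types (x a : R).

Lemma normal_pdf_opp x : pdf (- x) = pdf x.
Proof. by rewrite !normal_pdfE ?oner_neq0// /normal_fun !subr0 sqrrN. Qed.

Lemma gmean_opp (f : R -> R) : measurable_fun setT f -> (forall x, 0 <= f x) ->
  gmean (fun x => f (- x)) = gmean f.
Proof.
move=> mf f0; rewrite /gmean; congr fine.
have mpdf : measurable_fun setT (fun x : R => (pdf x)%:E).
  by apply/measurable_EFinP; exact: measurable_normal_pdf.
have mfE : measurable_fun setT (fun x : R => (f x)%:E) by exact/measurable_EFinP.
rewrite ge0_integral_gauss; first last.
- by move=> x; rewrite lee_fin.
- by apply/measurable_EFinP; apply: (measurableT_comp mf); exact: oppr_measurable.
rewrite (ge0_integral_gauss mfE) => [|x]; last by rewrite lee_fin.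
pose G (y : measurableTypeR R) := ((f y)%:E * (pdf y)%:E)%E.
have mG : measurable_fun [set: measurableTypeR R] G by exact: emeasurable_funM.
have G0 : {in [set: measurableTypeR R], forall y, (0 <= G y)%E}.
  by move=> x _; rewrite mule_ge0// lee_fin ?normal_pdf_ge0.
have mo : measurable_fun [set: measurableTypeR R]
  (-%R : measurableTypeR R -> measurableTypeR R) by exact: oppr_measurable.
have := ge0_integral_pushforward mo mu measurableT mG G0.
rewrite preimage_setT => E.
transitivity (\int[mu]_x (G \o -%R) x)%E.
  by apply: eq_integral => x _; rewrite /G /= normal_pdf_opp.
rewrite -E (eq_measure_integral mu)//.
by move=> A mA _; exact: lebesgue_measureN.
Qed.

(** The difference factors as [(exp b - exp a) (1 - exp (- (a + b)))], for the
    absolute values [a] and [b] of [u] and [v]. *)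
Lemma expR_sym_le (u v : R) : `|u| <= `|v| ->
  expR u + expR (- u) <= expR v + expR (- v).
Proof.
have E (z : R) : expR z + expR (- z) = expR `|z| + expR (- `|z|).
  by have [z0|z0] := leP 0 z; [rewrite ger0_norm|rewrite ltr0_norm// opprK addrC].
rewrite E (E v); move: (normr_ge0 u); move: (`|u|) (`|v|) => a b a0 ab.
rewrite -subr_ge0.
have -> : expR b + expR (- b) - (expR a + expR (- a)) =
    (expR b - expR a) * (1 - expR (- (a + b))).
  have eb : expR b * expR (- (a + b)) = expR (- a) by rewrite -expRD; congr expR; lra.
  have ea : expR a * expR (- (a + b)) = expR (- b) by rewrite -expRD; congr expR; lra.
  by rewrite mulrBl !mulrBr !mulr1 ea eb; lra.
apply: mulr_ge0; rewrite subr_ge0; first by rewrite ler_expR.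
by rewrite expR_le1; lra.
Qed.

Variable m : nat.
Hypothesis m0 : (0 < m)%N.

Local Notation X := ('I_(m ^ 2).+1 * 'I_(m ^ 2).+1)%type.

(** Positive and negative parts are rounded down separately, to multiples of
    [1 / m] not above [m]. The resulting [rval \o rcell] is odd and does not
    increase absolute values, which makes the rounded variable sub-Gaussian with
    the same constant, see [rounded_mgf]. *)
Definition grid x : 'I_(m ^ 2).+1 := inord (minn (Num.truncn (m%:R * x)) (m ^ 2)).

Definition rcell x : X := (grid x, grid (- x)).

Definition rval (u : X) : R := (u.1%:R - u.2%:R) / m%:R.

Let mR : 0 < m%:R :> R. Proof. by rewrite ltr0n. Qed.

Lemma val_grid x : grid x = minn (Num.truncn (m%:R * x)) (m ^ 2) :> nat.
Proof. by rewrite /grid inordK// ltnS geq_minr. Qed.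

Lemma rval_opp x : rval (rcell (- x)) = - rval (rcell x).
Proof. by rewrite /rval /rcell /= opprK -mulNr opprB. Qed.

Lemma grid_neg x : x <= 0 -> grid x = 0 :> nat.
Proof.
move=> x0; rewrite val_grid; have -> : Num.truncn (m%:R * x) = 0%N.
  apply/eqP; rewrite -leqn0 truncn_le_nat.
  by rewrite (le_lt_trans _ ltr01)// pmulr_rle0.
by rewrite min0n.
Qed.

Lemma rval_bounds x : 0 <= x ->
  0 <= rval (rcell x) <= x /\ x - rval (rcell x) <= (1 + x ^+ 2) / m%:R.
Proof.
move=> x0; have mx : 0 <= m%:R * x by rewrite mulr_ge0// ltW.
have /andP[t1 t2] := truncn_itv mx.
rewrite /rval /rcell /= (@grid_neg (- x)) ?oppr_le0// subr0 val_grid.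
set k := Num.truncn _ in t1 t2 *; split.
  rewrite divr_ge0//= ler_pdivrMr// [x * _]mulrC (le_trans _ t1)// ler_nat.
  exact: geq_minl.
rewrite lerBlDr -mulrDl ler_pdivlMr// [x * _]mulrC.
have [km|km] := leqP k (m ^ 2); first by rewrite -addn1 natrD in t2; have := sqr_ge0 x; lra.
have mm : (m ^ 2)%:R <= m%:R * x by rewrite (le_trans _ t1)// ler_nat ltnW.
have mx2 : m%:R <= x by rewrite -(ler_pM2l mR) -expr2 -natrX.
have : m%:R * x <= x ^+ 2 by rewrite expr2 ler_wpM2r.
by have := ler0n R (m ^ 2); lra.
Qed.

Lemma rval_norm x : `|rval (rcell x)| <= `|x|.
Proof.
have [x0|x0] := leP 0 x.
  by have [/andP[h1 h2] _] := rval_bounds x0; rewrite !ger0_norm.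
have nx0 : 0 <= - x by rewrite oppr_ge0 ltW.
have [/andP[h1 h2] _] := rval_bounds nx0; rewrite rval_opp in h1 h2.
by rewrite -normrN -[leRHS]normrN !ger0_norm.
Qed.

Lemma rval_err x : `|x - rval (rcell x)| <= (1 + x ^+ 2) / m%:R.
Proof.
have [x0|x0] := leP 0 x.
  by have [/andP[h1 h2] h3] := rval_bounds x0; rewrite ger0_norm// subr_ge0.
have nx0 : 0 <= - x by rewrite oppr_ge0 ltW.
have [/andP[h1 h2] h3] := rval_bounds nx0; rewrite rval_opp sqrrN in h2 h3.
by rewrite -normrN opprB addrC ger0_norm//; lra.
Qed.

Lemma measurable_grid (i : 'I_(m ^ 2).+1) : measurable (grid @^-1` [set i]).
Proof.
have mono : {homo (fun x => (grid x : nat)%:R : R) : x y / x <= y}.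
  move=> x y xy; rewrite ler_nat !val_grid leq_min geq_minr andbT.
  apply: leq_trans (geq_minl _ _) _; apply: le_truncn.
  by rewrite ler_pM2l.
have mg : measurable_fun setT (fun x => (grid x : nat)%:R : R).
  exact: nondecreasing_measurable.
have -> : grid @^-1` [set i] = (fun x => (grid x : nat)%:R : R) @^-1` [set (i : nat)%:R].
  apply/seteqP; split => x /=; first by move=> ->.
  by move=> /eqP; rewrite eqr_nat => /eqP/val_inj.
by rewrite -[X in measurable X]setTI; exact: mg.
Qed.

Lemma measurable_rcell (u : X) : measurable (rcell @^-1` [set u]).
Proof.
have -> : rcell @^-1` [set u] = (grid @^-1` [set u.1]) `&` (-%R @^-1` (grid @^-1` [set u.2])).
  apply/seteqP; split => x /=; first by move=> <-.
  by move=> [h1 h2]; rewrite /rcell h1 h2; case: u {h1 h2}.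
apply: measurableI; first exact: measurable_grid.
rewrite -[X in measurable X]setTI; apply: (@oppr_measurable R) => //.
exact: measurable_grid.
Qed.

(** By symmetry both sides are means of hyperbolic cosines, which increase with
    the absolute value of their argument. *)
Lemma rounded_mgf a : avg (cellw (cell := rcell)) (fun u => expR (a * rval u)) <=
  expR (a ^+ 2 / 2).
Proof.
rewrite -(gmean_cell measurable_rcell (fun u => expR (a * rval u))).
have eg b : expgrowth (fun x => expR (b * rval (rcell x))).
  exact: (expgrowth_cell measurable_rcell (fun u => expR (b * rval u))).
have E : gmean (fun x => expR (a * rval (rcell x))) =
    gmean (fun x => expR (- a * rval (rcell x))).
  rewrite -(gmean_opp (f := fun x => expR (a * rval (rcell x)))).
  - by congr gmean; apply/funext => x; rewrite rval_opp mulNr mulrN.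
  - by case: (eg a).
  - by move=> x; exact: expR_ge0.
suff : gmean (fun x => expR (a * rval (rcell x)) + expR (- a * rval (rcell x))) <=
    gmean (fun x => expR (a * x) + expR (- a * x)).
  rewrite gmeanD// -E gmeanD; try exact: expgrowth_expR.
  have e1 := gmean_expR (R := R) a; have e2 := gmean_expR (R := R) (- a).
  rewrite sqrrN in e2; rewrite e1 e2.
  by move: (gmean _) (expR _) => A B; lra.
apply: gmean_le => [||x].
- exact: expgrowthD.
- by apply: expgrowthD; exact: expgrowth_expR.
rewrite !mulNr; apply: expR_sym_le; rewrite (normrM a) (normrM a).
by apply: ler_wpM2l => //; exact: rval_norm.
Qed.

Definition rerr x := x - rval (rcell x).

Lemma measurable_rerr : measurable_fun setT rerr.
Proof. by apply: measurable_funB => //; exact: (measurable_cell measurable_rcell rval). Qed.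

Let dom k x := k * (expR (1 * x) + expR (-1 * x)).

Let edom k : expgrowth (dom k).
Proof. by apply: expgrowthZ; apply: expgrowthD; exact: expgrowth_expR. Qed.

Let gmean_dom k : gmean (dom k) = k * (expR (1 / 2) *+ 2).
Proof.
have h1 := gmean_expR (R := R) 1; have h2 := gmean_expR (R := R) (-1).
rewrite sqrrN !expr1n in h1 h2.
rewrite /dom gmeanZ; last by apply: expgrowthD; exact: expgrowth_expR.
by rewrite gmeanD; [rewrite h1 h2|exact: expgrowth_expR|exact: expgrowth_expR].
Qed.

Let rerr_le1 x : `|rerr x| <= m%:R^-1 * (1 + dom 2 x).
Proof.
apply: (le_trans (rval_err x)); rewrite mulrC; apply: ler_wpM2l.
  by rewrite invr_ge0 ltW.
rewrite /dom mul1r mulN1r lerD2l -[_ ^+ 2]real_normK ?num_real//.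
exact: (exprn_le_expR x 1).
Qed.

Let rerr_le2 x : rerr x ^+ 2 <= m%:R ^- 2 * (2 + dom 48 x).
Proof.
have h : `|rerr x| ^+ 2 <= ((1 + x ^+ 2) / m%:R) ^+ 2.
  by rewrite ler_sqr ?nnegrE//; [exact: rval_err|exact: le_trans (rval_err x)].
rewrite real_normK ?num_real// in h; apply: (le_trans h).
rewrite expr_div_n mulrC; apply: ler_wpM2l; first by rewrite invr_ge0 sqr_ge0.
have h4 : x ^+ 4 <= 24 * (expR x + expR (- x)).
  rewrite (_ : x ^+ 4 = (x ^+ 2) ^+ 2); last by ring.
  rewrite -[x ^+ 2]real_normK ?num_real// -exprM; exact: (exprn_le_expR x 3).
have q : (1 + x ^+ 2) ^+ 2 <= 2 + 2 * x ^+ 4.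
  by rewrite -subr_ge0 (_ : _ - _ = (x ^+ 2 - 1) ^+ 2) ?sqr_ge0//; ring.
apply: (le_trans q); rewrite /dom mul1r mulN1r.
by move: (expR x + _) (x ^+ 4) h4 => E F h4; lra.
Qed.

Let expgrowth_rerr1 : expgrowth (fun x => `|rerr x|).
Proof.
split; first by apply: measurableT_comp => //; exact: measurable_rerr.
have [_ [C [K h]]] := expgrowthZ m%:R^-1 (expgrowthD (expgrowth_cst 1) (edom 2)).
exists C, K => x; rewrite normr_id; apply: (le_trans (rerr_le1 x)).
by apply: le_trans (h x); exact: ler_norm.
Qed.

Lemma expgrowth_rerr2 : expgrowth (fun x => rerr x ^+ 2).
Proof.
split; first by apply: measurable_funX; exact: measurable_rerr.
have [_ [C [K h]]] := expgrowthZ (m%:R ^- 2) (expgrowthD (expgrowth_cst 2) (edom 48)).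
exists C, K => x; rewrite ger0_norm ?sqr_ge0//; apply: (le_trans (rerr_le2 x)).
by apply: le_trans (h x); exact: ler_norm.
Qed.

Lemma gmean_rerr1 : gmean (fun x => `|rerr x|) <= 9 / m%:R.
Proof.
have e1 := expgrowthD (expgrowth_cst 1) (edom 2).
apply: le_trans (gmean_le expgrowth_rerr1 (expgrowthZ _ e1) rerr_le1) _.
rewrite gmeanZ// gmeanD//; last exact: expgrowth_cst.
rewrite gmean_cst gmean_dom mulrC; apply: ler_wpM2r; first by rewrite invr_ge0 ltW.
by have := @expR_half_le2 R; rewrite div1r; lra.
Qed.

Lemma gmean_rerr2 : gmean (fun x => rerr x ^+ 2) <= 194 / m%:R ^+ 2.
Proof.
have e1 := expgrowthD (expgrowth_cst 2) (edom 48).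
apply: le_trans (gmean_le expgrowth_rerr2 (expgrowthZ _ e1) rerr_le2) _.
rewrite gmeanZ// gmeanD//; last exact: expgrowth_cst.
rewrite gmean_cst gmean_dom mulrC; apply: ler_wpM2r; first by rewrite invr_ge0 sqr_ge0.
by have := @expR_half_le2 R; rewrite div1r; lra.
Qed.

End Rounding.

(** * From random variables to finite sums *)

Section Bridge.
Context {disp : measure_display} {T : measurableType disp} {R : realType}.
Context {P : probability T R}.
Local Notation gauss := (@normal_prob R 0 1).

Lemma variance_le_deviation (X : T -> R) c M : measurable_fun setT X ->
  (\int[P]_w ((X w - c) ^+ 2)%:E <= M%:E)%E -> ('V_P[X] <= M%:E)%E.
Proof.
move=> mX hM; pose Y : T -> R := fun w => X w - c.
have mY : measurable_fun setT Y by exact: measurable_funB.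
have Y2 : Y \in Lfun P 2%:E.
  apply/andP; rewrite !inE /=; split => //; rewrite /finite_norm.
  rewrite unlock poweR_lty//; apply: le_lt_trans (ltry M); apply: le_trans hM.
  rewrite le_eqVlt; apply/orP; left; apply/eqP; apply: eq_integral => w _ /=.
  by rewrite powR_mulrn// real_normK ?num_real.
have -> : X = (Y \+ cst c)%R by apply/funext => w; rewrite /Y /= subrK.
rewrite varianceD_cst_r// varianceE//.
have E2 : ('E_P[Y ^+ 2] <= M%:E)%E by rewrite unlock.
apply: le_trans E2; rewrite -[leRHS]adde0 leeD2l// oppe_le0.
have f : ('E_P[Y] \is a fin_num)%E.
  by apply: expectation_fin_num; apply: Lfun_subset12 => //; rewrite fin_num_measure.
by rewrite -(fineK f) -EFin_expe lee_fin sqr_ge0.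
Qed.

Lemma integral_gaussian (X : {RV P >-> R}) (f : R -> \bar R) :
  standard_gaussian X -> measurable_fun setT f -> (forall x, (0 <= f x)%E) ->
  (\int[P]_w f (X w) = \int[gauss]_x f x)%E.
Proof.
move=> hX mf f0.
(* [gauss] lives on another copy of the Borel space [R] than the law of [X]. *)
have mX : measurable_fun setT (X : T -> measurableTypeR R).
  have h : measurable_fun setT (X : T -> R) := measurable_funP X.
  exact: h.
have mf' : measurable_fun [set: measurableTypeR R] f by exact: mf.
have f0' : {in [set: measurableTypeR R], forall x, (0 <= f x)%E} by move=> x _.
have := ge0_integral_pushforward mX P measurableT mf' f0'.
rewrite preimage_setT /comp => <-.
by apply: eq_measure_integral => A mA _; exact: hX.
Qed.

Context {I X : finType} {cell : R -> X} (mcell : forall j, measurable (cell @^-1` [set j])).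
Context {G : I -> {RV P >-> R}}.
Hypothesis hG : forall c, standard_gaussian (G c).
Hypothesis hI : mutually_independent G.

Definition cells (w : T) : {ffun I -> X} := [ffun c => cell (G c w)].

Lemma cells_preimage (x : {ffun I -> X}) : cells @^-1` [set x] =
  \bigcap_(c in [set` [set: I]%SET]) (G c @^-1` (cell @^-1` [set x c])).
Proof.
apply/seteqP; split => w /=.
  by move=> <- c _; rewrite /= ffunE.
by move=> H; apply/ffunP => c; rewrite ffunE; apply: (H c); rewrite /= inE.
Qed.

Lemma measurable_cells x : measurable (cells @^-1` [set x]).
Proof.
rewrite cells_preimage; apply: fin_bigcap_measurable; first exact: finite_finset.
move=> c _; rewrite -[X in measurable X]setTI; exact: measurable_funP.
Qed.

Lemma prob_cells x : P (cells @^-1` [set x]) = (prodw (fun=> cellw (cell := cell)) x)%:E.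
Proof.
rewrite cells_preimage hI => [|c _]; last exact: mcell.
rewrite /prodw -prodEFin (eq_bigl xpredT) => [|c]; last by rewrite inE.
apply: eq_bigr => c _; rewrite /cellw fineK; first exact: (hG _ (mcell _)).
by apply: fin_num_measure; exact: mcell.
Qed.

Lemma integral_cells (f : {ffun I -> X} -> R) : (forall x, 0 <= f x) ->
  (\int[P]_w (f (cells w))%:E =
   (Emean (p := cellw (cell := cell)) f)%:E)%E.
Proof.
move=> f0.
have E w : (f (cells w))%:E =
    (\sum_x (f x * \1_(cells @^-1` [set x]) w)%:E)%E.
  rewrite sumEFin (bigD1 (cells w))//= indicE mem_set// mulr1.
  rewrite big1 ?addr0// => x xw; rewrite indicE memNset ?mulr0//=.
  by move=> H; rewrite H eqxx in xw.
under eq_integral do rewrite E.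
rewrite ge0_integral_sum//; first last.
- by move=> x w _; rewrite lee_fin mulr_ge0// f0.
- move=> x; apply/measurable_EFinP; apply: measurable_funM => //.
  by apply: measurable_indic; exact: measurable_cells.
rewrite /Emean /avg -sumEFin; apply: eq_bigr => x _.
under eq_integral do rewrite EFinM.
rewrite ge0_integralZl//; first last.
- by rewrite lee_fin.
- by apply/measurable_EFinP/measurable_indic; exact: measurable_cells.
rewrite integral_indic//; last exact: measurable_cells.
rewrite setIT [RHS]EFinM [RHS]muleC; congr (_ * _)%E.
exact: prob_cells.
Qed.

End Bridge.

Section Transfer.
Context {disp : measure_display} {T : measurableType disp} {R : realType}.
Context {P : probability T R} {I S X : finType} (s0 : S) {chi : S -> I -> R}.
Hypothesis chiP : forall s c, chi s c = 1 \/ chi s c = -1.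
Local Notation logZ := (logZ chi).

Lemma logZ_lipschitz e (y b : I -> R) :
  `|logZ e y - logZ e b| <= `|e| * \sum_c `|y c - b c|.
Proof.
have H (u v : I -> R) : logZ e u - logZ e v <= `|e| * \sum_c `|u c - v c|.
  have := logZ_tangent s0 chi e u v; rewrite -lerBrDl -lerN2 opprB -sumrN => h.
  apply: (le_trans h); rewrite mulr_sumr; apply: ler_sum => c _.
  rewrite -mulrN opprB; apply: le_trans (ler_norm _) _; rewrite !normrM.
  apply: ler_wpM2r => //; rewrite -[leRHS]mulr1; apply: ler_wpM2l => //.
  by rewrite ler_norml; exact: magnet_le1.
rewrite ler_norml H andbT lerNl opprB (eq_bigr (fun c => `|b c - y c|)) => [|c _].
  exact: H.
exact: distrC.
Qed.

Lemma sqr_sum_le (a : I -> R) : (\sum_c a c) ^+ 2 <= #|I|%:R * \sum_c a c ^+ 2.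
Proof.
rewrite expr2 big_distrlr /=.
have -> : #|I|%:R * \sum_c a c ^+ 2 =
    \sum_c \sum_c' (a c ^+ 2 / 2 + a c' ^+ 2 / 2).
  transitivity (\sum_c ((a c ^+ 2 / 2) *+ #|I| + \sum_c' a c' ^+ 2 / 2)); last first.
    by apply: eq_bigr => c _; rewrite big_split /= sumr_const.
  rewrite big_split /= sumrMnl sumr_const -!mulr_suml -mulrnDl -splitr.
  by rewrite mulr_natl.
apply: ler_sum => c _; apply: ler_sum => c' _.
by have := sqr_ge0 (a c - a c'); rewrite sqrrB; lra.
Qed.

Lemma logZ_rounding e (y b : I -> R) m :
  (logZ e y - m) ^+ 2 <= 2 * e ^+ 2 * #|I|%:R * (\sum_c (y c - b c) ^+ 2) +
    2 * (logZ e b - m) ^+ 2.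
Proof.
have h : (logZ e y - logZ e b) ^+ 2 <= e ^+ 2 * (#|I|%:R * \sum_c (y c - b c) ^+ 2).
  have h1 : `|logZ e y - logZ e b| ^+ 2 <= (`|e| * \sum_c `|y c - b c|) ^+ 2.
    rewrite ler_sqr ?nnegrE ?normr_ge0//; first exact: logZ_lipschitz.
    by rewrite mulr_ge0// sumr_ge0.
  rewrite real_normK ?num_real// in h1; apply: (le_trans h1).
  rewrite exprMn real_normK ?num_real//; apply: ler_wpM2l; first exact: sqr_ge0.
  apply: le_trans (sqr_sum_le _) _; apply: ler_wpM2l => //.
  by apply: ler_sum => c _; rewrite real_normK ?num_real.
move: h; move: (\sum_c _) (logZ e y) (logZ e b) => D u v h.
rewrite (_ : 2 * e ^+ 2 * _ * D = 2 * (e ^+ 2 * (#|I|%:R * D))); last by ring.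
move: (e ^+ 2 * _) h => E h.
by have := sqr_ge0 ((u - v) - (v - m)); lra.
Qed.

Lemma measurable_logZ e (G : I -> {RV P >-> R}) :
  measurable_fun setT (fun w => logZ e (fun c => G c w)).
Proof.
apply: measurableT_comp; first exact: measurable_ln.
apply: measurable_sum => s; apply: measurableT_comp => //.
apply: measurable_sum => c; apply: measurable_funM => //.
Qed.

Context {cell : R -> X} {val : X -> R}.
Hypothesis mcell : forall j, measurable (cell @^-1` [set j]).
Hypothesis err2 : expgrowth (fun x => (x - val (cell x)) ^+ 2).

(** The free energy is Lipschitz in the disorder, so that the rounding errors of
    the coordinates add up, and the squares cost a factor 2. *)
Lemma variance_transfer e m (G : I -> {RV P >-> R}) :
  (forall c, standard_gaussian (G c)) -> mutually_independent G ->
  ('V_P[fun w => logZ e (fun c => G c w)] <=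
    (2 * e ^+ 2 * #|I|%:R * (#|I|%:R * gmean (fun x => (x - val (cell x)) ^+ 2)) +
     2 * Emean (p := cellw (cell := cell))
       (fun x : {ffun I -> X} => (free_energy (chi := chi) (val := val) e x - m) ^+ 2))%:E)%E.
Proof.
move=> hG hI; apply: (@variance_le_deviation _ _ _ _ _ m); first exact: measurable_logZ.
pose d c w := (G c w - val (cell (G c w))) ^+ 2.
have [merr _] := err2.
have md c : measurable_fun setT (d c) by exact: (measurableT_comp merr).
have d0 c w : 0 <= d c w by exact: sqr_ge0.
pose F (x : {ffun I -> X}) := 2 * (free_energy (chi := chi) (val := val) e x - m) ^+ 2.
have F0 x : 0 <= F x by rewrite mulr_ge0// sqr_ge0.
pose k := 2 * e ^+ 2 * #|I|%:R.
have k0 : 0 <= k by apply: mulr_ge0 => //; apply: mulr_ge0 => //; exact: sqr_ge0.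
have mF : measurable_fun setT (fun w => F (cells (cell := cell) (G := G) w)).
  have -> : (fun w => F (cells (cell := cell) (G := G) w)) =
      (fun w => \sum_x F x * \1_(cells (cell := cell) (G := G) @^-1` [set x]) w).
    apply/funext => w; rewrite (bigD1 (cells (cell := cell) (G := G) w))//= indicE mem_set// mulr1.
    rewrite big1 ?addr0// => x xw; rewrite indicE memNset ?mulr0//=.
    by move=> H; rewrite H eqxx in xw.
  apply: measurable_sum => x; apply: measurable_funM => //.
  by apply: measurable_indic; exact: measurable_cells.
have mD : measurable_fun setT (fun w => k * \sum_c d c w).
  by apply: measurable_funM => //; apply: measurable_sum.
apply: (@le_trans _ _ (\int[P]_w ((k * \sum_c d c w)%:E +
    (F (cells (cell := cell) (G := G) w))%:E))%E).
  apply: ge0_le_integral => //.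
  - by move=> w _; rewrite lee_fin sqr_ge0.
  - apply/measurable_EFinP; apply: measurable_funX; apply: measurable_funB => //.
    exact: measurable_logZ.
  - by apply: emeasurable_funD; exact/measurable_EFinP.
  - move=> w _; rewrite -EFinD lee_fin.
    have := logZ_rounding e (fun c => G c w) (fun c => val (cells (cell := cell) (G := G) w c)) m.
    under eq_bigr do rewrite ffunE.
    by apply: le_trans.
rewrite ge0_integralD//; first last.
- exact/measurable_EFinP.
- by move=> w _; rewrite lee_fin.
- exact/measurable_EFinP.
- by move=> w _; rewrite lee_fin mulr_ge0// sumr_ge0.
rewrite EFinD; apply: leeD.
  under eq_integral do rewrite EFinM -sumEFin.
  rewrite ge0_integralZl//; first last.
  - by move=> w _; apply: sume_ge0 => c _; rewrite lee_fin.
  - by apply: emeasurable_sum => c; exact/measurable_EFinP.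
  rewrite ge0_integral_sum//; first last.
  - by move=> c w _; rewrite lee_fin.
  - by move=> c; exact/measurable_EFinP.
  rewrite [leRHS]EFinM lee_wpmul2l ?lee_fin//.
  rewrite (eq_bigr (fun=> (gmean (fun x => (x - val (cell x)) ^+ 2))%:E)) => [|c _].
    by rewrite sumEFin sumr_const lee_fin mulr_natl.
  have := @integral_gaussian _ _ _ _ (G c) (fun x => ((x - val (cell x)) ^+ 2)%:E) (hG c).
  move=> ->.
  - rewrite /gmean fineK//; have := integrable_fin_num measurableT (expgrowth_integrable err2).
    exact.
  - exact/measurable_EFinP.
  - by move=> x; rewrite lee_fin sqr_ge0.
have := integral_cells mcell hG hI F0 => ->.
by rewrite lee_fin /Emean /F avgZ.
Qed.

End Transfer.

(** * The gap between the annealed and the quenched free energy *)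

Section AnnealedGap.
Context {R : realType} {I S X : finType} (s0 : S) {chi : S -> I -> R}.
Hypothesis chiP : forall s c, chi s c = 1 \/ chi s c = -1.
Context {p : X -> R} {val : X -> R}.
Hypothesis hp : weight p.
Hypothesis mgf : forall a, avg p (fun u => expR (a * val u)) <= expR (a ^+ 2 / 2).

Definition annealed_gap e : R := ln #|S|%:R + (e ^+ 2 / 2) *+ #|I| -
  Emean (p := p) (fun x : {ffun I -> X} => free_energy (chi := chi) (val := val) e x).

Lemma annealed_gap_ge0 e : 0 <= annealed_gap e.
Proof.
have wp : weight (prodw (fun _ : I => p)) by exact: weight_prodw.
rewrite subr_ge0 /Emean /free_energy /logZ.
apply: le_trans (avg_ln wp _) _ => [x|]; first exact: partition_gt0.
have S0 : 0 < #|S|%:R :> R by rewrite ltr0n; apply/card_gt0P; exists s0.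
have eS : 0 < #|S|%:R * expR ((e ^+ 2 / 2) *+ #|I|) :> R by rewrite mulr_gt0 ?expR_gt0.
rewrite -[X in _ <= _ + X]expRK -lnM ?posrE ?expR_gt0// ler_ln ?posrE//; last first.
  by apply: avg_gt0 => // x; exact: partition_gt0.
rewrite avg_sum mulr_natl -sumr_const; apply: ler_sum => s _.
have -> : avg (prodw (fun=> p)) (fun x : {ffun I -> X} => expR (field chi e (fun c => val (x c)) s)) =
    \prod_c avg p (fun u => expR (e * chi s c * val u)).
  rewrite -(avg_prod (fun=> p) (fun c u => expR (e * chi s c * val u))).
  by apply: eq_avg => x; rewrite /field expR_sum.
rewrite -sumr_const expR_sum.
apply: ler_prod => c _; apply/andP; split.
  by apply: avg_ge0 => // u; exact: expR_ge0.
apply: le_trans (mgf _) _; rewrite exprMn.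
by have [->|->] := chiP s c; rewrite ?sqrrN !expr1n mulr1.
Qed.

(** The free energy is convex in [e]. Hence its mean at [e] is at least twice
    that at [ec] minus that at the reflected point [2 * ec - e], where the
    annealed upper bound applies. *)
Lemma annealed_gap_midpoint ec e :
  annealed_gap e <= 2 * annealed_gap ec + ((e - ec) ^+ 2) *+ #|I|.
Proof.
have wp : weight (prodw (fun _ : I => p)) by exact: weight_prodw.
pose F e := Emean (p := p) (fun x : {ffun I -> X} => free_energy (chi := chi) (val := val) e x).
have h : 2 * F ec <= F (2 * ec - e) + F e.
  rewrite /F /Emean -avgZ -avgD; apply: avg_le => // x.
  have := logZ_midpoint s0 chi (2 * ec - e) e (fun c => val (x c)).
  by rewrite subrK [2 * ec]mulrC mulfK.
have q : ((2 * ec - e) ^+ 2 / 2) *+ #|I| + (e ^+ 2 / 2) *+ #|I| =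
    2 * ((ec ^+ 2 / 2) *+ #|I|) + ((e - ec) ^+ 2) *+ #|I|.
  rewrite -mulrnDl mulrnAr -mulrnDl; congr (_ *+ _).
  by field.
have := annealed_gap_ge0 (2 * ec - e); rewrite /annealed_gap -!/(F _).
move: q h; move: (F _) (F _) (F _) (_ *+ #|I|) (_ *+ #|I|) (_ *+ #|I|) (_ *+ #|I|) (ln _) => a b c q1 q2 q3 q4 A.
lra.
Qed.

End AnnealedGap.

(** * The overlap of two independent spin configurations *)

Section Rademacher.
Context {R : realType}.
Implicit Types x y : R.

Lemma cosh_le_small y : (expR y + expR (- y)) / 2 <= expR (y ^+ 2 / 2 * expR `|y|).
Proof.
have E : expR y + expR (- y) = expR `|y| + expR (- `|y|).
  by have [y0|y0] := leP 0 y; [rewrite ger0_norm|rewrite ltr0_norm// opprK addrC].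
rewrite E -[y ^+ 2]real_normK ?num_real//; move: `|y| (normr_ge0 y) => a a0.
apply: le_trans (expR_ge1Dx _).
have H : expR (a / 2) - expR (- (a / 2)) <= a * expR (a / 2).
  have h := @expR_sub1_le R a.
  have e1 : expR (a / 2) = expR (- (a / 2)) * expR a by rewrite -expRD; congr expR; lra.
  rewrite e1 -[X in _ - X]mulr1 -mulrBr mulrCA.
  by apply: ler_wpM2l => //; exact: expR_ge0.
have H0 : 0 <= expR (a / 2) - expR (- (a / 2)) by rewrite subr_ge0 ler_expR; lra.
have e2 (z : R) : expR z = expR (z / 2) ^+ 2 by rewrite expr2 -expRD; congr expR; lra.
rewrite (e2 a) (e2 (- a)) mulNr.
have uv : expR (a / 2) * expR (- (a / 2)) = 1 by rewrite expRxMexpNx_1.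
have H2 : (expR (a / 2) - expR (- (a / 2))) ^+ 2 <= (a * expR (a / 2)) ^+ 2.
  by rewrite ler_sqr ?nnegrE ?mulr_ge0 ?expR_ge0.
rewrite exprMn in H2; move: H2 uv; rewrite sqrrB.
move: (expR (a / 2)) (expR (- (a / 2))) => u v H2 uv; rewrite uv in H2.
by move: H2; move: (u ^+ 2) (v ^+ 2) => U V; move: (a ^+ 2) => A; lra.
Qed.

(** The bound near the origin spreads by [cosh (2 y) = 2 cosh y ^ 2 - 1 <= cosh y ^ 4]. *)
Lemma cosh_le_doubling k x :
  (expR x + expR (- x)) / 2 <= expR (x ^+ 2 / 2 * expR (`|x| / 2 ^+ k)).
Proof.
elim: k x => [|k IH] x; first by rewrite expr0 divr1; exact: cosh_le_small.
have h := IH (x / 2).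
have n2 : `|x / 2| = `|x| / 2 by rewrite normrM normfV (ger0_norm (ler0n R 2)).
rewrite n2 in h.
have -> : x ^+ 2 / 2 * expR (`|x| / 2 ^+ k.+1) =
    (x / 2) ^+ 2 / 2 * expR (`|x| / 2 / 2 ^+ k) * 4%:R.
  have -> : `|x| / 2 ^+ k.+1 = `|x| / 2 / 2 ^+ k by rewrite (exprS 2 k) invfM mulrA.
  by move: (expR _) => E; field.
rewrite expRM_natr.
have c0 : 0 <= (expR (x / 2) + expR (- (x / 2))) / 2.
  by rewrite divr_ge0// addr_ge0// expR_ge0.
apply: (@le_trans _ _ (((expR (x / 2) + expR (- (x / 2))) / 2) ^+ 4)); last first.
  by rewrite lerXn2r ?nnegrE ?expR_ge0.
have e2 (z : R) : expR z = expR (z / 2) ^+ 2 by rewrite expr2 -expRD; congr expR; lra.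
rewrite (e2 x) (e2 (- x)) mulNr.
have uv : expR (x / 2) * expR (- (x / 2)) = 1 by rewrite expRxMexpNx_1.
move: (expR (x / 2)) (expR (- (x / 2))) uv => u v uv.
have -> : (u ^+ 2 + v ^+ 2) / 2 = 2 * ((u + v) / 2) ^+ 2 - (u * v) by field.
rewrite uv; move: ((u + v) / 2) => c.
by rewrite -subr_ge0 (_ : _ - _ = (c ^+ 2 - 1) ^+ 2) ?sqr_ge0//; ring.
Qed.

Lemma cosh_le x : expR x + expR (- x) <= 2 * expR (x ^+ 2 / 2).
Proof.
have c0 : 0 < (expR x + expR (- x)) / 2 by rewrite divr_gt0// addr_gt0// expR_gt0.
suff h : ln ((expR x + expR (- x)) / 2) <= x ^+ 2 / 2.
  by move: h; rewrite -ler_expR lnK ?posrE//; lra.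
apply/ler_addgt0Pr => eps eps0.
pose M := x ^+ 2 / 2 * (`|x| * expR `|x|).
have x2 : 0 <= x ^+ 2 / 2 by rewrite divr_ge0// sqr_ge0.
have M0 : 0 <= M by rewrite mulr_ge0// mulr_ge0// expR_ge0.
pose k := (Num.truncn (M / eps)).+1.
have Mk : M / 2 ^+ k <= eps.
  rewrite ler_pdivrMr ?exprn_gt0// mulrC -ler_pdivrMr//.
  apply: ltW; apply: (lt_le_trans (truncnS_gt _)); rewrite -natrX ler_nat.
  exact: ltnW (ltn_expl _ _).
have L : ln ((expR x + expR (- x)) / 2) <= x ^+ 2 / 2 * expR (`|x| / 2 ^+ k).
  by rewrite -ler_expR lnK ?posrE//; exact: cosh_le_doubling.
apply: (le_trans L); apply: le_trans (lerD (lexx _) Mk).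
have z0 : 0 <= `|x| / 2 ^+ k by rewrite divr_ge0// exprn_ge0.
have z1 : `|x| / 2 ^+ k <= `|x|.
  by rewrite ler_pdivrMr ?exprn_gt0// ler_peMr// exprn_ege1// ler1n.
have h : expR (`|x| / 2 ^+ k) <= 1 + `|x| / 2 ^+ k * expR `|x|.
  have h1 := @expR_sub1_le R (`|x| / 2 ^+ k).
  have h2 : `|x| / 2 ^+ k * expR (`|x| / 2 ^+ k) <= `|x| / 2 ^+ k * expR `|x|.
    by apply: ler_wpM2l => //; rewrite ler_expR.
  lra.
apply: le_trans (ler_wpM2l x2 h) _.
rewrite /M le_eqVlt; apply/orP; left; apply/eqP.
by move: (expR _) (2 ^+ k)^-1 => a b; ring.
Qed.

End Rademacher.

Section Overlaps.
Context {R : realType} {N : nat}.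
Local Notation S := {ffun 'I_N -> bool}.
Implicit Types (s : S).

Lemma spin_sqr s i : spin R s i ^+ 2 = 1.
Proof. by rewrite /spin sqrr_sign. Qed.

Lemma sum_spin_expR_le (lam : 'I_N -> R) :
  \sum_(s : S) expR (\sum_i lam i * spin R s i) <=
  2 ^+ N * expR (\sum_i lam i ^+ 2 / 2).
Proof.
have -> : \sum_(s : S) expR (\sum_i lam i * spin R s i) =
    \prod_i (expR (lam i) + expR (- lam i)).
  transitivity (\prod_(i < N) \sum_(b : bool) expR (lam i * (-1) ^+ b)).
    rewrite bigA_distr_bigA; apply: eq_bigr => s _; exact: expR_sum.
  by apply: eq_bigr => i _; rewrite big_bool /= expr1 expr0 mulr1 mulrN1 addrC.
have -> : 2 ^+ N * expR (\sum_i lam i ^+ 2 / 2) = \prod_i (2 * expR (lam i ^+ 2 / 2)).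
  by rewrite big_split /= -expR_sum prodr_const card_ord.
by apply: ler_prod => i _; rewrite addr_ge0 ?expR_ge0//= cosh_le.
Qed.

Definition spin_overlap s s' : R := \sum_i spin R s i * spin R s' i.

Lemma spin_overlap_value s s' :
  exists d : 'I_N.+1, spin_overlap s s' = N%:R - 2 * d%:R.
Proof.
pose D := #|[pred i | s i != s' i]|.
have DN : (D < N.+1)%N by rewrite ltnS -[X in (_ <= X)%N](card_ord N) max_card.
exists (Ordinal DN); rewrite /spin_overlap /= /D -sum1_card natr_sum mulr_sumr.
rewrite [X in _ = X - _](_ : _ = \sum_(i < N) 1); last by rewrite sumr_const card_ord.
rewrite [X in _ - X]big_mkcond -sumrB; apply: eq_bigr => i _.
rewrite -topredE /= /spin; case: (s i) (s' i) => [] [] /=; rewrite ?expr0 ?expr1 ?mulr1 ?mulrN1 ?opprK; lra.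
Qed.

(** A Chernoff bound. The overlap takes at most [N + 1] values [k], and when it
    equals [k] the exponent is the linear function [(k / N) q - k^2 / (2 N)] of
    the overlap [q], whose exponential has mean at most 1. The number of values
    is the only loss. *)
Lemma overlap_second_moment s : (0 < N)%N ->
  \sum_s' expR (spin_overlap s s' ^+ 2 / (2 * N%:R)) <= N.+1%:R * 2 ^+ N.
Proof.
move=> N0; have NR : 0 < N%:R :> R by rewrite ltr0n.
have NN : N%:R != 0 :> R by rewrite gt_eqF.
pose k (d : 'I_N.+1) : R := N%:R - 2 * d%:R.
apply: (@le_trans _ _ (\sum_s' \sum_d
    expR (k d / N%:R * spin_overlap s s' - k d ^+ 2 / (2 * N%:R)))).
  apply: ler_sum => s' _; have [d hd] := spin_overlap_value s s'.
  rewrite (bigD1 d)//= /k -hd; set q := spin_overlap _ _.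
  have -> : q / N%:R * q - q ^+ 2 / (2 * N%:R) = q ^+ 2 / (2 * N%:R) by field.
  by rewrite lerDl sumr_ge0// => *; exact: expR_ge0.
have -> : N.+1%:R * 2 ^+ N = \sum_(d < N.+1) 2 ^+ N :> R.
  by rewrite sumr_const card_ord mulr_natl.
rewrite exchange_big /=.
apply: ler_sum => d _.
have -> : \sum_s' expR (k d / N%:R * spin_overlap s s' - k d ^+ 2 / (2 * N%:R)) =
    expR (- (k d ^+ 2 / (2 * N%:R))) *
    \sum_s' expR (\sum_i (k d / N%:R * spin R s i) * spin R s' i).
  rewrite mulr_sumr; apply: eq_bigr => s' _; rewrite -expRD addrC; congr expR.
  by congr (_ + _); rewrite mulr_sumr; apply: eq_bigr => i _; rewrite mulrA.
apply: le_trans (ler_wpM2l (expR_ge0 _) (sum_spin_expR_le _)) _.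
under eq_bigr do rewrite exprMn spin_sqr mulr1.
rewrite sumr_const card_ord mulrCA -expRD -[leRHS]mulr1.
have -> : - (k d ^+ 2 / (2 * N%:R)) + ((k d / N%:R) ^+ 2 / 2) *+ N = 0.
  by rewrite -[X in _ + X]mulr_natr; move: NN; move: (N%:R : R) (k d) => n a n0; field.
by rewrite expR0.
Qed.

End Overlaps.

(** * The Sherrington-Kirkpatrick model near its critical temperature *)

Section SherringtonKirkpatrick.
Context {R : realType} {N : nat}.
Hypothesis N0 : (0 < N)%N.
Local Notation S := {ffun 'I_N -> bool}.
Local Notation I := ('I_N * 'I_N)%type.

Definition pair_spin (s : S) (c : I) : R := spin R s c.1 * spin R s c.2.

Lemma pair_spinP s c : pair_spin s c = 1 \/ pair_spin s c = -1.
Proof.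
rewrite /pair_spin /spin; case: (s c.1) (s c.2) => [] [];
  rewrite ?expr0 ?expr1 ?mulr1 ?mulrN1 ?opprK; by [left|right].
Qed.

Lemma pair_spin_overlap e s s' :
  overlap pair_spin e s s' = e ^+ 2 * spin_overlap s s' ^+ 2.
Proof.
rewrite [spin_overlap _ _ ^+ 2]expr2 /overlap /spin_overlap big_distrlr pair_bigA /= mulr_sumr.
by apply: eq_bigr => c _; rewrite /pair_spin; congr (_ * _); ring.
Qed.

Lemma sk_free_energy_logZ beta (g : 'I_N -> 'I_N -> R) : sk_free_energy beta g =
  logZ pair_spin (beta / Num.sqrt N%:R) (fun c => g c.1 c.2).
Proof.
rewrite /sk_free_energy /logZ; congr ln; apply: eq_bigr => s _; congr expR.
rewrite /sk_hamiltonian /field pair_bigA /= mulrA mulr_sumr.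
by apply: eq_bigr => c _; rewrite /pair_spin; ring.
Qed.

Let NR : 0 < N%:R :> R. Proof. by rewrite ltr0n. Qed.
Let s0 : S := [ffun=> false].
Let cardS : #|{: S}| = (2 ^ N)%N.
Proof. by rewrite card_ffun card_bool card_ord. Qed.
Let cardI : #|{: I}|%:R = N%:R * N%:R :> R.
Proof. by rewrite card_prod card_ord natrM. Qed.

Let cardIn (x : R) : x *+ #|{: I}| = x * (N%:R * N%:R).
Proof. by rewrite -cardI mulr_natr. Qed.

(** For [a = beta_c^2 / N] this is the second moment of the partition function at
    the critical temperature, relative to its squared mean. *)
Lemma ln_overlap_le a : a * (2 * N%:R) = 1 ->
  ln (\sum_(s : S) \sum_(s' : S) expR (a * spin_overlap (R := R) s s' ^+ 2)) <=
  2 * ln #|{: S}|%:R + ln N.+1%:R.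
Proof.
move=> ha; have n2 : 2 * N%:R != 0 :> R by rewrite mulf_neq0 ?pnatr_eq0// gt_eqF.
have -> : a = (2 * N%:R)^-1 by apply: (mulIf n2); rewrite ha mulVf.
have S0 : 0 < #|{: S}|%:R :> R by rewrite cardS ltr0n expn_gt0.
have -> : 2 * ln #|{: S}|%:R + ln N.+1%:R =
    ln (#|{: S}|%:R * #|{: S}|%:R * N.+1%:R) :> R.
  have M0 : 0 < N.+1%:R :> R by rewrite ltr0n.
  rewrite (lnM (mulr_gt0 S0 S0) M0) (lnM S0 S0).
  by congr (_ + _); rewrite mulr_natl.
rewrite ler_ln ?posrE; first last.
- by rewrite !mulr_gt0.
- rewrite lt_neqAle; apply/andP; split; last first.
    by apply: sumr_ge0 => s _; apply: sumr_ge0 => s' _; exact: expR_ge0.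
  rewrite eq_sym psumr_neq0 => [|s _]; last by apply: sumr_ge0 => s' _; exact: expR_ge0.
  apply/hasP; exists s0; rewrite ?mem_index_enum//=.
  exact: (partition_gt0 s0).
have -> : #|{: S}|%:R * #|{: S}|%:R * N.+1%:R = \sum_(s : S) #|{: S}|%:R * N.+1%:R :> R.
  by rewrite sumr_const -mulrA mulr_natl.
apply: ler_sum => s _.
under eq_bigr do rewrite mulrC.
by rewrite cardS natrX [leRHS]mulrC; exact: overlap_second_moment.
Qed.

Variable m : nat.
(* The rounding errors of all [N ^ 2] coordinates contribute [O(1)] together. *)
Hypothesis hm : (36 * N ^ 2 <= m)%N.
Let m0 : (0 < m)%N.
Proof. by apply: leq_trans hm; rewrite muln_gt0 expn_gt0 N0. Qed.
Local Notation mcell := (measurable_rcell (R := R) m0).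
Local Notation p := (cellw (R := R) (cell := rcell (R := R) m)).
Local Notation gap := (annealed_gap (I := ('I_N * 'I_N)%type) (chi := pair_spin) (p := p)
  (val := rval (R := R) (m := m))).
Let hp : weight p := weight_cellw mcell.
Let mgf := rounded_mgf (R := R) m0.

(** The second moment bound [ln_overlap_le] loses a factor [N + 1] at the
    critical temperature; the error [e^4] of [mean_free_ge] for each of the [N^2]
    coordinates and the rounding error contribute 1/4 each. *)
Lemma critical_gap_le e : e ^+ 2 * (2 * N%:R) = 1 -> 0 <= e -> gap e <= ln N.+1%:R + 2^-1.
Proof.
move=> he e0.
have := mean_free_ge s0 pair_spinP mcell (val := rval (R := R) (m := m)) e.
have := ln_overlap_le he.
under eq_bigr do under eq_bigr do rewrite -pair_spin_overlap.
rewrite /annealed_gap; have := gmean_rerr1 (R := R) m0; rewrite /rerr.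
rewrite !cardIn (ger0_norm e0).
move: (Emean _) (ln (\sum_s _)) (ln #|_|%:R) (ln N.+1%:R) => E L A l.
set eta := gmean _ => heta hL hE.
have NN1 : 1 <= N%:R :> R by rewrite ler1n.
have e1 : e <= 1 by move: he NN1; move: (N%:R : R) => n; nra.
have hn : eta * (N%:R * N%:R) <= 4^-1.
  have n2 : 0 <= N%:R * N%:R :> R by rewrite mulr_ge0.
  apply: (le_trans (ler_wpM2r n2 heta)).
  have hm' : 36 * (N%:R * N%:R) <= m%:R :> R.
    by rewrite -natrM -(natrM R 36) ler_nat mulnn.
  have mp : 0 < m%:R :> R by rewrite ltr0n.
  rewrite mulrAC ler_pdivrMr//; move: hm'; move: (N%:R * N%:R) (m%:R : R) => q M; lra.
have h4 : e ^+ 4 * (N%:R * N%:R) = 4^-1.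
  have -> : e ^+ 4 * (N%:R * N%:R) = (e ^+ 2 * (2 * N%:R)) ^+ 2 / 4 by field.
  by rewrite he expr1n mul1r.
have h5 : e * eta * (N%:R * N%:R) <= 4^-1.
  have eta0 : 0 <= eta * (N%:R * N%:R).
    rewrite mulr_ge0 ?mulr_ge0//; apply: fine_ge0; apply: integral_ge0 => x _.
    by rewrite lee_fin.
  rewrite -mulrA; move: eta0 hn; move: (eta * _) => z; nra.
move: hE h4 h5; rewrite !mulrBl; move: (e ^+ 4 * _) (e * eta * _) (e ^+ 2 / 2 * _) => a b c.
by lra.
Qed.

Lemma annealed_gap_le e ec : ec ^+ 2 * (2 * N%:R) = 1 -> 0 <= ec -> ec <= e ->
  gap e <= 2 * ln N.+1%:R + 1 + N%:R * (e ^+ 2 * N%:R - 2^-1) ^+ 2 / 2.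
Proof.
move=> hc c0 ce; have h := critical_gap_le hc c0.
have := annealed_gap_midpoint s0 pair_spinP hp mgf ec e; rewrite cardIn => h1.
apply: (le_trans h1).
have hn : (e - ec) ^+ 2 * (N%:R * N%:R) <= N%:R * (e ^+ 2 * N%:R - 2^-1) ^+ 2 / 2.
  have -> : N%:R * (e ^+ 2 * N%:R - 2^-1) ^+ 2 / 2 =
      N%:R * (e ^+ 2 * N%:R - ec ^+ 2 * N%:R) ^+ 2 / 2.
    by congr (_ * _ ^+ 2 / 2); move: hc; lra.
  have -> : N%:R * (e ^+ 2 * N%:R - ec ^+ 2 * N%:R) ^+ 2 / 2 =
      (e - ec) ^+ 2 * (N%:R * N%:R) * (N%:R * (e + ec) ^+ 2 / 2) by field.
  apply: ler_peMr; first by rewrite mulr_ge0 ?sqr_ge0// mulr_ge0.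
  have : (2 * ec) ^+ 2 <= (e + ec) ^+ 2 by rewrite ler_sqr ?nnegrE; lra.
  rewrite exprMn => h2; have h3 := ler_wpM2l (ltW NR) h2; move: h3 hc.
  move: (N%:R * (e + ec) ^+ 2) => z; lra.
by move: h hn; move: (gap ec) (ln _) (_ * (N%:R * N%:R)) (_ / 2) => a b c d; lra.
Qed.

(** With [tc = 1 / (2 s)] the interaction at level [tc] is the critical one. The
    last dyadic step is chosen such that the levels near [tc] contribute
    [O(1)]. *)
Lemma rounded_variance_le s e : 2^-1 <= s -> 0 <= e -> e ^+ 2 * N%:R = s ->
  Emean (p := p) (fun x : {ffun I -> _} =>
    (free_energy (chi := pair_spin) (val := rval (R := R) (m := m)) e x -
     Emean (p := p) (free_energy (chi := pair_spin) (val := rval (R := R) (m := m)) e)) ^+ 2)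
  <= 32 * (trunc_log 2 N).+1%:R *
      (expR s * s ^+ 2 + 5 * ln N.+1%:R + 2 + N%:R * (s - 2^-1) ^+ 2) +
     32 * (s - 2^-1) * N%:R + 32 * s + 7168 * s ^+ 2.
Proof.
move=> hs e0 es.
have s_gt0 : 0 < s by apply: lt_le_trans hs; rewrite invr_gt0.
have s0' : s != 0 by rewrite gt_eqF.
pose ec : R := (Num.sqrt (2 * N%:R))^-1.
have n2 : 0 < 2 * N%:R :> R by rewrite mulr_gt0.
have c0 : 0 <= ec by rewrite invr_ge0 sqrtr_ge0.
have hc : ec ^+ 2 * (2 * N%:R) = 1.
  by rewrite /ec exprVn sqr_sqrtr ?ltW// mulVf// gt_eqF.
have ce : ec <= e.
  rewrite -(ler_sqr (x := ec)) ?nnegrE// -(ler_pM2r n2) hc.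
  by move: es; move: (e ^+ 2) (N%:R : R) => E n; lra.
have hgap := annealed_gap_le hc c0 ce; rewrite es in hgap.
have e2s : e ^+ 2 <= s.
  by rewrite -es ler_peMr ?sqr_ge0// ler1n.
have hnn : e ^+ 2 * (N%:R * N%:R) = s * N%:R by rewrite mulrA es.
have h4 : e ^+ 4 * (N%:R * N%:R) = s ^+ 2 by rewrite -es; ring.
pose tc : R := (2 * s)^-1.
have tcs : tc * s = 2^-1 by rewrite /tc invfM -mulrA mulVf// mulr1.
have tc1 : 0 < tc <= 1.
  by rewrite invr_gt0 mulr_gt0//= invf_le1 ?mulr_gt0//; move: hs; lra.
have htc : tc * e ^+ 2 * (2 * N%:R) = 1.
  rewrite (_ : _ * _ = tc * (e ^+ 2 * N%:R) * 2); last by ring.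
  by rewrite es tcs mulVf.
pose B := expR s * s ^+ 2 + 5 * ln N.+1%:R + 2 + N%:R * (s - 2^-1) ^+ 2.
have l0 : 0 <= ln N.+1%:R :> R by rewrite ln_ge0// ler1n.
have B0 : 0 <= B.
  rewrite /B; apply: addr_ge0; last by rewrite mulr_ge0 ?sqr_ge0.
  apply: addr_ge0 => //; apply: addr_ge0; last by rewrite mulr_ge0.
  by rewrite mulr_ge0 ?expR_ge0 ?sqr_ge0.
have hB t : 0 <= t < tc ->
    (tc - t) * replica (chi := pair_spin) (p := p) (val := rval (R := R) (m := m)) e t <= B.
  move=> /andP[t0 ttc].
  have t1 : 0 <= t <= 1 by rewrite t0 (le_trans (ltW ttc))//; case/andP: tc1.
  apply: (le_trans (replica_annealed s0 pair_spinP hp mgf e tc t1)).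
  have := ln_overlap_le htc.
  under eq_bigr do under eq_bigr do rewrite -mulrA -pair_spin_overlap.
  move: hgap; rewrite /annealed_gap !cardIn [(_ + expR _ * _) * _]mulrDl hnn -[expR _ * _ * _]mulrA h4.
  have hx : expR (e ^+ 2) * s ^+ 2 <= expR s * s ^+ 2.
    by apply: ler_wpM2r; [exact: sqr_ge0|rewrite ler_expR].
  rewrite [e ^+ 2 / 2 * _]mulrAC hnn /B; move: hx.
  move: (expR _ * _) (expR _ * _) (Emean _) (ln (\sum_s _)) (ln #|_|%:R) (ln N.+1%:R)
    (s * N%:R) (N%:R * _) => x1 x2 E L A l sn u.
  by lra.
apply: (le_trans (variance_free_le s0 pair_spinP hp mgf (trunc_log 2 N).+1 tc1 B0 hB)).
rewrite !cardIn hnn h4 -/B -[32 * B *+ _]mulr_natr.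
have hk : 2^-1 ^+ (trunc_log 2 N).+1 * N%:R <= 1 :> R.
  rewrite exprVn mulrC ler_pdivrMr ?exprn_gt0// mul1r -natrX ler_nat ltnW//.
  exact: trunc_log_ltn.
have hk' : s * (2^-1 ^+ (trunc_log 2 N).+1 * N%:R) <= s * 1 by apply: ler_wpM2l => //; exact: ltW.
rewrite (_ : 32 * (1 - tc + _) * (s * N%:R) = 32 * ((s - tc * s) * N%:R) +
  32 * (s * (2^-1 ^+ (trunc_log 2 N).+1 * N%:R))); last by ring.
rewrite tcs; rewrite mulrAC -[32 * (s - _) * N%:R]mulrA.
move: (32 * _ * B) ((s - 2^-1) * N%:R) (s ^+ 2) hk'; move: (s * (_ * _)) => z a b c; lra.
Qed.

End SherringtonKirkpatrick.

Section SKVariance.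
Context {R : realType}.

Lemma sk_variance_le (N : nat) (disp : measure_display) (T : measurableType disp)
    (P : probability T R) (g : 'I_N -> 'I_N -> {RV P >-> R}) (beta s : R) :
  (0 < N)%N -> gaussian_disorder g -> 0 <= beta -> beta ^+ 2 = s -> 2^-1 <= s ->
  ('V_P[sk_free_energy_rv beta g] <=
   (65 * s + 14336 * s ^+ 2 + 64 * (trunc_log 2 N).+1%:R *
      (expR s * s ^+ 2 + 5 * ln N.+1%:R + 2 + N%:R * (s - 2^-1) ^+ 2) +
     64 * (s - 2^-1) * N%:R)%:E)%E.
Proof.
move=> N0 [hG hI] b0 bs hs; have NR : 0 < N%:R :> R by rewrite ltr0n.
have NN : N%:R != 0 :> R by rewrite gt_eqF.
(* The mesh is hidden behind a variable, lest [36 * N ^ 2] be evaluated. *)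
have [m hm] : exists m, (36 * N ^ 2 <= m)%N by exists (36 * N ^ 2)%N.
have m0 : (0 < m)%N by apply: leq_trans hm; rewrite muln_gt0 expn_gt0 N0.
pose e := beta / Num.sqrt N%:R.
have e0 : 0 <= e by rewrite divr_ge0 ?sqrtr_ge0.
have es : e ^+ 2 * N%:R = s by rewrite /e expr_div_n sqr_sqrtr ?ltW// bs mulfVK.
pose G (c : 'I_N * 'I_N) := g c.1 c.2.
have -> : sk_free_energy_rv beta g = (fun w => logZ (@pair_spin R N) e (fun c => G c w)).
  by apply/funext => w; rewrite /sk_free_energy_rv sk_free_energy_logZ.
have hv := rounded_variance_le N0 hm hs e0 es.
have hr := gmean_rerr2 (R := R) m0; rewrite /rerr in hr.
have := variance_transfer [ffun=> false] (@pair_spinP R N) (measurable_rcell (R := R) m0)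
  (expgrowth_rerr2 m0) e (Emean (p := cellw (R := R) (cell := rcell (R := R) m))
    (free_energy (chi := @pair_spin R N) (val := rval (R := R) (m := m)) e))
  (G := G) (fun c => hG c.1 c.2) hI.
move/le_trans; apply; rewrite lee_fin card_prod card_ord natrM.
move: hv hr; move: (Emean _) (gmean _) => V q hv hr.
have hq : 2 * e ^+ 2 * (N%:R * N%:R) * (N%:R * N%:R * q) <= s.
  have -> : 2 * e ^+ 2 * (N%:R * N%:R) * (N%:R * N%:R * q) =
      e ^+ 2 * N%:R * (2 * (N%:R * (N%:R * N%:R)) * q) by ring.
  rewrite es; apply: ler_piMr; first by move: hs; lra.
  have hm' : 36 * N%:R ^+ 2 <= m%:R :> R by rewrite -natrX -(natrM R 36) ler_nat.
  have N1 : 1 <= N%:R :> R by rewrite ler1n.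
  have n3 : 0 <= 2 * (N%:R * (N%:R * N%:R)) :> R by rewrite !mulr_ge0.
  apply: (le_trans (ler_wpM2l n3 hr)).
  have mm : (36 * N%:R ^+ 2) ^+ 2 <= m%:R ^+ 2 :> R.
    by rewrite ler_sqr ?nnegrE ?mulr_ge0 ?sqr_ge0.
  have mp : 0 < m%:R ^+ 2 :> R by rewrite exprn_gt0// ltr0n.
  rewrite [leLHS]mulrA ler_pdivrMr// mul1r; apply: le_trans mm.
  move: N1; move: (N%:R : R) => n n1.
  have -> : (36 * n ^+ 2) ^+ 2 = 1296 * (n * (n * n)) * n by ring.
  have k0 : 0 <= n * (n * n) by rewrite !mulr_ge0// (le_trans ler01).
  by move: (n * (n * n)) k0 => k k0; nra.
move: hv hq; rewrite -!mulrA; move: (2 * _) ((_.+1)%:R * _) ((s - _) * _) (s ^+ 2) => a b c w.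
by lra.
Qed.

Lemma ln2_ge : 2^-1 <= ln 2 :> R.
Proof. by rewrite -ler_expR lnK ?posrE//; exact: expR_half_le2. Qed.

Lemma ln2_le : ln 2 <= 1 :> R.
Proof. by rewrite -ler_expR lnK ?posrE//; have := expR_ge1Dx (1 : R); lra. Qed.

Lemma trunc_log_le (N : nat) : (0 < N)%N ->
  (trunc_log 2 N).+1%:R <= 1 + 2 * ln N%:R :> R.
Proof.
move=> N0; set k := trunc_log 2 N; have NR : 0 < N%:R :> R by rewrite ltr0n.
have h : k%:R * ln 2 <= ln N%:R :> R.
  rewrite mulr_natl -lnXn// ler_ln ?posrE ?exprn_gt0// -natrX ler_nat.
  exact: trunc_logP.
have h2 := ler_wpM2l (ler0n R k) ln2_ge.
rewrite -(natr1 k); move: h h2; move: (k%:R : R) (_ * ln 2) => K l; lra.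
Qed.

Lemma lnS_le (N : nat) : (0 < N)%N -> ln N.+1%:R <= 1 + ln N%:R :> R.
Proof.
move=> N0; have NR : 0 < N%:R :> R by rewrite ltr0n.
apply: le_trans (lerD ln2_le (lexx _)); rewrite -lnM ?posrE//.
rewrite ler_ln ?posrE ?mulr_gt0// -natrM ler_nat mul2n -addnn -addn1 leq_add2l//.
Qed.

Lemma sk_variance_log_le (N : nat) (disp : measure_display) (T : measurableType disp)
    (P : probability T R) (g : 'I_N -> 'I_N -> {RV P >-> R}) (beta s : R) :
  (0 < N)%N -> gaussian_disorder g -> 0 <= beta -> beta ^+ 2 = s -> 2^-1 <= s ->
  ('V_P[sk_free_energy_rv beta g] <=
   ((65 * s + 14336 * s ^+ 2 + 64 * (3 * (expR s * s ^+ 2) + 36)) *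
      (ln N%:R ^+ 2 + 1) +
    64 * ((1 + 2 * ln N%:R) * (N%:R * (s - 2^-1) ^+ 2)) + 64 * ((s - 2^-1) * N%:R))%:E)%E.
Proof.
move=> N0 hg b0 bs hs; apply: (le_trans (sk_variance_le N0 hg b0 bs hs)).
rewrite lee_fin.
have L0 : 0 <= ln N%:R :> R by rewrite ln_ge0// ler1n.
have hK := trunc_log_le N0; have hl := lnS_le N0.
have E0 : 0 <= expR s * s ^+ 2 by rewrite mulr_ge0 ?expR_ge0 ?sqr_ge0.
have U0 : 0 <= N%:R * (s - 2^-1) ^+ 2 by rewrite mulr_ge0 ?sqr_ge0.
have S0 : 0 <= 65 * s + 14336 * s ^+ 2 by have := sqr_ge0 s; move: hs; lra.
have K0 := ler0n R (trunc_log 2 N).+1.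
rewrite -!(mulrA 64); move: S0; set a := _ + 14336 * _.
move: a (expR s * _) (N%:R * _) ((_ - _) * _) hK hl L0 E0 U0 K0.
move: (_.+1%:R) (ln N.+1%:R) (ln N%:R) => K l L a E U u hK hl L0 E0 U0 K0 a0.
have h1 : K * (E + 5 * l + 2 + U) <= (1 + 2 * L) * (E + 5 * L + 7 + U).
  by apply: (le_trans (ler_wpM2l K0 (_ : _ <= E + 5 * L + 7 + U)));
    [lra|apply: ler_wpM2r => //; lra].
have h2 : (1 + 2 * L) * (E + 5 * L + 7) <= (3 * E + 36) * (L ^+ 2 + 1).
  have q := sqr_ge0 (L - 1); have EL : 0 <= E * (L - 1) ^+ 2 by rewrite mulr_ge0.
  have EL2 : 0 <= E * L ^+ 2 by rewrite mulr_ge0 ?sqr_ge0.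
  by nra.
have h3 : a <= a * (L ^+ 2 + 1) by apply: ler_peMr => //; have := sqr_ge0 L; lra.
have -> : (a + 64 * (3 * E + 36)) * (L ^+ 2 + 1) =
  a * (L ^+ 2 + 1) + 64 * ((3 * E + 36) * (L ^+ 2 + 1)) by ring.
have h4 : (1 + 2 * L) * (E + 5 * L + 7 + U) =
  (1 + 2 * L) * (E + 5 * L + 7) + (1 + 2 * L) * U by ring.
rewrite h4 in h1; by clear -h1 h2 h3; lra.
Qed.

Lemma beta_c_sqr : beta_c R ^+ 2 = 2^-1.
Proof. by rewrite /beta_c expr_div_n expr1n sqr_sqrtr// mul1r. Qed.

Lemma ln_powR_le (N : nat) (alpha : R) : (0 < N)%N -> 0 < alpha ->
  ln N%:R * N%:R `^ (- alpha) <= alpha^-1.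
Proof.
move=> N0 a0; have NR : 0 < N%:R :> R by rewrite ltr0n.
rewrite powRN ler_pdivrMr ?powR_gt0// mulrC ler_pdivlMr//.
rewrite mulrC -ln_powR; have := @ln_sublinear R _ (powR_gt0 alpha NR); exact: ltW.
Qed.

(** Constants are absorbed by [ln N ^ 2] if [N >= 2], and by the power, which is
    1, if [N = 1]. *)
Lemma sqr_ln_powR_ge (N : nat) (b : R) : (0 < N)%N ->
  ln N%:R ^+ 2 + 1 <= 5 * (ln N%:R ^+ 2 + N%:R `^ b).
Proof.
case: N => [|[|N]] // _.
  by rewrite powR1 ln1 expr0n /= !add0r mulr1 ler1n.
have l2 : 2^-1 <= ln N.+2%:R :> R.
  by apply: (le_trans ln2_ge); rewrite ler_ln ?posrE ?ltr0n// ler_nat.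
move: l2 (powR_ge0 (N.+2%:R : R) b); move: (ln _) (_ `^ b) => l y; nra.
Qed.

End SKVariance.

Theorem theorem1 (R : realType) :
  (exists C : R, 0 < C /\
    forall (N : nat), (1 <= N)%N ->
    forall (disp : measure_display) (T : measurableType disp)
      (P : probability T R) (g : 'I_N -> 'I_N -> {RV P >-> R}),
      gaussian_disorder g ->
      ('V_P[sk_free_energy_rv (beta_c R) g]
         <= (C * (ln (N%:R : R) ^+ 2 + 1))%:E)%E)
  /\
  (forall (alpha d : R), 0 < alpha -> 0 < d ->
    exists C : R,
    forall (N : nat), (1 <= N)%N ->
    forall (disp : measure_display) (T : measurableType disp)
      (P : probability T R) (g : 'I_N -> 'I_N -> {RV P >-> R}),
      gaussian_disorder g ->
      ('V_P[sk_free_energy_rv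
              (Num.sqrt (beta_c R ^+ 2 + d * (N%:R : R) `^ (- alpha))) g]
         <= (C * (ln (N%:R : R) ^+ 2 + (N%:R : R) `^ (1 - alpha)))%:E)%E).
Proof.
pose a (s : R) := 65 * s + 14336 * s ^+ 2 + 64 * (3 * (expR s * s ^+ 2) + 36).
have half0 : 0 < 2^-1 :> R by rewrite invr_gt0.
have a_mono s s' : 2^-1 <= s -> s <= s' -> a s <= a s'.
  move=> s1 s2.
  have q : s ^+ 2 <= s' ^+ 2 by rewrite ler_sqr ?nnegrE//; lra.
  have eq : expR s * s ^+ 2 <= expR s' * s' ^+ 2.
    by apply: ler_pM => //; rewrite ?expR_ge0 ?sqr_ge0// ler_expR.
  by rewrite /a; move: q eq; move: (_ ^+ 2) (_ ^+ 2) (_ * _) (_ * _) => x y z w; lra.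
have a_gt0 s : 2^-1 <= s -> 0 < a s.
  move=> s1; have q : 0 <= expR s * s ^+ 2 by rewrite mulr_ge0 ?expR_ge0 ?sqr_ge0.
  by have := sqr_ge0 s; rewrite /a; move: q; move: (_ * s ^+ 2) => z; lra.
have combine z1 z2 A q d L Y : z1 <= A * (5 * (L + Y)) -> z2 <= q * Y ->
    0 <= q * L -> 0 <= d * L ->
    z1 + 64 * z2 + 64 * (d * Y) <= (5 * A + 64 * (q + d)) * (L + Y) :> R.
  by clear; move=> h1 h2 h3 h4; lra.
split.
  exists (a 2^-1); split; first exact: a_gt0.
  move=> N N0 disp T P g hg.
  have bc0 : 0 <= beta_c R by rewrite /beta_c divr_ge0 ?sqrtr_ge0.
  have h := sk_variance_log_le N0 hg bc0 beta_c_sqr (lexx _).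
  apply: (le_trans h).
  by rewrite lee_fin subrr expr0n /= !mulr0 mul0r mulr0 !addr0.
move=> alpha d a0 d0; exists (5 * a (2^-1 + d) + 64 * (d ^+ 2 * (1 + 2 / alpha) + d)).
move=> N N0 disp T P g hg; have NR : 0 < N%:R :> R by rewrite ltr0n.
set x := N%:R `^ (- alpha); pose s := 2^-1 + d * x.
have x0 : 0 <= x by exact: powR_ge0.
have x1 : x <= 1.
  rewrite /x powRN invf_le1 ?powR_gt0//; apply: (le_trans _ (ler_powR _ (ltW a0))).
    by rewrite powRr0.
  by rewrite ler1n.
have dx0 : 0 <= d * x by rewrite mulr_ge0// ltW.
have hs : 2^-1 <= s by rewrite lerDl.
have hs' : s <= 2^-1 + d by rewrite lerD2l ler_piMr// ltW.
rewrite beta_c_sqr -/s.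
have sb : Num.sqrt s ^+ 2 = s by rewrite sqr_sqrtr// (le_trans _ hs)// ltW.
have h := sk_variance_log_le N0 hg (sqrtr_ge0 s) sb hs.
apply: (le_trans h).
rewrite lee_fin -/(a s).
have h1 := sqr_ln_powR_ge (1 - alpha) N0.
have E : N%:R `^ (1 - alpha) = N%:R * x.
  rewrite -[X in X * x](powRr1 (ltW NR)) -powRD//.
  by apply/implyP => _; rewrite gt_eqF.
rewrite E in h1 *.
have us : s - 2^-1 = d * x by rewrite /s addrC addKr.
rewrite us.
have L0 : 0 <= ln N%:R :> R by rewrite ln_ge0// ler1n.
have Lx : ln N%:R * x <= alpha^-1 by exact: ln_powR_le.
have Y0 : 0 <= N%:R * x by rewrite mulr_ge0// ltW.
have h2 : a s <= a (2^-1 + d) by exact: a_mono.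
have h3 : (1 + 2 * ln N%:R) * (N%:R * (d * x) ^+ 2) <=
    d ^+ 2 * (1 + 2 / alpha) * (N%:R * x).
  have -> : (1 + 2 * ln N%:R) * (N%:R * (d * x) ^+ 2) =
    d ^+ 2 * (x + 2 * (ln N%:R * x)) * (N%:R * x) by ring.
  apply: ler_wpM2r => //; apply: ler_wpM2l; first exact: sqr_ge0.
  by apply: lerD => //; apply: ler_wpM2l.
have -> : d * x * N%:R = d * (N%:R * x) by ring.
have L2 := sqr_ge0 (ln N%:R : R).
have h4 : a s * (ln N%:R ^+ 2 + 1) <= a (2^-1 + d) * (5 * (ln N%:R ^+ 2 + N%:R * x)).
  by apply: ler_pM => //; [exact: ltW (a_gt0 _ hs)|rewrite addr_ge0].
have q0 : 0 <= d ^+ 2 * (1 + 2 / alpha).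
  by rewrite mulr_ge0 ?sqr_ge0// addr_ge0// divr_ge0// ltW.
exact: (combine _ _ _ _ _ _ _ h4 h3 (mulr_ge0 q0 L2) (mulr_ge0 (ltW d0) L2)).
Qed.
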